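(* Let $\Omega\subset\mathbb{R}^2$ be either $\mathbb{R}^2$, or an exterior domain with smooth boundary, or a perturbed half-space with smooth boundary, and let $T>0$. Let $\omega_0=\partial_1v_0^2-\partial_2v_0^1\in L^2(\Omega)$, and let $v\in C^\infty(\bar\Omega\times[0,T))$ be a bounded solution (with pressure $p$) of \[ \begin{cases} v_t-\Delta v+(v\cdot\nabla)v+\nabla p=0, & (x,t)\in\Omega\times(0,T),\\ \operatorname{div}v=0, & (x,t)\in\Omega\times(0,T),\\ v(x,t)=0, & x\in\partial\Omega,\\ v(x,0)=v_0(x), & x\in\Omega. \end{cases} \] Let $t\in(0,T)$. Assume that $\omega=\partial_1v^2-\partial_2v^1$ satisfies \[ \varepsilon_\omega(t):=\lim_{R\to\infty}\left(\sup_{(x,\tau)\in(\Omega\cap\{|x|\ge R\})\times(0,t)}|x|^{1/2}|\omega(x,\tau)|\right)<\infty \] and, for the same $t$, \[ \frac{\partial\omega}{\partial\nu}\,\omega\in L^1(\partial\Omega\times(0,t))\quad\text{and}\quad\int_0^t\int_{\partial\Omega}\frac{\partial\omega}{\partial\nu}(x,\tau)\,\omega(x,\tau)\,dS\,d\tau\le0 . \] Then \[ \omega\in L^\infty(0,t;L^2(\Omega)),\quad\nabla\omega\in L^2(0,t;L^2(\Omega)) \] with the estimate \[ \|\omega(t)\|_{L^2(\Omega)}^2+2\int_0^t\|\nabla\omega(\tau)\|_{L^2(\Omega)}^2\,d\tau\le\|\omega(0)\|_{L^2(\Omega)}^2+C_0\,t\,\|v\|_{L^\infty(\Omega\times(0,t))}\,\varepsilon_\omega(t)^2,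 \] where $C_0>0$ is an absolute constant.
   Context: $v=(v^1,v^2)$ is the velocity field, $v_0=(v_0^1,v_0^2)$ the initial velocity, and $p$ the scalar pressure. $\frac{\partial}{\partial\nu}$ denotes the normal derivative on $\partial\Omega$, with $\nu$ the unit outward normal. An exterior domain is the complement of a compact set; a perturbed half-space is a domain that coincides with the half-plane $\mathbb{R}^2_+$ outside some ball. When $\Omega=\mathbb{R}^2$ there is no boundary, and the conditions on $\partial\Omega$ are void. *)

(* Defs.v *)
From HB Require Import structures.
From mathcomp Require Import all_boot all_order all_algebra.
From mathcomp Require Import all_classical all_reals all_analysis.

Set Implicit Arguments.
Unset Strict Implicit.
Unset Printing Implicit Defensive.

Import Order.TTheory GRing.Theory Num.Theory.
Import numFieldNormedType.Exports.

Local Open Scope classical_set_scope.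
Local Open Scope ring_scope.

(* [measurableTypeR R] is convertible to [R]; it is the alias of [R] on which
   the library defines [lebesgue_measure]. *)
Notation mplane R := (measurableTypeR R * measurableTypeR R)%type.
Notation leb1 := lebesgue_measure.
Notation leb2 := (leb1 \x leb1)%E.
Notation leb3 := (leb2 \x leb1)%E.

Section smoothness.
Context {R : realType} {V W : normedModType R}.

Definition iter_derive (s : seq V) (f : V -> W) : V -> W :=
  foldr (fun e g z => 'D_e g z) f s.

(* With D open and D `<=` E `<=` closure D: f is C^oo on D, and f as well as
   each of its derivatives extends continuously to E.  For V = R^2 x R,
   D = Omega x ]0, T[ and E = closure Omega x [0, T[, this is
   f \in C^oo(closure Omega x [0, T[). *)
Definition smooth_up_to (D E : set V) (f : V -> W) : Prop :=
  {within E, continuous f} /\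
  forall s : seq V,
    (forall z e, D z -> derivable (iter_derive s f) z e) /\
    exists2 g : V -> W, {within E, continuous g} &
      forall z, D z -> g z = iter_derive s f z.

End smoothness.

Section plane_geometry.
Context {R : realType}.
Implicit Types (Omega U : set (R * R)) (x u w n nu : R * R) (gamma : R -> R).

Definition dot u w : R := u.1 * w.1 + u.2 * w.2.

(* The norm [`|x|] of the product type [R * R] is the maximum norm. *)
Definition enorm x : R := Num.sqrt (dot x x).

Definition rot n : R * R := (n.2, - n.1).

Definition boundary Omega : set (R * R) := closure Omega `\` interior Omega.

Definition is_domain Omega : Prop := [/\ open Omega, connected Omega & Omega !=set0].

Definition exterior_domain Omega : Prop := is_domain Omega /\ compact (~` Omega).

Definition perturbed_half_space Omega : Prop :=
  is_domain Omega /\ exists r : R, forall x, r <= enorm x -> (Omega x <-> 0 < x.2).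

(* In the positively oriented orthonormal frame (rot n, n), the part of Omega in
   the open set U is the part of U lying above the graph of gamma. *)
Definition graph_chart Omega U n gamma : Prop :=
  [/\ open U, enorm n = 1,
      forall k s, derivable (derive1n k gamma) s 1 &
      forall x, U x -> (Omega x <-> gamma (dot (rot n) x) < dot n x)].

Definition smooth_boundary Omega : Prop :=
  forall x, boundary Omega x -> exists U n gamma, graph_chart Omega U n gamma /\ U x.

Definition graph_point n gamma (s : R) : R * R := s *: rot n + gamma s *: n.

Definition arc_element gamma (s : R) : R :=
  Num.sqrt (1 + derive1 gamma s ^+ 2).

(* nu is the unit outward normal of Omega at the boundary point x. *)
Definition outward_normal Omega x nu : Prop :=
  exists U n gamma, [/\ graph_chart Omega U n gamma, U x &
    let s := dot (rot n) x in
    nu = (arc_element gamma s)^-1 *: (derive1 gamma s *: rot n - n)].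

(* The surface measure dS of the boundary of Omega, as a measure on the plane
   concentrated on that boundary: dS = sqrt (1 + gamma'(s)^2) ds in each chart.
   Finitely or countably many charts cover the boundary, so that these
   conditions determine sigma. *)
Definition surface_measure Omega (sigma : set (mplane R) -> \bar R) : Prop :=
  sigma (~` boundary Omega) = 0%E /\
  forall U n gamma, graph_chart Omega U n gamma ->
    forall A : set (mplane R), measurable A -> A `<=` U ->
      sigma A =
        (\int[leb1]_(s in graph_point n gamma @^-1` A)
           (arc_element gamma s)%:E)%E.

(* The value at a boundary point x of the continuous extension of f. *)
Definition trace Omega (f : R * R -> R) x : R :=
  lim (f y @[y --> within Omega (nbhs x)]).

End plane_geometry.

Section vector_calculus.
Context {R : realType}.
Implicit Types (Omega : set (R * R)) (x : R * R).

Definition e1 : R * R := (1, 0).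
Definition e2 : R * R := (0, 1).

Definition grad (f : R * R -> R) x : R * R := ('D_e1 f x, 'D_e2 f x).

Definition divergence (u : R * R -> R * R) x : R :=
  'D_e1 (fun y => (u y).1) x + 'D_e2 (fun y => (u y).2) x.

Definition curl (u : R * R -> R * R) x : R :=
  'D_e1 (fun y => (u y).2) x - 'D_e2 (fun y => (u y).1) x.

Definition laplacian (u : R * R -> R * R) x : R * R :=
  'D_e1 (fun y => 'D_e1 u y) x + 'D_e2 (fun y => 'D_e2 u y) x.

Definition convection (u : R * R -> R * R) x : R * R :=
  (u x).1 *: 'D_e1 u x + (u x).2 *: 'D_e2 u x.

Definition normal_derivative Omega (nu : R * R -> R * R) (f : R * R -> R) x : R :=
  dot (trace Omega (fun y => 'D_e1 f y) x, trace Omega (fun y => 'D_e2 f y) x) (nu x).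

End vector_calculus.

Section flow.
Context {R : realType}.
Implicit Types (Omega : set (R * R)) (T t : R).

Definition at_time (W : Type) (f : R * R * R -> W) (t : R) : R * R -> W :=
  fun x => f (x, t).

Definition vorticity (v : R * R * R -> R * R) : R * R * R -> R :=
  fun z => curl (at_time v z.2) z.1.

Definition navier_stokes Omega T (v0 : R * R -> R * R) (v : R * R * R -> R * R)
    (p : R * R * R -> R) : Prop :=
  [/\ forall x t, Omega x -> 0 < t < T ->
        differentiable (at_time p t) x /\
        'D_1 (fun s : R => v (x, s)) t - laplacian (at_time v t) x
          + convection (at_time v t) x + grad (at_time p t) x = 0,
      forall x t, Omega x -> 0 < t < T -> divergence (at_time v t) x = 0,
      forall x t, boundary Omega x -> 0 < t < T -> v (x, t) = 0 &
      forall x, Omega x -> v (x, 0) = v0 x].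

(* The limit of a nonincreasing function of r with values in [-oo, +oo]. *)
Definition decay_limit Omega t (w : R * R * R -> R) : \bar R :=
  lim (ereal_sup [set (Num.sqrt (enorm z.1) * `|w z|)%:E | z in
         [set z | [/\ Omega z.1, r <= enorm z.1 & 0 < z.2 < t]]]
       @[r --> +oo%R]).

Definition boundary_flux Omega (nu : R * R -> R * R) (w : R * R * R -> R) :
    R * R * R -> R :=
  fun z => normal_derivative Omega nu (at_time w z.2) z.1
           * trace Omega (at_time w z.2) z.1.

Local Open Scope ereal_scope.

Definition L2norm Omega (f : R * R -> R) : \bar R :=
  'N[leb2]_(2%:E)[(EFin \o f) \_ Omega].

Definition in_L2 Omega (f : R * R -> R) : Prop :=
  measurable_fun (Omega : set (mplane R)) f /\ L2norm Omega f < +oo.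

(* f \in L^q(0, t; L^2(Omega)) *)
Definition in_LqL2 (q : \bar R) Omega t (f : R * R * R -> R) : Prop :=
  measurable_fun
    (Omega `*` `]0%R, t[ : set (mplane R * measurableTypeR R)) f /\
  'N[leb1]_q[(fun s => L2norm Omega (at_time f s)) \_ `]0%R, t[] < +oo.

Definition Linfty_norm Omega t (v : R * R * R -> R * R) : \bar R :=
  'N[leb3]_(+oo)[(fun z => (enorm (v z))%:E) \_ (Omega `*` `]0%R, t[)].

End flow.

(* Main.v *)
Require Import Defs.
From HB Require Import structures.
From mathcomp Require Import all_boot all_order all_algebra.
From mathcomp Require Import all_classical all_reals all_analysis.
From mathcomp Require Import measurable_realfun ess_sup_inf lra ring.

Set Implicit Arguments.
Unset Strict Implicit.
Unset Printing Implicit Defensive.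

Import Order.TTheory GRing.Theory Num.Theory.
Import numFieldNormedType.Exports.

Local Open Scope classical_set_scope.
Local Open Scope ring_scope.

(** The idea is the energy identity for the vorticity equation
      omega_t = Lap omega - v . grad omega,
    multiplied by zeta^2 omega, where zeta is a C^1 cutoff equal to 1 on the
    square of half-side n and to 0 off the square of half-side 2 n.  As div v = 0
    and v = 0 on the boundary, the convective term only produces omega^2 v .
    grad zeta, and the Laplacian produces the boundary integral of
    zeta^2 omega d(omega)/d(nu), the dissipation zeta^2 |grad omega|^2 and a cross
    term 2 zeta omega grad zeta . grad omega.  Completing the square turns the
    cross term into omega^2 |grad zeta|^2 / delta at the price of a fraction delta
    of the dissipation.

    What is left is carried by an annulus of area O(n^2).  There |grad zeta| is
    O(1/n) and the decay hypothesis gives omega^2 <= (eps + delta)^2 / n, so that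
    the convective remainder is O(L (eps + delta)^2), L being the supremum of |v|,
    while the other one is O(1/n).  Integrate in time, let n go to infinity
    (dominated convergence for the boundary flux, monotone convergence for the
    two energies), use the sign of the flux, and let delta go to 0:
    lemmas slice_energy, energy_pointwise, local_energy_inequality and
    global_energy.  The decay rate |x|^(-1/2) is exactly the one for which the
    convective remainder stays bounded.

    Three ingredients have to be built.

    The vorticity equation (vorticity_equation).  Of the pressure only the gradient
    is given, which the momentum equation shows to be differentiable; that its mixed
    derivatives agree is Young's theorem (mixed_derivatives).

    Green's formula with the given surface measure (green_formula_compact).  In a
    graph chart the coordinates (s, z) -> s rot(n) + (gamma(s) + z) n preserve the
    area and carry the half-plane z > 0 to the domain, where the formula is the
    fundamental theorem of calculus on lines.  The defining property of the surface
    measure and the uniqueness of the unit outward normal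
    (chart_normal_unique) identify the boundary term.  A field of compact support
    is then cut into finitely many pieces, each supported in one chart.

    Traces and the initial time.  All the functions involved are replaced by
    their continuous extensions to the closure, up to time 0.  These extensions
    are the traces (traceE), and at time 0 they are the derivatives of the
    initial velocity (derive_initial). *)

(** * Borel sets and continuous functions in the plane and in space-time *)

(** An open set is the union of the countably many balls with centre in a dense
    sequence and rational radius that it contains. *)
Lemma open_in_sigma_algebra (R : realType) (V : normedModType R) (I : countType)
    (q : I -> V) (M : set (set V)) :
  M set0 -> (forall F : nat -> set V, (forall n, M (F n)) -> M (\bigcup_n F n)) ->
  (forall i (r : rat), M (ball (q i) (ratr r))) ->
  (forall x (e : R), 0 < e -> exists i, ball x e (q i)) ->
  forall U, open U -> M U.
Proof.
move=> M0 MU Mb dq U oU.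
pose F n : set V := if @unpickle (I * rat)%type n is Some (i, r) then
  if `[< ball (q i) (ratr r) `<=` U >] then ball (q i) (ratr r) else set0 else set0.
suff -> : U = \bigcup_n F n.
  apply: MU => n; rewrite /F; case: unpickle => [[i r]|//].
  by case: ifPn => // _; exact: Mb.
apply/seteqP; split => [x Ux|x [n _]]; last first.
  by rewrite /F; case: unpickle => [[i r]|//]; case: ifPn => // /asboolP; apply.
have /nbhs_ballP[e /= e0 xeU] : nbhs x U by exact: open_nbhs_nbhs.
have /rat_in_itvoo[r /itvP rP] : e / 4 < e / 2 by lra.
have r1 : e / 4 < ratr r by rewrite rP.
have r2 : ratr r < e / 2 by rewrite rP.
have [|i xi] := dq x (e / 4); first lra.
exists (@pickle (I * rat)%type (i, r)) => //; rewrite /F pickleK.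
have -> : `[< ball (q i) (ratr r) `<=` U >].
  apply/asboolP => y iy; apply: xeU; have := ball_triangle xi iy.
  by apply: le_ball; lra.
by apply: ball_sym; exact: (le_ball (ltW r1) xi).
Qed.

Section borel.
Context {R : realType}.

Lemma rat_ball (x e : R) : 0 < e -> exists r : rat, ball x e (ratr r).
Proof.
move=> e0; have /rat_in_itvoo[r /itvP rP] : x - e < x + e by lra.
have r1 : x - e < ratr r by rewrite rP.
have r2 : ratr r < x + e by rewrite rP.
exists r.
by rewrite /ball /= ltr_norml; apply/andP; split; lra.
Qed.

(** The measurable sets of the plane are those of the product sigma-algebra; its relation
    to the product topology rests on the countable base of rational squares. *)
Lemma open_measurable2 (U : set (R * R)) : open U ->
  measurable (U : set (mplane R)).
Proof.
apply: (@open_in_sigma_algebra R (R * R)%type (rat * rat)%type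
   (fun i => (ratr i.1, ratr i.2)) [set U | measurable (U : set (mplane R))]).
- exact: measurable0.
- by move=> F mF; exact: bigcupT_measurable.
- move=> i r /=.
  rewrite [X in measurable X](_ : _ = ball (ratr i.1 : R) (ratr r : R) `*` ball (ratr i.2 : R) (ratr r : R)).
    by apply: measurableX; exact: measurable_ball.
  by apply/seteqP; split => x; rewrite /ball /=.
- move=> [x y] e e0; have [r1 h1] := rat_ball x e0; have [r2 h2] := rat_ball y e0.
  by exists (r1, r2); split.
Qed.

Lemma open_measurable3 (U : set (R * R * R)) : open U ->
  measurable (U : set (mplane R * measurableTypeR R)).
Proof.
apply: (@open_in_sigma_algebra R (R * R * R)%type (rat * rat * rat)%type
   (fun i => (ratr i.1.1, ratr i.1.2, ratr i.2))
   [set U | measurable (U : set (mplane R * measurableTypeR R))]).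
- exact: measurable0.
- by move=> F mF; exact: bigcupT_measurable.
- move=> i r /=.
  rewrite [X in measurable X](_ : _ = (ball (ratr i.1.1 : R) (ratr r : R) `*` ball (ratr i.1.2 : R) (ratr r : R))
     `*` ball (ratr i.2 : R) (ratr r : R)).
    apply: measurableX; last exact: measurable_ball.
    by apply: measurableX; exact: measurable_ball.
  by apply/seteqP; split => x; rewrite /ball /=.
- move=> [[x y] z] e e0; have [r1 h1] := rat_ball x e0.
  have [r2 h2] := rat_ball y e0; have [r3 h3] := rat_ball z e0.
  by exists (r1, r2, r3); split.
Qed.

Lemma closed_measurable2 (U : set (R * R)) : closed U ->
  measurable (U : set (mplane R)).
Proof.
move=> cU; rewrite -(setCK U); apply: measurableC.
by apply: open_measurable2; exact: closed_openC.
Qed.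

Lemma within_continuous_measurable2 (D : set (R * R)) (f : R * R -> R) :
  measurable (D : set (mplane R)) -> {within D, continuous f} ->
  measurable_fun (D : set (mplane R)) f.
Proof.
move=> mD cf.
apply: (@measurability _ _ (mplane R) R D f _ (RGenOpens.measurableE R)).
move=> _ [_ [a [b ->] <-]].
have oab : @open R [set` `]a, b[] by exact: interval_open.
have /continuousP/(_ _ oab)/open_subspaceP[V oV VD] := cf.
rewrite setIC -VD.
by apply: measurableI => //; exact: open_measurable2.
Qed.

Lemma within_continuous_measurable3 (D : set (R * R * R)) (f : R * R * R -> R) :
  measurable (D : set (mplane R * measurableTypeR R)) -> {within D, continuous f} ->
  measurable_fun (D : set (mplane R * measurableTypeR R)) f.
Proof.
move=> mD cf.
apply: (@measurability _ _ (mplane R * measurableTypeR R)%type R D f _ (RGenOpens.measurableE R)).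
move=> _ [_ [a [b ->] <-]].
have oab : @open R [set` `]a, b[] by exact: interval_open.
have /continuousP/(_ _ oab)/open_subspaceP[V oV VD] := cf.
rewrite setIC -VD.
by apply: measurableI => //; exact: open_measurable3.
Qed.

End borel.

Local Notation image_measure :=
  measure_function_pushforward__canonical__measure_function_Measure.

(** * The area of the plane in coordinates adapted to a graph *)

Section affine_change.
Context {R : realType}.
Variables (a b : R).
Hypothesis a0 : a != 0.

Let phi : measurableTypeR R -> measurableTypeR R := fun y => a * y + b.

Let mphi : measurable_fun setT phi.
Proof.
apply: measurable_funD; last exact: measurable_cst.
by apply: measurable_funM => //; exact: measurable_cst.
Qed.

Lemma lebesgue_measure_affine (A : set (measurableTypeR R)) : measurable A ->
  leb1 A = (`|a|%:E * leb1 (phi @^-1` A))%E.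
Proof.
move=> mA.
pose na := NngNum (normr_ge0 a).
rewrite (@lebesgue_measure_unique R (mscale na (image_measure (@lebesgue_measure R) mphi))) //.
move=> _ [[x y] /= _ <-].
rewrite /mscale /= /pushforward /= lebesgue_measure_itv /=.
have [agt0|] := ltrP 0 a.
  rewrite [X in leb1 X](_ : _ = `](x - b) / a, (y - b) / a]%classic); last first.
    apply/seteqP; split=> z /=; rewrite /phi !in_itv /= ltr_pdivrMr// ler_pdivlMr// ltrBlDr lerBrDr [a * z]mulrC//.
  rewrite lebesgue_measure_itv /= !lte_fin ltr_pM2r ?invr_gt0// ltrD2r.
  case: ifPn => _; last by rewrite mule0.
  by rewrite -!EFinB -EFinM gtr0_norm//; congr EFin; field.
rewrite le_eqVlt (negbTE a0) /= => alt0.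
rewrite [X in leb1 X](_ : _ = `[(y - b) / a, (x - b) / a[%classic); last first.
  apply/seteqP; split=> z /=; rewrite /phi !in_itv /= ltr_ndivlMr// ler_ndivrMr// ltrBlDr lerBrDr [a * z]mulrC;
    by move=> /andP[-> ->].
rewrite lebesgue_measure_itv /= !lte_fin ltr_nM2r ?invr_lt0// ltrD2r.
case: ifPn => _; last by rewrite mule0.
by rewrite -!EFinB -EFinM ltr0_norm//; congr EFin; field.
Qed.

Lemma ge0_integral_affine (g : measurableTypeR R -> \bar R) : measurable_fun setT g ->
  (forall x, 0 <= g x)%E ->
  (\int[leb1]_y g y = `|a|%:E * \int[leb1]_y g (a * y + b)%R)%E.
Proof.
move=> mg g0.
transitivity (\int[mscale (NngNum (normr_ge0 a)) (image_measure (@lebesgue_measure R) mphi)]_y g y)%E.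
  apply: eq_measure_integral => A mA _.
  exact: lebesgue_measure_affine mA.
rewrite ge0_integral_mscale//=; congr (_ * _)%E.
by rewrite ge0_integral_pushforward.
Qed.

End affine_change.

Section graph_coordinates.
Context {R : realType}.
Implicit Types (n : R * R) (gamma : R -> R).

(** The boundary is the axis p.2 = 0 in these coordinates, and the domain lies on
    the side p.2 > 0. *)
Definition graph_coords n gamma (p : R * R) : R * R :=
  p.1 *: Defs.rot n + (gamma p.1 + p.2) *: n.

Lemma graph_coords1 n gamma p :
  (graph_coords n gamma p).1 = p.1 * n.2 + (gamma p.1 + p.2) * n.1.
Proof. by []. Qed.

Lemma graph_coords2 n gamma p :
  (graph_coords n gamma p).2 = - p.1 * n.1 + (gamma p.1 + p.2) * n.2.
Proof. by rewrite mulNr -mulrN. Qed.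

Lemma measurable_graph_coords n gamma : measurable_fun setT (gamma : measurableTypeR R -> measurableTypeR R) ->
  measurable_fun setT (graph_coords n gamma : mplane R -> mplane R).
Proof.
move=> mg.
have mg1 : measurable_fun setT (fun p : mplane R => (gamma p.1 + p.2 : measurableTypeR R)).
  apply: measurable_funD; last exact: measurable_snd.
  exact: (measurableT_comp mg measurable_fst).
rewrite (_ : graph_coords n gamma = fun p => (p.1 * n.2 + (gamma p.1 + p.2) * n.1,
     - p.1 * n.1 + (gamma p.1 + p.2) * n.2)).
  apply: measurable_fun_pair.
    apply: measurable_funD.
      by apply: measurable_funM; [exact: measurable_fst|exact: measurable_cst].
    by apply: measurable_funM => //; exact: measurable_cst.
  apply: measurable_funD.
    apply: measurable_funM; last exact: measurable_cst.
    by apply: measurableT_comp => //; exact: measurable_fst.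
  by apply: measurable_funM => //; exact: measurable_cst.
apply/funext => p; rewrite -graph_coords1 -graph_coords2; by case: (graph_coords n gamma p).
Qed.

Lemma measurable_pairl (x : measurableTypeR R) :
  measurable_fun setT ((fun y => (x, y)) : measurableTypeR R -> mplane R).
Proof. exact: measurable_fun_pair. Qed.

Lemma measurable_pairr (y : measurableTypeR R) :
  measurable_fun setT ((fun x => (x, y)) : measurableTypeR R -> mplane R).
Proof. exact: measurable_fun_pair. Qed.

Lemma tonelli2 (f : mplane R -> \bar R) :
  measurable_fun setT f -> (forall p, 0 <= f p)%E ->
  (\int[leb2]_p f p = \int[leb1]_x \int[leb1]_y f (x, y))%E.
Proof. by move=> mf f0; exact: fubini_tonelli1. Qed.

Lemma tonelli2_swap (f : mplane R -> \bar R) :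
  measurable_fun setT f -> (forall p, 0 <= f p)%E ->
  (\int[leb1]_x \int[leb1]_y f (x, y) = \int[leb1]_y \int[leb1]_x f (x, y))%E.
Proof. by move=> mf f0; exact: fubini_tonelli. Qed.

(** The graph enters through a translation of each line p.1 = s.  The rotation that
    remains is a composition of maps that change one coordinate at a time, with
    factors |n.2| and |n.2|^-1; for n.2 = 0 it is a quarter turn, up to signs. *)
Lemma ge0_integral_graph_coords n gamma (f : mplane R -> \bar R) :
  enorm n = 1 -> measurable_fun setT (gamma : measurableTypeR R -> measurableTypeR R) ->
  measurable_fun setT f -> (forall p, 0 <= f p)%E ->
  (\int[leb2]_p f (graph_coords n gamma p) = \int[leb2]_p f p)%E.
Proof.
move=> n1 mg mf f0.
have nn : n.1 ^+ 2 + n.2 ^+ 2 = 1.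
  have := congr1 (fun x => x ^+ 2) n1; rewrite /enorm /dot sqr_sqrtr; last first.
    by rewrite addr_ge0 // -expr2 sqr_ge0.
  by rewrite expr1n !expr2.
pose F (p : mplane R) := f (graph_coords n (cst 0) p).
have mF : measurable_fun setT F.
  by apply: measurableT_comp => //; apply: measurable_graph_coords; exact: measurable_cst.
have F0 p : (0 <= F p)%E by exact: f0.
transitivity (\int[leb2]_p F p)%E.
  have mfg : measurable_fun setT (fun p : mplane R => f (graph_coords n gamma p)).
    by apply: measurableT_comp => //; exact: measurable_graph_coords.
  rewrite (tonelli2 mfg (fun p => f0 _)) (tonelli2 mF F0).
  apply: eq_integral => s _.
  rewrite [RHS](@ge0_integral_affine _ 1 (gamma s)) //; last first.
    by apply: measurableT_comp => //; exact: measurable_pairl.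
  rewrite normr1 mul1e; apply: eq_integral => z _; congr f.
  by rewrite /graph_coords /= add0r mul1r [gamma s + z]addrC.
have FE s y : F (s, y) = f (s * n.2 + y * n.1, - s * n.1 + y * n.2).
  rewrite /F; congr f; rewrite [LHS]surjective_pairing graph_coords1 graph_coords2 /= add0r //.
rewrite (tonelli2 mF F0) (tonelli2 mf f0).
have [n20|n20] := eqVneq n.2 0.
  have n10 : n.1 != 0 by apply/eqP => n10; move: nn; rewrite n10 n20; lra.
  have n1E : `|n.1| = 1.
    by apply/eqP; rewrite -(@eqrXn2 _ 2) // expr1n real_normK ?num_real//; apply/eqP; rewrite -nn n20; ring.
  transitivity (\int[@lebesgue_measure R]_s \int[@lebesgue_measure R]_x f (x, - s * n.1)%R)%E.
    apply: eq_integral => s _.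
    rewrite [RHS](@ge0_integral_affine _ n.1 0) //; last first.
      by apply: measurableT_comp => //; exact: measurable_pairr.
    rewrite n1E mul1e; apply: eq_integral => y _; rewrite FE n20; congr (f (_, _)); ring.
  have mh : measurable_fun setT (fun p : mplane R => f (p.1, - p.2 * n.1)).
    apply: measurableT_comp => //; apply: measurable_fun_pair; first exact: measurable_fst.
    apply: measurable_funM; last exact: measurable_cst.
    by apply: measurableT_comp => //; exact: measurable_snd.
  rewrite -(tonelli2_swap mh (fun p => f0 _)).
  apply: eq_integral => x _.
  rewrite [RHS](@ge0_integral_affine _ (- n.1) 0) ?oppr_eq0 //; last first.
    by apply: measurableT_comp => //; exact: measurable_pairl.
  rewrite normrN n1E mul1e; apply: eq_integral => y _ /=; congr (f (_, _)); ring.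
pose G (p : mplane R) := f (p.1, - (n.1 / n.2) * p.1 + p.2 / n.2).
have mG : measurable_fun setT G.
  apply: measurableT_comp => //; apply: measurable_fun_pair; first exact: measurable_fst.
  apply: measurable_funD.
    by apply: measurable_funM; [exact: measurable_cst|exact: measurable_fst].
  by apply: measurable_funM; [exact: measurable_snd|exact: measurable_cst].
have G0 p : (0 <= G p)%E by exact: f0.
transitivity (\int[@lebesgue_measure R]_x (`|n.2^-1|%:E * \int[@lebesgue_measure R]_y G (x, y)))%E; last first.
  apply: eq_integral => x _.
  rewrite [RHS](@ge0_integral_affine _ n.2^-1 (- (n.1 / n.2) * x)) ?invr_eq0 //; last first.
    by apply: measurableT_comp => //; exact: measurable_pairl.
  congr (_ * _)%E; apply: eq_integral => y _ /=; congr (f (_, _)) => /=; ring.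
rewrite ge0_integralZl_EFin //; last 2 first.
- by move=> x _; exact: integral_ge0.
- exact: (measurable_fun_fubini_tonelli_F G).
rewrite (tonelli2_swap mG G0) (tonelli2_swap mF F0).
rewrite -ge0_integralZl_EFin //; last 2 first.
- by move=> x _; exact: integral_ge0.
- exact: (measurable_fun_fubini_tonelli_G G).
apply: eq_integral => y _.
rewrite [X in (_ * X)%E](@ge0_integral_affine _ n.2 (y * n.1)) //; last first.
  by apply: measurableT_comp => //; exact: measurable_pairr.
rewrite muleA -EFinM -normrM mulVf // normr1 mul1e.
apply: eq_integral => s _; rewrite FE /G /=; congr (f (_, _)); first by rewrite mulrC.
have -> : - (n.1 / n.2) * (n.2 * s + y * n.1) + y / n.2 = - s * n.1 + y * (1 - n.1 ^+ 2) / n.2 by field.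
by rewrite -nn; field.
Qed.

(** Since n is a unit vector, these coordinates have Jacobian one. *)
Lemma integral_graph_coords n gamma (f : mplane R -> \bar R) :
  enorm n = 1 -> measurable_fun setT (gamma : measurableTypeR R -> measurableTypeR R) ->
  measurable_fun setT f ->
  (\int[leb2]_p f (graph_coords n gamma p) = \int[leb2]_p f p)%E.
Proof.
move=> n1 mg mf; rewrite integralE [RHS]integralE; congr (_ - _)%E.
  rewrite -(ge0_integral_graph_coords n1 mg (measurable_funepos mf)); last first.
    by move=> p; exact: funepos_ge0.
  by apply: eq_integral => p _; rewrite funepos_comp.
rewrite -(ge0_integral_graph_coords n1 mg (measurable_funeneg mf)); last first.
  by move=> p; exact: funeneg_ge0.
by apply: eq_integral => p _; rewrite funeneg_comp.
Qed.

End graph_coordinates.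

(** * Directional derivatives *)

Section directional_derivatives.
Context {R : realType} {V : normedModType R}.
Implicit Types (f : V -> R) (z e a b : V).

Lemma is_derive_line f z e (k : R) : derivable f (z + k *: e) e ->
  is_derive k (1 : R) (fun s : R => f (z + s *: e)) ('D_e f (z + k *: e)).
Proof.
have E : (fun h : R => h^-1 *: (f (z + (h *: (1 : R) + k) *: e) - f (z + k *: e))) =
         (fun h : R => h^-1 *: (f (h *: e + (z + k *: e)) - f (z + k *: e))).
  apply/funext => h; congr (_ *: (f _ - _)).
  by rewrite scalerDl addrCA /GRing.scale /= mulr1.
move=> dfe; apply: DeriveDef.
  by move: dfe; rewrite /derivable /= E.
by rewrite /derive /= E.
Qed.

(** The mean value inequality on the segment from z to z + h *: e, compared with the
    linear map h * c. *)
Lemma increment_le f z e (c eps h : R) :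
  (forall k, `|k| <= `|h| -> derivable f (z + k *: e) e /\
     `|'D_e f (z + k *: e) - c| <= eps) ->
  `|f (z + h *: e) - f z - h * c| <= eps * `|h|.
Proof.
move=> H; pose g (s : R) := f (z + s *: e).
have dg k : `|k| <= `|h| -> is_derive k (1 : R) g ('D_e f (z + k *: e)).
  by move=> /H[d _]; exact: is_derive_line.
have key (a b : R) : a <= b -> (forall k, a <= k <= b -> `|k| <= `|h|) ->
    exists2 k, `|k| <= `|h| & g b - g a = 'D_e f (z + k *: e) * (b - a).
  move=> ab Hab; have [||k kab gE] := @MVT_segment R g (fun k => 'D_e f (z + k *: e)) a b ab.
  - by move=> k /[!in_itv]/= /andP[ak kb]; apply: dg; apply: Hab; rewrite !ltW.
  - apply: derivable_within_continuous => k /[!in_itv]/= kab.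
    by have [] := dg _ (Hab _ kab).
  - by exists k => //; apply: Hab; move: kab; rewrite in_itv.
have gh : g h = f (z + h *: e) by [].
have g0 : g 0 = f z by rewrite /g scale0r addr0.
have [h0|h0] := leP 0 h.
  have [k kh E] : exists2 k, `|k| <= `|h| & g h - g 0 = 'D_e f (z + k *: e) * (h - 0).
    by apply: key => // k /andP[k0 kh]; rewrite !ger0_norm.
  rewrite -gh -g0 E subr0 [h * c]mulrC -mulrBl normrM ler_wpM2r//.
  by have [] := H _ kh.
have [k kh E] : exists2 k, `|k| <= `|h| & g 0 - g h = 'D_e f (z + k *: e) * (0 - h).
  apply: key => [|k /andP[hk k0]]; first exact: ltW.
  by rewrite (ltr0_norm h0) ler0_norm// lerN2.
have {}E : g h - g 0 = 'D_e f (z + k *: e) * h.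
  by rewrite -[LHS]opprB E sub0r mulrN opprK.
rewrite -gh -g0 E [h * c]mulrC -mulrBl normrM ler_wpM2r//.
by have [] := H _ kh.
Qed.

Lemma littleo_differentiable f z :
  (forall eps, 0 < eps -> \forall h \near (0 : V), `|f (h + z) - f z| <= eps * `|h|) ->
  differentiable f z.
Proof.
move=> fo.
have fE : f \o shift z = cst (f z) + (\0 : {linear V -> R}) +o_ (0 : V) id.
  apply/eqaddoP => eps eps0; near=> h.
  rewrite /= /cst /= (_ : (_ - _) h = f (h + z) - f z); last first.
    by rewrite /= !fctE /= addr0.
  by near: h; exact: fo.
have c0 : continuous (\0 : {linear V -> R}) by move=> x; exact: cvg_cst.
have dE := diff_unique c0 fE.
by apply/diff_locallyP; split; rewrite dE.
Unshelve. all: by end_near. Qed.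

Lemma differentiable_increment f z (eps : R) : differentiable f z -> 0 < eps ->
  \forall h \near (0 : V), `|f (z + h) - f z - 'd f z h| <= eps * `|h|.
Proof.
move=> /diff_locally /eqaddoP/(_ _)/[apply]; apply: filterS => h /=.
by rewrite !fctE /= [h + z]addrC opprD addrA.
Qed.

(** Young's form of the symmetry of second derivatives: both mixed derivatives
    are the leading coefficient of one and the same second difference.  It applies
    to the pressure, whose gradient is known to be differentiable because the
    other terms of the momentum equation are. *)
Lemma mixed_derivatives f z a b :
  (\forall y \near z, derivable f y a /\ derivable f y b) ->
  differentiable ('D_a f) z -> differentiable ('D_b f) z ->
  'D_b ('D_a f) z = 'D_a ('D_b f) z.
Proof.
move=> df da db; rewrite (deriveE _ da) (deriveE _ db).
pose N := `|a| + `|b| + 1.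
have N0 : 0 < N by rewrite /N ltr_wpDl // addr_ge0.
(* one half of the argument, used for (a, b) and for (b, a) *)
have half c d (eps : R) : 0 < eps -> `|c| + `|d| <= N ->
    (\forall y \near z, derivable f y c) -> differentiable ('D_c f) z ->
    \forall t \near (0 : R)^'+, `|f (z + t *: c + t *: d) - f (z + t *: c) -
       (f (z + t *: d) - f z) - t ^+ 2 * 'd ('D_c f) z d| <= 2 * eps * N * t ^+ 2.
  move=> eps0 cdN dfc dc.
  have /nbhs_ballP[r1 /= r10 B1] := dfc.
  have /nbhs_ballP[r2 /= r20 B2] := differentiable_increment dc eps0.
  have r0 : 0 < Num.min r1 r2 / N by rewrite divr_gt0 // lt_min r10.
  near=> t.
  have t0 : 0 < t by [].
  have tN : t * N < Num.min r1 r2.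
    rewrite -ltr_pdivlMr //; near: t; exact: nbhs_right_lt.
  have small k s : `|k| <= t -> 0 <= s <= t -> `|k *: c + s *: d| <= t * N.
    move=> kt /andP[s0 st]; apply: (le_trans (ler_normD _ _)); rewrite !normrZ.
    apply: le_trans (_ : t * (`|c| + `|d|) <= _); last by rewrite ler_pM2l.
    by rewrite mulrDr lerD // ler_wpM2r // ger0_norm.
  (* the second difference is the increment of phi in the direction c *)
  pose phi y := f (y + t *: d) - f y.
  have inc : `|phi (z + t *: c) - phi z - t * (t * 'd ('D_c f) z d)| <= (2 * eps * N * t) * `|t|.
    apply: increment_le => k; rewrite (gtr0_norm t0) => kt.
    have k0 : `|k *: c| <= t * N.
      by have := small k 0 kt; rewrite scale0r addr0; apply; rewrite lexx ltW.
    have kt1 : `|k *: c + t *: d| <= t * N by apply: small => //; rewrite lexx ltW.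
    have tr1 : t * N < r1 by apply: lt_le_trans tN _; rewrite ge_min lexx.
    have tr2 : t * N < r2 by apply: lt_le_trans tN _; rewrite ge_min lexx orbT.
    have d1 : derivable f (z + k *: c) c.
      apply: B1; rewrite -ball_normE /= opprD addNKr normrN.
      exact: le_lt_trans tr1.
    have d2 : derivable f (z + k *: c + t *: d) c.
      apply: B1; rewrite -ball_normE /= -addrA opprD addNKr normrN.
      exact: le_lt_trans tr1.
    have dphi : is_derive (z + k *: c) c phi ('D_c f (z + k *: c + t *: d) - 'D_c f (z + k *: c)).
      have := derivableP d1; suff : is_derive (z + k *: c) c (fun y => f (y + t *: d)) ('D_c f (z + k *: c + t *: d)).
        by move=> D2 D1; exact: is_deriveB D2 D1.
      have E : (fun h : R => h^-1 *: (f (h *: c + (z + k *: c) + t *: d) - f (z + k *: c + t *: d))) =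
         (fun h : R => h^-1 *: (f (h *: c + (z + k *: c + t *: d)) - f (z + k *: c + t *: d))).
        by apply/funext => h; rewrite -!addrA.
      apply: DeriveDef; first by move: d2; rewrite /derivable /= E.
      by rewrite /derive /= E.
    split; first by have [] := dphi.
    rewrite (@derive_val _ _ _ _ _ _ _ dphi).
    have b1 : `|'D_c f (z + (k *: c + t *: d)) - 'D_c f z - 'd ('D_c f) z (k *: c + t *: d)| <= eps * (t * N).
      apply: le_trans (B2 _ _) _; last by rewrite ler_pM2l.
      by rewrite -ball_normE /= sub0r normrN; exact: le_lt_trans tr2.
    have b2 : `|'D_c f (z + k *: c) - 'D_c f z - 'd ('D_c f) z (k *: c)| <= eps * (t * N).
      apply: le_trans (B2 _ _) _; last by rewrite ler_pM2l.
      by rewrite -ball_normE /= sub0r normrN; exact: le_lt_trans tr2.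
    have -> : 'D_c f (z + k *: c + t *: d) - 'D_c f (z + k *: c) - t * 'd ('D_c f) z d =
      ('D_c f (z + (k *: c + t *: d)) - 'D_c f z - 'd ('D_c f) z (k *: c + t *: d)) -
      ('D_c f (z + k *: c) - 'D_c f z - 'd ('D_c f) z (k *: c)).
      have -> : 'd ('D_c f) z (k *: c + t *: d) = 'd ('D_c f) z (k *: c) + t * 'd ('D_c f) z d.
        by rewrite linearD (linearZ _ d).
      by rewrite (addrA z); ring.
    apply: le_trans (ler_normB _ _) _; apply: le_trans (lerD b1 b2) _.
    by rewrite le_eqVlt; apply/orP; left; apply/eqP; ring.
  move: inc; rewrite (gtr0_norm t0) /phi; congr (`|_| <= _); ring.
apply/eqP; rewrite -subr_eq0 -normr_eq0 eq_le normr_ge0 andbT.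
apply/ler_addgt0Pl => eps eps0; rewrite addr0.
pose e' := eps / (4 * N); have e'0 : 0 < e' by rewrite divr_gt0 // mulr_gt0.
have ha := half a b e' e'0 _ _ da; have hb := half b a e' e'0 _ _ db.
have [t [t0 hat hbt]] : exists t : R, [/\ 0 < t,
   `|f (z + t *: a + t *: b) - f (z + t *: a) -
       (f (z + t *: b) - f z) - t ^+ 2 * 'd ('D_a f) z b| <= 2 * e' * N * t ^+ 2 &
   `|f (z + t *: b + t *: a) - f (z + t *: b) -
       (f (z + t *: a) - f z) - t ^+ 2 * 'd ('D_b f) z a| <= 2 * e' * N * t ^+ 2].
  near ((0 : R)^'+) => t; exists t; split => //.
    near: t; apply: ha; first by rewrite /N lerDl.
    by apply: filterS df => y [].
  near: t; apply: hb; first by rewrite /N [`|b| + _]addrC lerDl.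
  by apply: filterS df => y [].
rewrite -(@ler_pM2l _ (t ^+ 2)) ?exprn_gt0 //.
rewrite -[X in X * _ <= _]ger0_norm ?sqr_ge0// -normrM.
have -> : t ^+ 2 * ('d ('D_a f) z b - 'd ('D_b f) z a) =
   (f (z + t *: b + t *: a) - f (z + t *: b) -
       (f (z + t *: a) - f z) - t ^+ 2 * 'd ('D_b f) z a) -
   (f (z + t *: a + t *: b) - f (z + t *: a) -
       (f (z + t *: b) - f z) - t ^+ 2 * 'd ('D_a f) z b).
  by rewrite (addrAC z); ring.
apply: le_trans (ler_normB _ _) _; apply: le_trans (lerD hbt hat) _.
by rewrite le_eqVlt; apply/orP; left; apply/eqP; rewrite /e'; field; rewrite gt_eqF.
Unshelve. all: by end_near. Qed.

End directional_derivatives.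

(** A function whose derivatives along a frame are continuous at a point is
    differentiable there: go from z to z + h parallel to the three axes. *)
Lemma partials_differentiable (R : realType) (V : normedModType R) (f : V -> R) (z : V)
    (a1 a2 a3 : V) (l1 l2 l3 : V -> R) :
  (forall h, h = l1 h *: a1 + l2 h *: a2 + l3 h *: a3) ->
  `|a1| <= 1 -> `|a2| <= 1 -> `|a3| <= 1 ->
  (forall h, [/\ `|l1 h| <= `|h|, `|l2 h| <= `|h| & `|l3 h| <= `|h|]) ->
  (forall h y, [/\ l1 (h + y) = l1 h + l1 y, l2 (h + y) = l2 h + l2 y &
                  l3 (h + y) = l3 h + l3 y]) ->
  differentiable l1 z -> differentiable l2 z -> differentiable l3 z ->
  (\forall y \near z, [/\ derivable f y a1, derivable f y a2 & derivable f y a3]) ->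
  {for z, continuous ('D_a1 f)} -> {for z, continuous ('D_a2 f)} ->
  {for z, continuous ('D_a3 f)} -> differentiable f z.
Proof.
move=> frame na1 na2 na3 lle lD dl1 dl2 dl3 df c1 c2 c3.
pose L y : R := l1 y * 'D_a1 f z + l2 y * 'D_a2 f z + l3 y * 'D_a3 f z.
have dL : differentiable L z.
  by apply: differentiableD; [apply: differentiableD|]; apply: differentiableM.
have -> : f = (f - L) + L by rewrite subrK.
apply: differentiableD; last exact: dL.
apply: littleo_differentiable => eps eps0.
have e30 : 0 < eps / 3 by lra.
have /nbhs_ballP[r0 /= r00 B0] := df.
move/cvgrPdist_le/(_ _ e30)/nbhs_ballP : c1 => [r1 /= r10 B1].
move/cvgrPdist_le/(_ _ e30)/nbhs_ballP : c2 => [r2 /= r20 B2].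
move/cvgrPdist_le/(_ _ e30)/nbhs_ballP : c3 => [r3 /= r30 B3].
have rr : 0 < Num.min (Num.min r0 r1) (Num.min r2 r3) / 3.
  by rewrite divr_gt0 // !lt_min r00 r10 r20.
near=> h.
have : `|h| < Num.min (Num.min r0 r1) (Num.min r2 r3) / 3.
  by near: h; exact: nbhs0_lt.
rewrite ltr_pdivlMr // !lt_min => /andP[/andP[hr0 hr1] /andP[hr2 hr3]].
have [h1 h2 h3] := lle h.
pose p1 := z + l1 h *: a1; pose p2 := p1 + l2 h *: a2.
have p3E : p2 + l3 h *: a3 = h + z.
  by rewrite /p2 /p1 -!addrA [h + z]addrC; congr (z + _); rewrite addrA -frame.
have in_ball k r : `|k| <= `|h| * 3 -> `|h| * 3 < r -> ball z r (z + k).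
  move=> kh hr; rewrite -ball_normE /= opprD addNKr normrN.
  exact: le_lt_trans hr.
have nz c (a : V) : `|a| <= 1 -> `|c| <= `|h| -> `|c *: a| <= `|h|.
  by move=> na ch; rewrite normrZ -[leRHS]mulr1 ler_pM.
have s1 : `|f p1 - f z - l1 h * 'D_a1 f z| <= eps / 3 * `|h|.
  apply: le_trans (_ : eps / 3 * `|l1 h| <= _); last by rewrite ler_pM2l.
  apply: increment_le => k kh.
  have yE : `|k *: a1| <= `|h| * 3.
    by have := nz k a1 na1 (le_trans kh h1); have := normr_ge0 h; lra.
  split; first by have [] := B0 _ (in_ball _ _ yE hr0).
  by rewrite distrC; apply: B1; exact: in_ball yE hr1.
have s2 : `|f p2 - f p1 - l2 h * 'D_a2 f z| <= eps / 3 * `|h|.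
  apply: le_trans (_ : eps / 3 * `|l2 h| <= _); last by rewrite ler_pM2l.
  apply: increment_le => k kh.
  have yE : `|l1 h *: a1 + k *: a2| <= `|h| * 3.
    apply: le_trans (ler_normD _ _) _.
    by have := nz _ _ na1 h1; have := nz k _ na2 (le_trans kh h2); have := normr_ge0 h; lra.
  rewrite -addrA; split; first by have [] := B0 _ (in_ball _ _ yE hr0).
  by rewrite distrC; apply: B2; exact: in_ball yE hr2.
have s3 : `|f (h + z) - f p2 - l3 h * 'D_a3 f z| <= eps / 3 * `|h|.
  rewrite -p3E.
  apply: le_trans (_ : eps / 3 * `|l3 h| <= _); last by rewrite ler_pM2l.
  apply: increment_le => k kh.
  have yE : `|l1 h *: a1 + (l2 h *: a2 + k *: a3)| <= `|h| * 3.
    apply: le_trans (ler_normD _ _) _; have := ler_normD (l2 h *: a2) (k *: a3).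
    have := nz _ _ na1 h1; have := nz _ _ na2 h2.
    by have := nz k _ na3 (le_trans kh h3); have := normr_ge0 h; lra.
  rewrite /p2 /p1 -!addrA; split; first by have [] := B0 _ (in_ball _ _ yE hr0).
  by rewrite distrC; apply: B3; exact: in_ball yE hr3.
have -> : (f - L) (h + z) - (f - L) z =
   (f p1 - f z - l1 h * 'D_a1 f z) + (f p2 - f p1 - l2 h * 'D_a2 f z) +
   (f (h + z) - f p2 - l3 h * 'D_a3 f z).
  by rewrite /L !fctE /=; have [-> -> ->] := lD h z; ring.
apply: le_trans (ler_normD _ _) _; apply: le_trans (lerD (ler_normD _ _) (lexx _)) _.
by move: s1 s2 s3; lra.
Unshelve. all: by end_near. Qed.

Section space_time.
Context {R : realType}.

Definition dx1 : R * R * R := (e1, 0).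
Definition dx2 : R * R * R := (e2, 0).
Definition dt : R * R * R := (0, 1).

Lemma differentiable_fst (V W : normedModType R) (z : V * W) : differentiable fst z.
Proof. by apply: linear_differentiable => ?; exact: cvg_fst. Qed.

Lemma differentiable_snd (V W : normedModType R) (z : V * W) : differentiable snd z.
Proof. by apply: linear_differentiable => ?; exact: cvg_snd. Qed.

Lemma norm3_le (x : R * R * R) (M : R) :
  `|x.1.1| <= M -> `|x.1.2| <= M -> `|x.2| <= M -> `|x| <= M.
Proof. by move=> h1 h2 h3; rewrite !prod_normE /= !ge_max h1 h2 h3. Qed.

Lemma partials_differentiable3 (f : R * R * R -> R) z :
  (\forall y \near z, [/\ derivable f y dx1, derivable f y dx2 & derivable f y dt]) ->
  {for z, continuous ('D_dx1 f)} -> {for z, continuous ('D_dx2 f)} ->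
  {for z, continuous ('D_dt f)} -> differentiable f z.
Proof.
apply: (@partials_differentiable R (R * R * R)%type f z dx1 dx2 dt
  (fun h => h.1.1) (fun h => h.1.2) snd).
- move=> [[h1 h2] h3]; congr (_, _, _) => /=; rewrite /GRing.scale /=.
  + by rewrite !(mulr0, mulr1, addr0).
  + by rewrite !(mulr0, mulr1, addr0, add0r).
  + by rewrite !(mulr0, mulr1, addr0, add0r).
- by apply: norm3_le; rewrite /= ?normr0 ?normr1.
- by apply: norm3_le; rewrite /= ?normr0 ?normr1.
- by apply: norm3_le; rewrite /= ?normr0 ?normr1.
- move=> h; split; rewrite !prod_normE /= !le_max lexx ?orbT //.
- by [].
- by apply: (@differentiable_comp _ _ _ _ fst fst); exact: differentiable_fst.
- apply: (@differentiable_comp _ _ _ _ fst snd); first exact: differentiable_fst.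
  exact: differentiable_snd.
- exact: differentiable_snd.
Qed.

End space_time.

(** * Continuously differentiable cutoff functions *)

Section plateau.
Context {R : realType}.
Implicit Types (x s u : R).

(** For the square of the positive part, the estimate holds across the kink at 0 with
    no need to compare one-sided derivatives. *)
Lemma is_derive_quadratic (f : R -> R) x c (K : R) :
  (forall h, `|f (h + x) - f x - h * c| <= K * h ^+ 2) -> is_derive x (1 : R) f c.
Proof.
move=> H; have K0 : 0 <= K by have := le_trans (normr_ge0 _) (H 1); rewrite expr1n mulr1.
pose g y := f y - y * c.
have dg : differentiable g x.
  apply: littleo_differentiable => eps eps0; near=> h.
  rewrite (_ : g (h + x) - g x = f (h + x) - f x - h * c); last by rewrite /g; ring.
  apply: (le_trans (H h)); rewrite -real_normK ?num_real// expr2 mulrA ler_wpM2r//.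
  have hK : `|h| < eps / (K + 1).
    near: h; apply/nbhs_ballP; exists (eps / (K + 1)); first by rewrite /= divr_gt0 // ltr_wpDl.
    by move=> y; rewrite -ball_normE /= sub0r normrN.
  rewrite ltr_pdivlMr ?ltr_wpDl // in hK.
  by apply: le_trans (ltW hK); rewrite mulrC ler_wpM2l // lerDl.
have g0 : 'D_1 g x = 0.
  apply/eqP; rewrite -normr_eq0 eq_le normr_ge0 andbT; apply/ler_addgt0Pl => eps eps0; rewrite addr0.
  rewrite (deriveE _ dg).
  have e2 : 0 < eps / 2 by lra.
  have /nbhs_ballP[r /= r0 B] := differentiable_increment dg e2.
  pose h := Num.min (r / 2) (eps / (2 * (K + 1))).
  have h0 : 0 < h by rewrite lt_min !divr_gt0 // mulr_gt0 // ltr_wpDl.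
  have hr : h < r by rewrite gt_min; apply/orP; left; lra.
  have := B h; rewrite -ball_normE /= sub0r normrN (gtr0_norm h0) => /(_ hr).
  have := H h; rewrite (_ : f _ - _ - _ = g (x + h) - g x); last by rewrite /g [h + x]addrC; ring.
  rewrite [X in 'd g x X](_ : _ = h *: (1 : R)); last by rewrite /GRing.scale /= mulr1.
  rewrite linearZ /= => A1 A2.
  rewrite -(@ler_pM2l _ h) // -{1}(gtr0_norm h0) -normrM.
  have -> : h * 'd g x 1 = (g (x + h) - g x) - (g (x + h) - g x - h * 'd g x 1) by ring.
  apply: le_trans (ler_normB _ _) _; apply: le_trans (lerD A1 A2) _.
  have hK : h * (K + 1) <= eps / 2.
    have K1 : 0 < K + 1 by rewrite ltr_wpDl.
    have hm : h <= eps / (2 * (K + 1)) by rewrite ge_min lexx orbT.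
    by move: hm; rewrite ler_pdivlMr ?mulr_gt0 //; lra.
  suff : K * h ^+ 2 <= h * (eps / 2) by lra.
  rewrite expr2 mulrCA ler_pM2l //; apply: le_trans hK.
  by rewrite mulrC ler_pM2l // lerDl.
have -> : f = g + (fun y => y * c) by apply/funext => y; rewrite fctE /g subrK.
have D1 : is_derive x (1 : R) g 0 by rewrite -g0; apply: derivableP; exact: diff_derivable.
have D2 : is_derive x (1 : R) (fun y : R => y * c) c.
  by apply: is_derive_eq; rewrite /GRing.scale /= mulr1 mulr0 add0r.
by apply: is_derive_eq; rewrite add0r.
Unshelve. all: by end_near. Qed.

Lemma is_derive_comp1 (g l : R -> R) x a b :
  is_derive (l x) (1 : R) g a -> is_derive x (1 : R) l b ->
  is_derive x (1 : R) (fun y => g (l y)) (a * b).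
Proof. by move=> dg dl; exact: is_derive1_comp. Qed.

Lemma is_derive_subl x a : is_derive x (1 : R) (fun y => a - y) (- 1 : R).
Proof.
by have := is_deriveB (is_derive_cst (a : R) x (1 : R)) (is_derive_id x (1 : R)); rewrite sub0r.
Qed.

Lemma is_derive_addl x a : is_derive x (1 : R) (fun y => a + y) (1 : R).
Proof.
by have := is_deriveD (is_derive_cst (a : R) x (1 : R)) (is_derive_id x (1 : R)); rewrite add0r.
Qed.

Lemma is_derive_subr x a : is_derive x (1 : R) (fun y => y - a) (1 : R).
Proof.
by have := is_deriveB (is_derive_id x (1 : R)) (is_derive_cst (a : R) x (1 : R)); rewrite subr0.
Qed.

Lemma is_derive_continuous (f : R -> R) x d : is_derive x (1 : R) f d ->
  {for x, continuous f}.
Proof. by case=> df _; apply: differentiable_continuous; exact/derivable1_diffP. Qed.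

Definition pos_part x : R := Num.max x 0.

Lemma pos_part_ge0 x : 0 <= x -> pos_part x = x.
Proof. by move=> x0; rewrite /pos_part; apply/max_idPl. Qed.

Lemma pos_part_le0 x : x <= 0 -> pos_part x = 0.
Proof. by move=> x0; rewrite /pos_part; apply/max_idPr. Qed.

Lemma continuous_pos_part : continuous pos_part.
Proof. by move=> x; apply: continuous_max; [exact: cvg_id|exact: cvg_cst]. Qed.

Lemma is_derive_pos_part2 x : is_derive x (1 : R) (fun y => pos_part y ^+ 2) (2 * pos_part x).
Proof.
apply: (@is_derive_quadratic _ _ _ 1) => h; rewrite mul1r ler_norml.
have [x0|x0] := leP 0 x; have [hx0|hx0] := leP 0 (h + x).
- by rewrite !pos_part_ge0 //; apply/andP; split; nra.
- by rewrite (pos_part_le0 (ltW hx0)) !pos_part_ge0 //; apply/andP; split; nra.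
- by rewrite (pos_part_le0 (ltW x0)) !pos_part_ge0 //; apply/andP; split; nra.
- by rewrite (pos_part_le0 (ltW x0)) (pos_part_le0 (ltW hx0)); apply/andP; split; nra.
Qed.

(** The quadratic spline that climbs from 0 to 1 on the unit interval.  The energy
    identity differentiates the cutoff once, so that class C^1 is enough. *)
Definition smoothstep u : R :=
  2 * pos_part u ^+ 2 - 4 * pos_part (u - 1 / 2) ^+ 2 + 2 * pos_part (u - 1) ^+ 2.

Definition smoothstep' u : R :=
  4 * pos_part u - 8 * pos_part (u - 1 / 2) + 4 * pos_part (u - 1).

Lemma is_derive_smoothstep u : is_derive u (1 : R) smoothstep (smoothstep' u).
Proof.
have D a : is_derive u (1 : R) (fun y => pos_part (y - a) ^+ 2) (2 * pos_part (u - a)).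
  have := @is_derive_comp1 _ (fun y => y - a) u _ _ (is_derive_pos_part2 (u - a)) (is_derive_subr u a).
  by rewrite mulr1.
have D0 := is_derive_pos_part2 u.
have D1 := D (1 / 2); have D2 := D 1.
apply: is_derive_eq; rewrite /smoothstep' /GRing.scale /=; ring.
Qed.

Lemma continuous_smoothstep' : continuous smoothstep'.
Proof.
move=> u; have D a : (fun y => pos_part (y - a)) y @[y --> u] --> pos_part (u - a).
  apply: (@cvg_comp _ _ _ (fun y => y - a) pos_part); last exact: continuous_pos_part.
  exact: is_derive_continuous (is_derive_subr u a).
apply: cvgD; [apply: cvgB|]; apply: cvgM; try exact: cvg_cst.
- exact: continuous_pos_part.
- exact: D.
- exact: D.
Qed.

Lemma smoothstep_le0 u : u <= 0 -> smoothstep u = 0.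
Proof. by move=> u0; rewrite /smoothstep !pos_part_le0; lra. Qed.

Lemma smoothstep_ge1 u : 1 <= u -> smoothstep u = 1.
Proof. by move=> u1; rewrite /smoothstep !pos_part_ge0; lra. Qed.

Lemma smoothstep_bounds u : 0 <= smoothstep u <= 1.
Proof.
have [u0|u0] := leP u 0; first by rewrite smoothstep_le0 // lexx ler01.
have [u1|u1] := leP 1 u; first by rewrite smoothstep_ge1 // lexx ler01.
rewrite /smoothstep (pos_part_ge0 (ltW u0)) (@pos_part_le0 (u - 1)); last lra.
have [h|h] := leP u (1 / 2).
  by rewrite pos_part_le0; [apply/andP; split; nra|lra].
by rewrite pos_part_ge0; [apply/andP; split; nra|lra].
Qed.

Lemma smoothstep'_le0 u : u <= 0 -> smoothstep' u = 0.
Proof. by move=> u0; rewrite /smoothstep' !pos_part_le0; lra. Qed.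

Lemma smoothstep'_ge1 u : 1 <= u -> smoothstep' u = 0.
Proof. by move=> u1; rewrite /smoothstep' !pos_part_ge0; lra. Qed.

Lemma smoothstep'_bounds u : 0 <= smoothstep' u <= 2.
Proof.
have [u0|u0] := leP u 0; first by rewrite smoothstep'_le0 // lexx; lra.
have [u1|u1] := leP 1 u; first by rewrite smoothstep'_ge1 // lexx; lra.
rewrite /smoothstep' (pos_part_ge0 (ltW u0)) (@pos_part_le0 (u - 1)); last lra.
have [h|h] := leP u (1 / 2).
  by rewrite pos_part_le0; [apply/andP; split; nra|lra].
by rewrite pos_part_ge0; [apply/andP; split; nra|lra].
Qed.

(** Equal to 1 on [-1, 1] and to 0 off [-2, 2]. *)
Definition plateau s : R := smoothstep (2 - s) * smoothstep (2 + s).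

Definition plateau' s : R :=
  smoothstep (2 - s) * smoothstep' (2 + s) - smoothstep' (2 - s) * smoothstep (2 + s).

Lemma is_derive_plateau s : is_derive s (1 : R) plateau (plateau' s).
Proof.
have Da := is_derive_smoothstep (2 - s); have Db := is_derive_smoothstep (2 + s).
have D1 : is_derive s (1 : R) (fun y => smoothstep (2 - y)) (- smoothstep' (2 - s)).
  by have := @is_derive_comp1 _ (fun y => 2 - y) s _ _ Da (is_derive_subl s 2); rewrite mulrN1.
have D2 : is_derive s (1 : R) (fun y => smoothstep (2 + y)) (smoothstep' (2 + s)).
  by have := @is_derive_comp1 _ (fun y => 2 + y) s _ _ Db (is_derive_addl s 2); rewrite mulr1.
by apply: is_derive_eq; rewrite /plateau' /GRing.scale /=; ring.
Qed.

Lemma continuous_plateau' : continuous plateau'.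
Proof.
move=> s.
have cl1 : (2 - y) @[y --> s] --> 2 - s := is_derive_continuous (is_derive_subl s 2).
have cl2 : (2 + y) @[y --> s] --> 2 + s := is_derive_continuous (is_derive_addl s 2).
have cS u : smoothstep y @[y --> u] --> smoothstep u.
  exact: is_derive_continuous (is_derive_smoothstep u).
have cS' u : smoothstep' y @[y --> u] --> smoothstep' u by exact: continuous_smoothstep'.
apply: cvgB; apply: cvgM.
- exact: cvg_comp cl1 (cS _).
- exact: cvg_comp cl2 (cS' _).
- exact: cvg_comp cl1 (cS' _).
- exact: cvg_comp cl2 (cS _).
Qed.

Lemma plateau_bounds s : 0 <= plateau s <= 1.
Proof.
have /andP[a0 a1] := smoothstep_bounds (2 - s).
have /andP[b0 b1] := smoothstep_bounds (2 + s).
by rewrite /plateau mulr_ge0 //= mulr_ile1.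
Qed.

Lemma plateau_eq1 s : `|s| <= 1 -> plateau s = 1.
Proof. by rewrite ler_norml => /andP[? ?]; rewrite /plateau !smoothstep_ge1 ?mulr1 //; lra. Qed.

Lemma plateau_eq0 s : 2 <= `|s| -> plateau s = 0.
Proof.
rewrite ler_normr => /orP[] h; rewrite /plateau.
  by rewrite (@smoothstep_le0 (2 - s)) ?mul0r //; lra.
by rewrite (@smoothstep_le0 (2 + s)) ?mulr0 //; lra.
Qed.

Lemma plateau'_eq0 s : `|s| <= 1 -> plateau' s = 0.
Proof.
rewrite ler_norml => /andP[? ?]; rewrite /plateau' !smoothstep'_ge1 ?mulr0 ?mul0r ?subr0 //; lra.
Qed.

Lemma plateau'_eq0_far s : 2 <= `|s| -> plateau' s = 0.
Proof.
rewrite ler_normr => /orP[] h; rewrite /plateau'.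
  by rewrite (@smoothstep_le0 (2 - s)) ?(@smoothstep'_le0 (2 - s)) ?mul0r ?subr0 //; lra.
by rewrite (@smoothstep_le0 (2 + s)) ?(@smoothstep'_le0 (2 + s)) ?mulr0 ?subr0 //; lra.
Qed.

Lemma plateau'_bound s : `|plateau' s| <= 2.
Proof.
have /andP[a0 a1] := smoothstep_bounds (2 - s).
have /andP[b0 b1] := smoothstep_bounds (2 + s).
have /andP[c0 c1] := smoothstep'_bounds (2 - s).
have /andP[d0 d1] := smoothstep'_bounds (2 + s).
have h1 : 0 <= smoothstep (2 - s) * smoothstep' (2 + s) <= 2.
  by rewrite mulr_ge0 //= -[leRHS]mul1r ler_pM.
have h2 : 0 <= smoothstep' (2 - s) * smoothstep (2 + s) <= 2.
  by rewrite mulr_ge0 //= -[leRHS]mulr1 ler_pM.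
by move: h1 h2 => /andP[? ?] /andP[? ?]; rewrite /plateau' ler_norml; apply/andP; split; lra.
Qed.

End plateau.

(** * Functions continuously differentiable up to the boundary *)

Section within_continuity.
Context {R : realType} {V : normedModType R}.
Implicit Types (A : set V) (f g : V -> R).

Lemma within_continuousM A f g : {within A, continuous f} -> {within A, continuous g} ->
  {within A, continuous (fun x => f x * g x)}.
Proof. by move=> cf cg x; apply: cvgM; [exact: cf|exact: cg]. Qed.

Lemma within_continuousD A f g : {within A, continuous f} -> {within A, continuous g} ->
  {within A, continuous (fun x => f x + g x)}.
Proof. by move=> cf cg x; apply: cvgD; [exact: cf|exact: cg]. Qed.

Lemma within_continuousB A f g : {within A, continuous f} -> {within A, continuous g} ->
  {within A, continuous (fun x => f x - g x)}.
Proof. by move=> cf cg x; apply: cvgB; [exact: cf|exact: cg]. Qed.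

Lemma within_continuous_cst A (c : R) : {within A, continuous (fun=> c)}.
Proof. by apply: continuous_subspaceT => x; exact: cvg_cst. Qed.

Lemma within_continuous_eq A f g : {in A, f =1 g} -> {within A, continuous f} ->
  {within A, continuous g}.
Proof.
move=> fg /subspace_continuousP cf; apply/subspace_continuousP => x Ax.
have gE : g x = f x by rewrite fg ?inE.
apply: (@cvg_trans _ (f @ within A (nbhs x))).
  by apply: near_eq_cvg; rewrite near_withinE; apply: nearW => y Ay; exact: fg (mem_set Ay).
by rewrite -[from_subspace A g x]/(g x) gE; exact: cf.
Qed.

Lemma within_continuous_bounded A f : {within A, continuous f} -> compact A ->
  exists2 M : R, 0 <= M & forall x, A x -> `|f x| <= M.
Proof.
move=> cf cA; have [M [_ BM]] := compact_bounded (continuous_compact cf cA).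
exists (`|M| + 1); first by rewrite addr_ge0.
move=> x Ax; apply: (BM (`|M| + 1)); last by exists x.
by rewrite ltr_pwDr // ler_norm.
Qed.

End within_continuity.

(** * Squares and cutoffs in the plane *)

Lemma integrable_bounded_support d (T : measurableType d) (R : realType)
    (mu : {measure set T -> \bar R}) (D K : set T) (f : T -> R) (M : R) :
  measurable D -> measurable K -> (mu K < +oo)%E -> measurable_fun D f ->
  (forall x, D x -> K x -> `|f x| <= M) -> (forall x, D x -> ~ K x -> f x = 0) ->
  mu.-integrable D (EFin \o f).
Proof.
move=> mD mK muK mf fM f0.
have iK : mu.-integrable (D `&` K) (EFin \o f).
  apply: measurable_bounded_integrable.
  - exact: measurableI.
  - by apply: le_lt_trans muK; apply: le_measure; rewrite ?inE //; exact: measurableI.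
  - by apply: measurable_funS mf => // x [].
  - exists `|M|; split; first exact: normr_real.
    by move=> N MN x [Dx Kx]; apply: le_trans (fM _ Dx Kx) _; rewrite (le_trans (ler_norm M)) // ltW.
apply/(integrable_mkcond _ mD).
rewrite (_ : (EFin \o f) \_ D = (EFin \o f) \_ (D `&` K)).
  by apply/(integrable_mkcond _ (measurableI _ _ mD mK)).
apply/funext => x; rewrite !patchE.
have [Dx|nDx] := pselect (D x); last first.
  by rewrite !ifN // notin_setE // => -[].
rewrite mem_set //; case: ifPn => //; rewrite notin_setE => nDK /=; rewrite f0 // => Kx.
by apply: nDK.
Qed.

Section plane.
Context {R : realType}.
Implicit Types (Omega : set (R * R)) (c x : R * R) (f : R * R -> R).

(** The norm of the product is the maximum norm, so that these closed balls are
    squares: products of intervals, as suits product measures and cutoffs. *)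
Definition box c (r : R) : set (R * R) := [set x | `|x - c| <= r].

Lemma boxP c (r : R) x : box c r x <-> `|x.1 - c.1| <= r /\ `|x.2 - c.2| <= r.
Proof. by rewrite /box /= prod_normE /= ge_max; split => [/andP//|[-> ->]]. Qed.

Lemma boxE c (r : R) : box c r = `[c.1 - r, c.1 + r] `*` `[c.2 - r, c.2 + r].
Proof.
apply/seteqP; split => x; rewrite boxP /= !in_itv /= !ler_norml; last first.
  by move=> [/andP[? ?] /andP[? ?]]; split; apply/andP; split; lra.
by move=> [/andP[? ?] /andP[? ?]]; split; apply/andP; split; lra.
Qed.

Lemma compact_box c (r : R) : compact (box c r).
Proof. by rewrite boxE; apply: compact_setX; exact: segment_compact. Qed.

Lemma closed_box c (r : R) : closed (box c r).
Proof. by apply: compact_closed; [exact: norm_hausdorff|exact: compact_box]. Qed.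

Lemma measurable_box c (r : R) : measurable (box c r : set (mplane R)).
Proof. by apply: closed_measurable2; exact: closed_box. Qed.

Lemma leb2_box c (r : R) : 0 <= r -> (leb2 (box c r : set (mplane R)) = (4 * r ^+ 2)%:E)%E.
Proof.
move=> r0; rewrite boxE product_measure1E //= !lebesgue_measure_itv /= !lte_fin.
have [->|rn0] := eqVneq r 0.
  by rewrite subr0 addr0 ltxx expr0n mulr0 mul0e.
have rgt0 : 0 < r by rewrite lt_def rn0.
have -> : c.1 - r < c.1 + r by lra.
have -> : c.2 - r < c.2 + r by lra.
by rewrite -!EFinB -EFinM; congr EFin; ring.
Qed.

Lemma leb2_box_fin c (r : R) : (leb2 (box c r : set (mplane R)) < +oo)%E.
Proof.
apply: (@le_lt_trans _ _ (leb2 (box c `|r| : set (mplane R)))).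
  apply: le_measure; rewrite ?inE; [exact: measurable_box|exact: measurable_box|].
  by move=> x; rewrite /box /= => /le_trans; apply; exact: ler_norm.
by rewrite leb2_box ?ltry.
Qed.

(** The partial derivatives are carried along as data, because at the boundary
    they are continuous extensions and not derivatives. *)
Definition C1_closure Omega f f1 f2 : Prop :=
  [/\ {within closure Omega, continuous f}, {within closure Omega, continuous f1},
      {within closure Omega, continuous f2} &
      forall x, Omega x -> [/\ differentiable f x, 'D_e1 f x = f1 x & 'D_e2 f x = f2 x]].

Lemma C1_closureM Omega f f1 f2 g g1 g2 :
  C1_closure Omega f f1 f2 -> C1_closure Omega g g1 g2 ->
  C1_closure Omega (fun x => f x * g x) (fun x => f1 x * g x + f x * g1 x)
    (fun x => f2 x * g x + f x * g2 x).
Proof.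
move=> [cf cf1 cf2 df] [cg cg1 cg2 dg]; split.
- exact: within_continuousM.
- by apply: within_continuousD; apply: within_continuousM.
- by apply: within_continuousD; apply: within_continuousM.
- move=> x Ox; have [dfx f1E f2E] := df x Ox; have [dgx g1E g2E] := dg x Ox.
  have D e : 'D_e (f * g) x = 'D_e f x * g x + f x * 'D_e g x.
    rewrite deriveM; [|exact: diff_derivable..].
    by rewrite /GRing.scale /= addrC [g x * _]mulrC.
  split; first exact: differentiableM.
    by rewrite [LHS](D e1) f1E g1E.
  by rewrite [LHS](D e2) f2E g2E.
Qed.

Lemma C1_closure_cst Omega (k : R) : C1_closure Omega (fun=> k) (fun=> 0) (fun=> 0).
Proof.
split; try exact: within_continuous_cst.
move=> x _; split; first exact: differentiable_cst.
  by rewrite (derive_cst k).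
by rewrite (derive_cst k).
Qed.

Lemma C1_closureD Omega f f1 f2 g g1 g2 :
  C1_closure Omega f f1 f2 -> C1_closure Omega g g1 g2 ->
  C1_closure Omega (fun x => f x + g x) (fun x => f1 x + g1 x) (fun x => f2 x + g2 x).
Proof.
move=> [cf cf1 cf2 df] [cg cg1 cg2 dg]; split; try exact: within_continuousD.
move=> x Ox; have [dfx f1E f2E] := df x Ox; have [dgx g1E g2E] := dg x Ox.
have D e : 'D_e (f + g) x = 'D_e f x + 'D_e g x.
  by rewrite deriveD //; exact: diff_derivable.
split; first exact: differentiableD.
  by rewrite [LHS](D e1) f1E g1E.
by rewrite [LHS](D e2) f2E g2E.
Qed.

Lemma C1_closureZ Omega f f1 f2 (k : R) :
  C1_closure Omega f f1 f2 ->
  C1_closure Omega (fun x => k * f x) (fun x => k * f1 x) (fun x => k * f2 x).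
Proof.
move=> Cf; have := C1_closureM (C1_closure_cst Omega k) Cf.
by congr C1_closure; apply/funext => x; rewrite mul0r add0r.
Qed.

Lemma C1_closureB Omega f f1 f2 g g1 g2 :
  C1_closure Omega f f1 f2 -> C1_closure Omega g g1 g2 ->
  C1_closure Omega (fun x => f x - g x) (fun x => f1 x - g1 x) (fun x => f2 x - g2 x).
Proof.
move=> Cf Cg; have := C1_closureD Cf (C1_closureZ (-1) Cg).
by congr C1_closure; apply/funext => x; rewrite mulN1r.
Qed.

Lemma deriv_fst x : ('D_e1 (fun y : R * R => y.1) x = 1) * ('D_e2 (fun y : R * R => y.1) x = 0).
Proof.
have l : linear (fst : R * R -> R) by [].
by split; rewrite deriveE ?diff_lin //; try exact: differentiable_fst;
  move=> y; exact: cvg_fst.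
Qed.

Lemma deriv_snd x : ('D_e1 (fun y : R * R => y.2) x = 0) * ('D_e2 (fun y : R * R => y.2) x = 1).
Proof.
by split; rewrite deriveE ?diff_lin //; try exact: differentiable_snd;
  move=> y; exact: cvg_snd.
Qed.

Lemma derive_comp (V : normedModType R) (l : V -> R) (g : R -> R) (x e : V) (g' : R) :
  differentiable l x -> is_derive (l x) (1 : R) g g' ->
  differentiable (fun y => g (l y)) x /\ 'D_e (fun y => g (l y)) x = g' * 'D_e l x.
Proof.
move=> dl [dg gE]; have dg' : differentiable g (l x) by exact/derivable1_diffP.
have dc : differentiable (g \o l) x by exact: differentiable_comp.
split; first exact: dc.
rewrite -[LHS]/('D_e (g \o l) x) (deriveE _ dc) diff_comp //= -(deriveE _ dl).
rewrite -{1}[X in 'd g (l x) X]mulr1 -[_ * 1]/(_ *: (1 : R)) linearZ /=.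
by rewrite -(deriveE _ dg') gE mulrC.
Qed.

(** The gradient of the cutoff lives between box c r and box c (2 * r) and has
    size 2 / r: the two facts on which the smallness of the remainder rests. *)
Definition cutoff c (r : R) x : R := plateau ((x.1 - c.1) / r) * plateau ((x.2 - c.2) / r).
Definition cutoff1 c (r : R) x : R := plateau' ((x.1 - c.1) / r) / r * plateau ((x.2 - c.2) / r).
Definition cutoff2 c (r : R) x : R := plateau ((x.1 - c.1) / r) * (plateau' ((x.2 - c.2) / r) / r).

Lemma C1_closure_comp1 Omega (g g' : R -> R) :
  (forall s, is_derive s (1 : R) g (g' s)) -> continuous g' ->
  C1_closure Omega (fun x => g x.1) (fun x => g' x.1) (fun=> 0).
Proof.
move=> dg cg'; split.
- apply: continuous_subspaceT => x; apply: (@cvg_comp _ _ _ fst g); first exact: cvg_fst.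
  exact: is_derive_continuous (dg _).
- by apply: continuous_subspaceT => x; apply: (@cvg_comp _ _ _ fst g'); [exact: cvg_fst|exact: cg'].
- exact: within_continuous_cst.
- move=> x _.
  have [d0 d1E] := derive_comp e1 (differentiable_fst x) (dg x.1).
  have [_ d2E] := derive_comp e2 (differentiable_fst x) (dg x.1).
  by split; rewrite ?d1E ?d2E ?(deriv_fst x) ?mulr1 ?mulr0.
Qed.

Lemma C1_closure_comp2 Omega (g g' : R -> R) :
  (forall s, is_derive s (1 : R) g (g' s)) -> continuous g' ->
  C1_closure Omega (fun x => g x.2) (fun=> 0) (fun x => g' x.2).
Proof.
move=> dg cg'; split.
- apply: continuous_subspaceT => x; apply: (@cvg_comp _ _ _ snd g); first exact: cvg_snd.
  exact: is_derive_continuous (dg _).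
- exact: within_continuous_cst.
- by apply: continuous_subspaceT => x; apply: (@cvg_comp _ _ _ snd g'); [exact: cvg_snd|exact: cg'].
- move=> x _.
  have [d0 d1E] := derive_comp e1 (differentiable_snd x) (dg x.2).
  have [_ d2E] := derive_comp e2 (differentiable_snd x) (dg x.2).
  by split; rewrite ?d1E ?d2E ?(deriv_snd x) ?mulr1 ?mulr0.
Qed.

Lemma C1_closure_cutoff Omega c (r : R) :
  C1_closure Omega (cutoff c r) (cutoff1 c r) (cutoff2 c r).
Proof.
have D (a s : R) : is_derive s (1 : R) (fun y => plateau ((y - a) / r)) (plateau' ((s - a) / r) / r).
  apply: (@is_derive_comp1 _ plateau (fun y => (y - a) / r)); first exact: is_derive_plateau.
  have := @is_derive_comp1 _ (fun y => y / r) (fun y => y - a) s r^-1 1 _ (is_derive_subr s a).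
  rewrite mulr1; apply.
  have := is_deriveM (is_derive_id (s - a) (1 : R)) (is_derive_cst (r^-1 : R) (s - a) (1 : R)).
  by rewrite scaler0 add0r /GRing.scale /= mulr1.
have cP (a : R) : continuous (fun s : R => plateau' ((s - a) / r) / r).
  move=> s; apply: cvgM; last exact: cvg_cst.
  apply: (@cvg_comp _ _ _ (fun s => (s - a) / r) plateau'); last exact: continuous_plateau'.
  apply: cvgM; last exact: cvg_cst.
  by apply: cvgB; [exact: cvg_id|exact: cvg_cst].
have := C1_closureM (C1_closure_comp1 Omega (D c.1) (cP c.1)) (C1_closure_comp2 Omega (D c.2) (cP c.2)).
by congr C1_closure; apply/funext => x; rewrite /= ?mul0r ?mulr0 ?addr0 ?add0r.
Qed.

Lemma measurable_cutoff c (r : R) : measurable_fun setT (cutoff c r : mplane R -> R).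
Proof.
have [cc _ _ _] := C1_closure_cutoff setT c r.
by rewrite closureT in cc; exact: within_continuous_measurable2.
Qed.

Lemma cutoff_bounds c (r : R) x : 0 <= cutoff c r x <= 1.
Proof.
have /andP[a0 a1] := plateau_bounds ((x.1 - c.1) / r).
have /andP[b0 b1] := plateau_bounds ((x.2 - c.2) / r).
by rewrite /cutoff mulr_ge0 //= mulr_ile1.
Qed.

Lemma cutoff_eq1 c (r : R) x : 0 < r -> box c r x -> cutoff c r x = 1.
Proof.
move=> r0 /boxP[h1 h2]; rewrite /cutoff !plateau_eq1 ?mulr1 // normrM normfV (gtr0_norm r0) ler_pdivrMr // mul1r //.
Qed.

Lemma cutoff_eq0 c (r : R) x : 0 < r -> ~ box c (2 * r) x -> cutoff c r x = 0.
Proof.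
move=> r0 nb; rewrite /cutoff.
have [h1|h1] := leP 2 (`|(x.1 - c.1) / r|); first by rewrite plateau_eq0 // mul0r.
have [h2|h2] := leP 2 (`|(x.2 - c.2) / r|); first by rewrite (plateau_eq0 h2) mulr0.
exfalso; apply: nb; apply/boxP.
by move: h1 h2; rewrite !normrM normfV (gtr0_norm r0) !ltr_pdivrMr // => /ltW ? /ltW ?.
Qed.

Lemma cutoff_gradient_eq0 c (r : R) x : 0 < r -> box c r x ->
  cutoff1 c r x = 0 /\ cutoff2 c r x = 0.
Proof.
move=> r0 /boxP[h1 h2]; rewrite /cutoff1 /cutoff2 !plateau'_eq0 ?mul0r ?mulr0 //
  normrM normfV (gtr0_norm r0) ler_pdivrMr // mul1r //.
Qed.

Lemma cutoff_gradient_eq0_far c (r : R) x : 0 < r -> ~ box c (2 * r) x ->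
  cutoff1 c r x = 0 /\ cutoff2 c r x = 0.
Proof.
move=> r0 nb; rewrite /cutoff1 /cutoff2.
have [h1|h1] := leP 2 (`|(x.1 - c.1) / r|).
  by rewrite (plateau_eq0 h1) (plateau'_eq0_far h1) !mul0r.
have [h2|h2] := leP 2 (`|(x.2 - c.2) / r|).
  by rewrite (plateau_eq0 h2) (plateau'_eq0_far h2) !(mul0r, mulr0).
exfalso; apply: nb; apply/boxP.
by move: h1 h2; rewrite !normrM normfV (gtr0_norm r0) !ltr_pdivrMr // => /ltW ? /ltW ?.
Qed.

Lemma cutoff_gradient_bound c (r : R) x : 0 < r ->
  `|cutoff1 c r x| <= 2 / r /\ `|cutoff2 c r x| <= 2 / r.
Proof.
move=> r0.
have P a : `|plateau a| <= (1 : R).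
  by have /andP[a0 a1] := plateau_bounds a; rewrite ger0_norm.
have Q (a : R) : `|plateau' a / r| <= 2 / r.
  by rewrite normrM normfV (gtr0_norm r0) ler_pM2r ?invr_gt0 //; exact: plateau'_bound.
rewrite /cutoff1 /cutoff2 ![`|_ * plateau _|]normrM ![`|plateau _ * _|]normrM.
split; first by rewrite -[leRHS]mulr1 ler_pM.
by rewrite -[leRHS]mul1r ler_pM.
Qed.

End plane.

(** * Integrals of derivatives over the half-plane *)

Section restriction.
Context {R : realType}.

Lemma continuous_pairr (T U : topologicalType) (s : T) : continuous (fun z : U => (s, z)).
Proof.
move=> z P [[A B] /= [nA nB] AB]; apply: filterS nB => y By.
by apply: AB; split => //; exact: nbhs_singleton nA.
Qed.

Lemma continuous_pairl (T U : topologicalType) (s : T) : continuous (fun z : U => (z, s)).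
Proof.
move=> z P [[A B] /= [nA nB] AB]; apply: filterS nA => y Ay.
by apply: AB; split => //; exact: nbhs_singleton nB.
Qed.

Lemma restriction_continuous_comp (U V W : topologicalType) (A : set U) (B : set V)
    (g : U -> V) (f : V -> W) :
  {within A, continuous g} -> {within B, continuous f} -> (forall x, A x -> B (g x)) ->
  {within A, continuous (fun x => f (g x))}.
Proof.
move=> /subspace_continuousP cg /subspace_continuousP cf gAB.
apply/subspace_continuousP => x Ax P Px.
have H : nbhs x (fun y => A y -> B (g y) -> P (f (g y))) := cg x Ax _ (cf _ (gAB _ Ax) _ Px).
change (nbhs x (fun y => A y -> P (f (g y)))).
by apply: filterS H => y h Ay; exact: h Ay (gAB _ Ay).
Qed.

Lemma is_derive_slice1 (f : R * R -> R) (s z : R) : derivable f (s, z) e1 ->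
  is_derive s (1 : R) (fun s => f (s, z)) ('D_e1 f (s, z)).
Proof.
have E : (fun h : R => h^-1 *: (f (h *: (1 : R) + s, z) - f (s, z))) =
         (fun h : R => h^-1 *: (f (h *: e1 + (s, z)) - f (s, z))).
  apply/funext => h; congr (_ *: (f _ - _)).
  by congr (_, _) => /=; rewrite /GRing.scale /= mulr0 add0r.
by move=> df; apply: DeriveDef; [move: df; rewrite /derivable /= E|rewrite /derive /= E].
Qed.

Lemma is_derive_slice2 (f : R * R -> R) (s z : R) : derivable f (s, z) e2 ->
  is_derive z (1 : R) (fun z => f (s, z)) ('D_e2 f (s, z)).
Proof.
have E : (fun h : R => h^-1 *: (f (s, h *: (1 : R) + z) - f (s, z))) =
         (fun h : R => h^-1 *: (f (h *: e2 + (s, z)) - f (s, z))).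
  apply/funext => h; congr (_ *: (f _ - _)).
  by congr (_, _) => /=; rewrite /GRing.scale /= mulr0 add0r.
by move=> df; apply: DeriveDef; [move: df; rewrite /derivable /= E|rewrite /derive /= E].
Qed.

(** The fundamental theorem of calculus for a derivative that vanishes on the part
    of D outside ]a, b[; D is a line or a half-line below. *)
Lemma integral_derivative_support (D : set R) (u u' : R -> R) (a b : R) : a < b ->
  {within `[a, b], continuous u} -> {within `[a, b], continuous u'} ->
  (forall z, a < z < b -> derivable u z 1 /\ 'D_1 u z = u' z) ->
  `]a, b[ `<=` D -> (forall z, D z -> ~ (a < z < b) -> u' z = 0) ->
  (\int[@lebesgue_measure R]_(z in D) (u' z)%:E = (u b - u a)%:E)%E.
Proof.
move=> ab cu cu' du abD u'0.
have mu' : measurable_fun `]a, b[ (fun z => (u' z)%:E).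
  apply/measurable_EFinP; apply: (@measurable_funS _ _ _ _ `[a, b]%classic) => //.
    by move=> z /=; rewrite !in_itv /= => /andP[az zb]; rewrite !ltW.
  exact: subspace_continuous_measurable_fun.
transitivity (\int[@lebesgue_measure R]_(z in `]a, b[) (u' z)%:E)%E.
  rewrite integral_mkcond [RHS]integral_mkcond; congr (integral _ _ _).
  apply/funext => z; rewrite !patchE.
  have [zab|zab] := boolP (z \in (`]a, b[)%classic).
    by rewrite mem_set //; apply: abD; rewrite inE in zab.
  case: ifPn => // /[!inE] Dz; rewrite u'0 //.
  by move: zab; rewrite notin_setE /= in_itv.
rewrite -(@integral_itv_bndoo _ a b _ true false) //.
rewrite (@continuous_FTC2 R u' u a b) //.
  split.
  - by move=> z /[!in_itv]/= zab; have [] := du z zab.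
  - by have /(continuous_within_itvP _ ab)[] := cu.
  - by have /(continuous_within_itvP _ ab)[] := cu.
by move=> z /[!in_itv]/= zab; rewrite derive1E; have [_ ->] := du z zab.
Qed.

End restriction.

Section half_plane.
Context {R : realType}.

Definition half_plane : set (R * R) := [set p | 0 < p.2].

Lemma open_half_plane : open half_plane.
Proof.
apply: (@open_comp _ _ snd [set x : R | 0 < x]); last exact: open_gt.
by move=> x _; exact: cvg_snd.
Qed.

Lemma closure_half_plane : closure half_plane = [set p : R * R | 0 <= p.2].
Proof.
apply/seteqP; split.
  have cH : closed (snd @^-1` [set x : R | 0 <= x] : set (R * R)).
    by apply: (@closed_comp _ _ snd); [move=> x _; exact: cvg_snd|exact: closed_ge].
  rewrite [X in _ `<=` X](_ : _ = snd @^-1` [set x : R | 0 <= x]) //.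
  rewrite [X in _ `<=` X]((closure_id _).1 cH); apply: closure_subset.
  by move=> p /ltW.
move=> [s z] /= z0 B /nbhs_ballP[e /= e0 eB].
exists (s, z + e / 2); split; first by rewrite /half_plane /=; lra.
apply: eB; split; rewrite /ball /= ?subrr ?normr0 //.
by rewrite opprD addNKr normrN gtr0_norm; lra.
Qed.

Lemma C1_closure_support (Omega K : set (R * R)) (f f1 f2 : R * R -> R) :
  closed K -> C1_closure Omega f f1 f2 -> (forall x, ~ K x -> f x = 0) ->
  forall x, Omega x -> ~ K x -> f1 x = 0 /\ f2 x = 0.
Proof.
move=> cK [_ _ _ df] f0 x Ox nKx; have [_ <- <-] := df x Ox.
have n0 : \forall y \near x, f y = cst 0 y.
  have : nbhs x (~` K) by apply: open_nbhs_nbhs; split => //; exact: closed_openC.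
  by apply: filterS => y; exact: f0.
by rewrite !(near_eq_derive _ n0) !derive_cst.
Qed.

Lemma closed_compactI (A K : set (R * R)) : closed A -> compact K -> compact (A `&` K).
Proof. by move=> cA cK; rewrite setIC; exact: compact_closedI. Qed.

Lemma integrable_closure (Omega : set (R * R)) (f : R * R -> R) c (r : R) :
  open Omega -> {within closure Omega, continuous f} ->
  (forall x, Omega x -> ~ box c r x -> f x = 0) ->
  (leb2 : {measure set (mplane R) -> \bar R}).-integrable Omega (EFin \o f).
Proof.
move=> oO cf f0.
have cK : compact (closure Omega `&` box c r).
  by apply: closed_compactI; [exact: closed_closure|exact: compact_box].
have [M M0 fM] := within_continuous_bounded (continuous_subspaceW (@subIsetl _ _ _) cf) cK.
apply: (@integrable_bounded_support _ (mplane R) R leb2 Omega (box c r) f M).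
- exact: open_measurable2.
- exact: measurable_box.
- exact: leb2_box_fin.
- apply: within_continuous_measurable2; first exact: open_measurable2.
  exact: continuous_subspaceW (@subset_closure _ _) cf.
- by move=> x Ox Kx; apply: fM; split => //; exact: subset_closure.
- exact: f0.
Qed.

Variables (f f1 f2 : R * R -> R) (M : R).
Hypotheses (M0 : 0 < M) (Cf : C1_closure half_plane f f1 f2)
  (f0 : forall x, ~ box 0 M x -> f x = 0).

Let f120 x : half_plane x -> ~ box 0 M x -> f1 x = 0 /\ f2 x = 0.
Proof. exact: C1_closure_support (@closed_box _ _ _) Cf f0 x. Qed.

Let box0 (x : R * R) : box 0 M x <-> `|x.1| <= M /\ `|x.2| <= M.
Proof. by rewrite boxP !subr0. Qed.

(** On each vertical line the fundamental theorem leaves the value at the boundary,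
    with a minus sign because the outward normal points down. *)
Lemma half_plane_integral2 :
  (\int[leb2]_(p in half_plane) (f2 p)%:E = \int[leb1]_s (- f (s, 0))%:E)%E.
Proof.
have [cf cf1 cf2 df] := Cf.
have i2 : (leb2 : {measure set (mplane R) -> \bar R}).-integrable half_plane (EFin \o f2).
  apply: (integrable_closure open_half_plane cf2 (c := 0) (r := M)) => x Hx nx.
  by have [] := f120 Hx nx.
have mH : measurable (half_plane : set (mplane R)) by apply: open_measurable2; exact: open_half_plane.
rewrite integral_mkcond.
have /(integrable_mkcond _ mH) i2' := i2.
rewrite -(integral12_prod_meas1 i2'); apply: eq_integral => s _; rewrite /fubini_F.
transitivity (\int[@lebesgue_measure R]_(z in [set z : R | (0 < z)%R]) (f2 (s, z))%:E)%E.
  by rewrite [RHS]integral_mkcond; apply: eq_integral => z _; rewrite !patchE.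
rewrite (@integral_derivative_support R _ (fun z => f (s, z)) (fun z => f2 (s, z)) 0 (M + 1)).
- congr EFin; rewrite [f (s, M + 1)]f0 ?sub0r // box0 => -[_ /=].
  by move/(le_trans (ler_norm _)) => h; lra.
- by have m0 := M0; lra.
- apply: (restriction_continuous_comp (B := closure half_plane) (f := f)) => //.
    by apply: continuous_subspaceT; exact: continuous_pairr.
  by move=> z; rewrite closure_half_plane /= in_itv /= => /andP[].
- apply: (restriction_continuous_comp (B := closure half_plane) (f := f2)) => //.
    by apply: continuous_subspaceT; exact: continuous_pairr.
  by move=> z; rewrite closure_half_plane /= in_itv /= => /andP[].
- move=> z /andP[z0 _]; have [dfz _ <-] := df (s, z) z0.
  by have [] := is_derive_slice2 (diff_derivable dfz).
- by move=> z /=; rewrite in_itv /= => /andP[].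
- move=> z z0 nz; have [] := @f120 (s, z) z0; last by [].
  rewrite box0 => -[_ /=]; rewrite gtr0_norm // => zM.
  by apply: nz; rewrite z0 /=; lra.
Qed.

(** On a horizontal line both ends lie outside the support. *)
Lemma half_plane_integral1 : (\int[leb2]_(p in half_plane) (f1 p)%:E = 0)%E.
Proof.
have [cf cf1 cf2 df] := Cf.
have i1 : (leb2 : {measure set (mplane R) -> \bar R}).-integrable half_plane (EFin \o f1).
  apply: (integrable_closure open_half_plane cf1 (c := 0) (r := M)) => x Hx nx.
  by have [] := f120 Hx nx.
have mH : measurable (half_plane : set (mplane R)) by apply: open_measurable2; exact: open_half_plane.
rewrite integral_mkcond.
have /(integrable_mkcond _ mH) i1' := i1.
rewrite -(integral21_prod_meas1 i1'); apply: integral0_eq => z _; rewrite /fubini_G.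
have [z0|z0] := ltP 0 z; last first.
  by apply: integral0_eq => s _; rewrite patchE ifN // notin_setE /half_plane /= => h; move: z0; rewrite leNgt h.
transitivity (\int[@lebesgue_measure R]_(s in setT) (f1 (s, z))%:E)%E.
  by apply: eq_integral => s _; rewrite !patchE mem_set.
rewrite (@integral_derivative_support R _ (fun s => f (s, z)) (fun s => f1 (s, z)) (- (M + 1)) (M + 1)).
- rewrite !f0 ?subr0 // box0 => -[/= + _].
    by rewrite normrN => /(le_trans (ler_norm _)) h; lra.
  by move/(le_trans (ler_norm _)) => h; lra.
- by have m0 := M0; lra.
- apply: (restriction_continuous_comp (B := closure half_plane) (f := f)) => //.
    by apply: continuous_subspaceT; exact: continuous_pairl.
  by move=> s _; rewrite closure_half_plane /= ltW.
- apply: (restriction_continuous_comp (B := closure half_plane) (f := f1)) => //.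
    by apply: continuous_subspaceT; exact: continuous_pairl.
  by move=> s _; rewrite closure_half_plane /= ltW.
- move=> s _; have [dfz <- _] := df (s, z) z0.
  by have [] := is_derive_slice1 (diff_derivable dfz).
- by [].
- move=> s _ ns; have [] := @f120 (s, z) z0; last by [].
  rewrite box0 => -[/= sM _].
  by apply: ns; move: sM; rewrite ler_norml => /andP[? ?]; apply/andP; split; lra.
Qed.

End half_plane.

(** * Measures with a density on a parametrised set *)

Section image_density.
Local Open Scope ereal_scope.
Context d1 d2 (X : measurableType d1) (Y : measurableType d2) (R : realType).
Variables (la : {measure set X -> \bar R}) (sg : {measure set Y -> \bar R}).
Variables (g : X -> Y) (k : X -> R) (B : set Y).
Hypotheses (mg : measurable_fun setT g) (mk : measurable_fun setT k)
  (k0 : forall x, (0 <= k x)%R) (mB : measurable B).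
Hypothesis sgE : forall A, measurable A -> A `<=` B ->
  sg A = \int[la]_(x in g @^-1` A) (k x)%:E.

Let mgB A : measurable A -> measurable (g @^-1` A).
Proof. by move=> mA; rewrite -[X in measurable X]setTI; exact: mg. Qed.

Import HBNNSimple.

(** The change of variables behind the surface measure: from the measures of the
    sets to simple functions by linearity, and from these to nonnegative functions
    by monotone convergence. *)
Lemma ge0_integral_image_density (f : Y -> \bar R) :
  measurable_fun B f -> (forall y, B y -> 0 <= f y) ->
  \int[sg]_(y in B) f y = \int[la]_(x in g @^-1` B) (f (g x) * (k x)%:E).
Proof.
move=> mf f0; pose f_ := nnsfun_approx mB mf.
have mkE D : measurable D -> measurable_fun D (fun x => (k x)%:E).
  by move=> mD; apply/measurable_EFinP; exact: measurable_funS mk.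
transitivity (limn (fun n => \int[sg]_(y in B) (f_ n y)%:E)).
  rewrite -monotone_convergence//.
  - apply: eq_integral => y /[!inE] yD; apply/esym/cvg_lim => //.
    exact: cvg_nnsfun_approx.
  - by move=> n; exact/measurable_EFinP/measurable_funP.
  - by move=> n y _; rewrite lee_fin.
  - by move=> y _ m n mn; rewrite lee_fin; exact/lefP/nd_nnsfun_approx.
rewrite [X in limn X](_ : _ =
    (fun n => \int[la]_(x in g @^-1` B) ((f_ n (g x))%:E * (k x)%:E))).
  rewrite -monotone_convergence//.
  - apply: eq_integral => x /[!inE] gx; apply/cvg_lim => //.
    by apply: cvgeZr => //; exact: cvg_nnsfun_approx.
  - exact: mgB.
  - move=> n; apply: emeasurable_funM; last exact/mkE/mgB.
    apply/measurable_EFinP; apply: (measurable_funS measurableT) => //.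
    by apply: measurableT_comp => //; exact: mg.
  - by move=> n x _; rewrite mule_ge0 // lee_fin.
  - move=> x _ m n mn; apply: lee_wpmul2r; rewrite ?lee_fin //.
    exact/lefP/nd_nnsfun_approx.
apply/funext => n.
have mfn r : measurable (f_ n @^-1` [set r]) by [].
transitivity (\sum_(r \in range (f_ n))
    \int[sg]_(y in B) (r * \1_(f_ n @^-1` [set r]) y)%:E).
  under eq_integral do rewrite fimfunE -fsumEFin//.
  rewrite ge0_integral_fsum//.
  - by move=> y; exact/measurable_EFinP/measurable_funM.
  - by move=> y x _; rewrite nnfun_muleindic_ge0.
transitivity (\sum_(r \in range (f_ n))
    \int[la]_(x in g @^-1` B) ((r * \1_(f_ n @^-1` [set r]) (g x))%:E * (k x)%:E)); last first.
  rewrite -ge0_integral_fsum//.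
  - apply: eq_integral => x _; rewrite fimfunE -fsumEFin// ge0_mule_fsuml//.
    by move=> r; rewrite nnfun_muleindic_ge0.
  - exact: mgB.
  - move=> r; apply: emeasurable_funM; last exact/mkE/mgB.
    apply/measurable_EFinP; apply: (measurable_funS measurableT) => //.
    apply: measurable_funM => //.
    by apply: (measurableT_comp _ mg); exact: measurable_indic.
  - by move=> r x _; rewrite mule_ge0 ?nnfun_muleindic_ge0 ?lee_fin.
apply: eq_fsbigr => r /[!inE] -[y0 _ <-].
rewrite integralZl_indic_nnsfun//.
under [RHS]eq_integral do rewrite EFinM -muleA.
rewrite ge0_integralZl//; last 4 first.
- exact: mgB.
- apply: emeasurable_funM; last exact/mkE/mgB.
  apply/measurable_EFinP; apply: (measurable_funS measurableT) => //.
  by apply: (measurableT_comp _ mg); exact: measurable_indic.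
- by move=> x _; rewrite mule_ge0 ?lee_fin.
- by rewrite lee_fin.
congr (_ * _); rewrite integral_indic// sgE; last 2 first.
- exact: measurableI.
- by move=> y [].
rewrite preimage_setI setIC integral_mkcondr; apply: eq_integral => x _.
rewrite patchE indicE; have [xA|xA] := pselect ((f_ n @^-1` [set f_ n y0]) (g x)).
  by rewrite !mem_set // mul1e.
by rewrite !memNset // mul0e.
Qed.

Lemma integral_image_density (f : Y -> R) : measurable_fun B f ->
  la.-integrable (g @^-1` B) (fun x => (f (g x) * k x)%:E) ->
  sg.-integrable B (EFin \o f) /\
  \int[sg]_(y in B) (f y)%:E = \int[la]_(x in g @^-1` B) (f (g x) * k x)%:E.
Proof.
move=> mf ifk; split.
  apply/integrableP; split; first exact/measurable_EFinP.
  rewrite ge0_integral_image_density//; last first.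
    by apply: measurableT_comp => //; exact/measurable_EFinP.
  have /integrableP[_] := ifk; apply: le_lt_trans.
  rewrite le_eqVlt; apply/orP; left; apply/eqP; apply: eq_integral => x _ /=.
  by rewrite normrM EFinM (ger0_norm (k0 _)).
rewrite integralE [RHS]integralE; have mfE : measurable_fun B (EFin \o f) by exact/measurable_EFinP.
congr (_ - _).
  rewrite ge0_integral_image_density//; last exact: measurable_funepos.
  apply: eq_integral => x _; rewrite unlock /=.
  by rewrite -!EFin_max -EFinM maxr_pMl // mul0r.
rewrite ge0_integral_image_density//; last exact: measurable_funeneg.
apply: eq_integral => x _; rewrite unlock /=.
by rewrite -!EFin_max -EFinM maxr_pMl // mul0r mulNr.
Qed.

End image_density.

(** * Graph charts and the outward normal *)

Section chart.
Context {R : realType}.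
Implicit Types (Omega U : set (R * R)) (n x : R * R) (gamma : R -> R).

Lemma unit_sqr n : enorm n = 1 -> n.1 ^+ 2 + n.2 ^+ 2 = 1.
Proof.
move=> n1; have := congr1 (fun x : R => x ^+ 2) n1; rewrite /enorm /dot sqr_sqrtr ?expr1n ?expr2 //.
by rewrite addr_ge0 // -expr2 sqr_ge0.
Qed.

Lemma dot_rot_graph_coords n gamma p : enorm n = 1 ->
  dot (Defs.rot n) (graph_coords n gamma p) = p.1.
Proof.
move=> /unit_sqr n1; rewrite /dot graph_coords1 graph_coords2 /=.
by rewrite -[RHS]mulr1 -n1; ring.
Qed.

Lemma dot_graph_coords n gamma p : enorm n = 1 ->
  dot n (graph_coords n gamma p) = gamma p.1 + p.2.
Proof.
move=> /unit_sqr n1; rewrite /dot graph_coords1 graph_coords2 /=.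
by rewrite -[RHS]mulr1 -n1; ring.
Qed.

Lemma graph_coords_dot n gamma x : enorm n = 1 ->
  graph_coords n gamma (dot (Defs.rot n) x, dot n x - gamma (dot (Defs.rot n) x)) = x.
Proof.
move=> /unit_sqr n1; rewrite [LHS]surjective_pairing graph_coords1 graph_coords2 /=.
rewrite [RHS]surjective_pairing; congr (_, _); rewrite /dot /=.
  by rewrite -[RHS]mulr1 -n1; ring.
by rewrite -[RHS]mulr1 -n1; ring.
Qed.

Lemma graph_point_coords n gamma s : graph_point n gamma s = graph_coords n gamma (s, 0).
Proof. by rewrite /graph_point /graph_coords /= addr0. Qed.

Lemma chart_derivative Omega U n gamma : graph_chart Omega U n gamma ->
  forall s, is_derive s (1 : R) gamma (derive1 gamma s).
Proof.
by move=> [_ _ dg _] s; rewrite derive1E; apply: derivableP; exact: dg 0%N s.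
Qed.

Lemma chart_derivative2 Omega U n gamma : graph_chart Omega U n gamma ->
  forall s, is_derive s (1 : R) (derive1 gamma) (derive1n 2 gamma s).
Proof.
by move=> [_ _ dg _] s; rewrite /= derive1E; apply: derivableP; exact: dg 1%N s.
Qed.

Lemma chart_continuous2 Omega U n gamma : graph_chart Omega U n gamma ->
  continuous (derive1n 2 gamma).
Proof.
move=> [_ _ dg _] s; apply: differentiable_continuous; apply/derivable1_diffP.
exact: dg 2%N s.
Qed.

Lemma chart_continuous Omega U n gamma : graph_chart Omega U n gamma ->
  continuous gamma.
Proof. by move=> ch s; exact: is_derive_continuous (chart_derivative ch s). Qed.

Lemma chart_continuous1 Omega U n gamma : graph_chart Omega U n gamma ->
  continuous (derive1 gamma).
Proof. by move=> ch s; exact: is_derive_continuous (chart_derivative2 ch s). Qed.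

Lemma continuous_dot n : continuous (dot n).
Proof.
move=> x; apply: cvgD; apply: cvgM; try exact: cvg_cst.
  exact: cvg_fst.
exact: cvg_snd.
Qed.

Lemma C1_graph_coords Omega' Omega U n gamma : graph_chart Omega U n gamma ->
  C1_closure Omega' (fun p => (graph_coords n gamma p).1)
     (fun p => n.2 + derive1 gamma p.1 * n.1) (fun=> n.1) /\
  C1_closure Omega' (fun p => (graph_coords n gamma p).2)
     (fun p => - n.1 + derive1 gamma p.1 * n.2) (fun=> n.2).
Proof.
move=> ch.
have id1 : forall s : R, is_derive s (1 : R) id (cst 1 s) by move=> s; exact: is_derive_id.
have c1 : continuous (cst 1 : R -> R) by move=> s; exact: cvg_cst.
have Cs := C1_closure_comp1 Omega' id1 c1.
have Cz := C1_closure_comp2 Omega' id1 c1.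
have Cg := C1_closure_comp1 Omega' (chart_derivative ch) (chart_continuous1 ch).
split.
  have := C1_closureD (C1_closureZ n.2 Cs) (C1_closureZ n.1 (C1_closureD Cg Cz)).
  congr C1_closure; apply/funext => p; rewrite ?graph_coords1 /cst /=; ring.
have := C1_closureD (C1_closureZ (- n.1) Cs) (C1_closureZ n.2 (C1_closureD Cg Cz)).
congr C1_closure; apply/funext => p; rewrite ?graph_coords2 /cst /=; ring.
Qed.

Lemma continuous_pair (T U V : topologicalType) (f : T -> U) (g : T -> V) (x : T) :
  {for x, continuous f} -> {for x, continuous g} ->
  {for x, continuous (fun y => (f y, g y))}.
Proof. by move=> cf cg; apply: cvg_pair. Qed.

Lemma continuous_graph_coords Omega U n gamma : graph_chart Omega U n gamma ->
  continuous (graph_coords n gamma).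
Proof.
move=> ch p; have [[_ _ _ d1] [_ _ _ d2]] := C1_graph_coords setT ch.
have [/differentiable_continuous c1 _ _] := d1 p I.
have [/differentiable_continuous c2 _ _] := d2 p I.
rewrite (_ : graph_coords n gamma = fun p => ((graph_coords n gamma p).1, (graph_coords n gamma p).2)).
  exact: continuous_pair c1 c2.
by apply/funext => q; rewrite -surjective_pairing.
Qed.

Lemma chart_half_plane Omega U n gamma p : graph_chart Omega U n gamma ->
  U (graph_coords n gamma p) -> (Omega (graph_coords n gamma p) <-> half_plane p).
Proof.
move=> [_ n1 _ H] /H ->; rewrite dot_rot_graph_coords // dot_graph_coords // /half_plane /=.
by rewrite ltrDl.
Qed.

Lemma chart_closure Omega U n gamma p : graph_chart Omega U n gamma ->
  U (graph_coords n gamma p) -> closure half_plane p -> closure Omega (graph_coords n gamma p).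
Proof.
move=> ch Up Hp N nN.
have [oU _ _ _] := ch.
have cg := continuous_graph_coords ch (x := p).
have nU : nbhs (graph_coords n gamma p) U by exact: open_nbhs_nbhs.
have [q [Hq [Nq Uq]]] := Hp _ (cg _ (filterI nN nU)).
by exists (graph_coords n gamma q); split => //; apply/(chart_half_plane ch Uq).
Qed.

(** In a chart the boundary is the graph itself: a point above the graph lies in
    the open set Omega, and a point below it has a neighbourhood that avoids Omega. *)
Lemma chart_boundary Omega U n gamma x : open Omega -> graph_chart Omega U n gamma ->
  U x -> (boundary Omega x <-> dot n x = gamma (dot (Defs.rot n) x)).
Proof.
move=> oO ch Ux; have [oU n1 _ H] := ch.
have iO : interior Omega = Omega by apply/interior_id.
rewrite /boundary iO; split => [[clx nOx]|E].
  apply/eqP; rewrite eq_le; apply/andP; split; rewrite leNgt; apply/negP => lt.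
    by apply: nOx; apply/H.
  pose dl y : R := dot n y - gamma (dot (Defs.rot n) y).
  have cdl : {for x, continuous dl}.
    apply: cvgB; first exact: continuous_dot.
    apply: (@cvg_comp _ _ _ (dot (Defs.rot n)) gamma); first exact: continuous_dot.
    exact: chart_continuous ch _.
  have nlt : nbhs x (fun y => dl y < 0).
    have : nbhs (dl x) [set r | r < 0].
      by apply: open_nbhs_nbhs; split; [exact: open_lt|rewrite /= subr_lt0].
    exact: cdl.
  have nU : nbhs x U by exact: open_nbhs_nbhs.
  have [y [Oy [dy Uy]]] := clx _ (filterI nlt nU).
  have /H := Uy; rewrite /dl subr_lt0 in dy; move=> [+ _] => /(_ Oy).
  by rewrite ltNge (ltW dy).
split; last by move=> /(H _ Ux); rewrite E ltxx.
rewrite -(graph_coords_dot gamma x n1) E subrr.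
apply: (chart_closure ch).
  by have := graph_coords_dot gamma x n1; rewrite E subrr => ->.
by rewrite closure_half_plane /=.
Qed.

Definition chart_normal n gamma (s : R) : R * R :=
  (arc_element gamma s)^-1 *: (derive1 gamma s *: Defs.rot n - n).

Lemma arc_element_gt0 gamma s : 0 < arc_element gamma s.
Proof. by rewrite sqrtr_gt0 ltr_wpDr // sqr_ge0. Qed.

Lemma arc_element_sqr gamma s : arc_element gamma s ^+ 2 = 1 + derive1 gamma s ^+ 2.
Proof. by rewrite sqr_sqrtr // addr_ge0 // sqr_ge0. Qed.

Lemma chart_normal_unit n gamma s : enorm n = 1 ->
  dot (chart_normal n gamma s) (chart_normal n gamma s) = 1.
Proof.
move=> /unit_sqr n1; have a0 := arc_element_gt0 gamma s.
rewrite /dot /chart_normal /= /GRing.scale /=.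
set a := arc_element gamma s; set g := derive1 gamma s.
have -> : a^-1 * (g * n.2 - n.1) * (a^-1 * (g * n.2 - n.1)) +
   a^-1 * (g * - n.1 - n.2) * (a^-1 * (g * - n.1 - n.2)) =
   (1 + g ^+ 2) * (n.1 ^+ 2 + n.2 ^+ 2) / a ^+ 2 by field; rewrite gt_eqF.
by rewrite n1 mulr1 arc_element_sqr divff // gt_eqF // ltr_wpDr // sqr_ge0.
Qed.

(** A direction w that makes an acute angle with the normal leaves Omega, one
    that makes an obtuse angle enters it.  Indeed the height over the graph along
    x + h *: w has at h = 0 the derivative - a c, where a is the arc element. *)
Lemma chart_normal_direction Omega U n gamma x (w : R * R) : open Omega ->
  graph_chart Omega U n gamma -> U x -> boundary Omega x ->
  let c := dot (chart_normal n gamma (dot (Defs.rot n) x)) w in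
  (c < 0 -> \forall h \near (0 : R)^'+, Omega (x + h *: w)) /\
  (0 < c -> \forall h \near (0 : R)^'+, ~ Omega (x + h *: w)).
Proof.
move=> oO ch Ux Bx c; have [oU n1 _ H] := ch.
have E := (chart_boundary oO ch Ux).1 Bx.
set s := dot (Defs.rot n) x in c E *.
pose phi (h : R) := dot n x + h * dot n w - gamma (s + h * dot (Defs.rot n) w).
have phiE h : dot n (x + h *: w) - gamma (dot (Defs.rot n) (x + h *: w)) = phi h.
  rewrite /phi /s /dot /= /GRing.scale /=; congr (_ - gamma _); ring.
pose a := arc_element gamma s; have a0 : 0 < a := arc_element_gt0 gamma s.
have dphi : is_derive (0 : R) (1 : R) phi (- a * c).
  have dl (p q : R) : is_derive (0 : R) (1 : R) (fun h => p + h * q) q.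
    have := is_deriveD (is_derive_cst p (0 : R) (1 : R))
      (is_deriveM (is_derive_id (0 : R) (1 : R)) (is_derive_cst q (0 : R) (1 : R))).
    by rewrite scaler0 !add0r /GRing.scale /= mulr1.
  have dg : is_derive (0 : R) (1 : R) (fun h => gamma (s + h * dot (Defs.rot n) w))
      (derive1 gamma s * dot (Defs.rot n) w).
    have dgs : is_derive (s + 0 * dot (Defs.rot n) w) (1 : R) gamma (derive1 gamma s).
      by rewrite mul0r addr0; exact: chart_derivative ch s.
    exact: (@is_derive_comp1 _ gamma (fun h => s + h * dot (Defs.rot n) w) 0 _ _ dgs (dl _ _)).
  have := is_deriveB (dl (dot n x) (dot n w)) dg.
  rewrite (_ : - a * c = dot n w - derive1 gamma s * dot (Defs.rot n) w) //.
  rewrite /c /chart_normal /dot /= /GRing.scale /= -/a; field.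
  by rewrite gt_eqF.
have near_line : \forall h \near (0 : R)^'+, U (x + h *: w).
  have nU : nbhs (x + (0 : R) *: w) U by rewrite scale0r addr0; exact: open_nbhs_nbhs.
  have : (fun h : R => x + h *: w) h @[h --> (0 : R)] --> x + (0 : R) *: w.
    by apply: cvgD; [exact: cvg_cst|apply: cvgZr_tmp; exact: cvg_id].
  move=> /(_ _ nU) /nbhs_ballP[r /= r0 B]; near=> h.
  have h0 : 0 < h by [].
  have hr : h < r by near: h; exact: nbhs_right_lt.
  by apply: B; rewrite -ball_normE /= sub0r normrN gtr0_norm.
have phi0 : phi 0 = 0 by rewrite /phi !mul0r !addr0 E subrr.
have key (b : R) : 0 < b -> \forall h \near (0 : R)^'+, `|phi h - h * (- a * c)| <= b * h.
  move=> b0; have [/derivable1_diffP dp pE] := dphi.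
  have /nbhs_ballP[r /= r0 B] := differentiable_increment dp b0.
  near=> h; have h0 : 0 < h by [].
  have hr : h < r by near: h; exact: nbhs_right_lt.
  have := B h; rewrite -ball_normE /= sub0r normrN (gtr0_norm h0) => /(_ hr).
  rewrite add0r phi0 subr0 -pE (deriveE _ dp).
  have -> : 'd phi 0 h = h * 'd phi 0 1.
    by rewrite -[LHS]/('d phi 0 (h : R)) -{1}(mulr1 h) -[h * 1]/(h *: (1 : R)) linearZ.
  by [].
split => c0.
- have b0 : 0 < a * - c / 2 by rewrite divr_gt0 // mulr_gt0 // oppr_gt0.
  have K := key _ b0.
  near=> h; have h0 : 0 < h by [].
  have kh : `|phi h - h * (- a * c)| <= a * - c / 2 * h by near: h.
  have Uh : U (x + h *: w).
    near: h; exact: near_line.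
  apply/(H _ Uh); rewrite -subr_gt0 phiE.
  move: kh; rewrite ler_norml => /andP[kh _].
  have : 0 < a * - c / 2 * h by rewrite mulr_gt0.
  by lra.
- have b0 : 0 < a * c / 2 by rewrite divr_gt0 // mulr_gt0.
  have K := key _ b0.
  near=> h; have h0 : 0 < h by [].
  have kh : `|phi h - h * (- a * c)| <= a * c / 2 * h by near: h.
  have Uh : U (x + h *: w).
    near: h; exact: near_line.
  move/(H _ Uh); rewrite -subr_gt0 phiE.
  move: kh; rewrite ler_norml => /andP[_ kh].
  have : 0 < a * c / 2 * h by rewrite mulr_gt0.
  by lra.
Unshelve. all: by end_near. Qed.

(** Both normals separate the same directions; w = nu' - nu would enter Omega
    for the one and leave it for the other. *)
Lemma chart_normal_unique Omega U U' n n' gamma gamma' x : open Omega ->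
  boundary Omega x -> graph_chart Omega U n gamma -> U x ->
  graph_chart Omega U' n' gamma' -> U' x ->
  chart_normal n gamma (dot (Defs.rot n) x) = chart_normal n' gamma' (dot (Defs.rot n') x).
Proof.
move=> oO Bx ch Ux ch' Ux'.
set v := chart_normal n gamma _; set v' := chart_normal n' gamma' _.
have v1 : dot v v = 1 by apply: chart_normal_unit; have [_ ->] := ch.
have v'1 : dot v' v' = 1 by apply: chart_normal_unit; have [_ ->] := ch'.
pose w := v' - v.
have [in_w _] := chart_normal_direction w oO ch Ux Bx.
have [_ out_w] := chart_normal_direction w oO ch' Ux' Bx.
rewrite -/v -/v' in in_w out_w.
have E1 : dot v w = dot v v' - 1 by rewrite -v1 /w /dot /=; ring.
have E2 : dot v' w = 1 - dot v v' by rewrite -v'1 /w /dot /=; ring.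
have E3 : (v.1 - v'.1) ^+ 2 + (v.2 - v'.2) ^+ 2 = 2 - 2 * dot v v'.
  have -> : (v.1 - v'.1) ^+ 2 + (v.2 - v'.2) ^+ 2 = dot v v + dot v' v' - 2 * dot v v'.
    by rewrite /dot; ring.
  by rewrite v1 v'1.
have [lt|ge] := ltP (dot v v') 1.
  have i_w : \forall h \near (0 : R)^'+, Omega (x + h *: w) by apply: in_w; rewrite E1; lra.
  have o_w : \forall h \near (0 : R)^'+, ~ Omega (x + h *: w) by apply: out_w; rewrite E2; lra.
  exfalso; have : \forall h \near (0 : R)^'+, False by near=> h; apply: (near o_w h) => //; near: h.
  by move=> /filter_ex[].
have z1 : (v.1 - v'.1) ^+ 2 = 0.
  by apply/eqP; rewrite eq_le sqr_ge0 andbT; have := sqr_ge0 (v.2 - v'.2); lra.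
have z2 : (v.2 - v'.2) ^+ 2 = 0.
  by apply/eqP; rewrite eq_le sqr_ge0 andbT; have := sqr_ge0 (v.1 - v'.1); lra.
move/eqP: z1; rewrite expf_eq0 /= subr_eq0 => /eqP z1.
move/eqP: z2; rewrite expf_eq0 /= subr_eq0 => /eqP z2.
rewrite [LHS]surjective_pairing [RHS]surjective_pairing.
by congr (_, _); [exact: z1|exact: z2].
Unshelve. all: by end_near. Qed.

End chart.

(** * Green's formula *)

Section green.
Context {R : realType}.
Variables (Omega : set (R * R)) (nu : R * R -> R * R)
  (sigma : {sigma_finite_measure set (mplane R) -> \bar R}).
Hypotheses (oO : open Omega)
  (nuP : forall x, boundary Omega x -> outward_normal Omega x (nu x))
  (sigmaP : surface_measure Omega sigma).

(** The field is (F, G) and d stands for its divergence, which is kept as a separate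
    function so that it can be rewritten on Omega alone. *)
Definition green_formula (F G d : R * R -> R) : Prop :=
  [/\ (leb2 : {measure set (mplane R) -> \bar R}).-integrable Omega (EFin \o d),
      sigma.-integrable (boundary Omega) (fun x => (F x * (nu x).1 + G x * (nu x).2)%:E) &
      (\int[leb2]_(x in Omega) (d x)%:E =
       \int[sigma]_(x in boundary Omega) (F x * (nu x).1 + G x * (nu x).2)%:E)%E].

Lemma closed_boundary : closed (boundary Omega).
Proof.
rewrite /boundary setDE; apply: closedI; first exact: closed_closure.
by apply: open_closedC; exact: open_interior.
Qed.

Lemma measurable_boundary : measurable (boundary Omega : set (mplane R)).
Proof. by apply: closed_measurable2; exact: closed_boundary. Qed.

Lemma pair_e12 (a b : R) : (a, b) = a *: e1 + b *: e2.
Proof.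
by congr (_, _) => /=; rewrite /GRing.scale /= mulr1 mulr0 ?addr0 ?add0r.
Qed.

Lemma diff_e12 (V : normedModType R) (f : R * R -> V) x (a b : R) :
  'd f x (a *: e1 + b *: e2) = a *: 'd f x e1 + b *: 'd f x e2.
Proof. by rewrite linearD !linearZ. Qed.

Section in_chart.
Variables (U : set (R * R)) (n : R * R) (gamma : R -> R) (c : R * R) (r : R).
Hypotheses (ch : graph_chart Omega U n gamma) (BU : box c r `<=` U).
Local Notation B := (box c r).
Local Notation gc := (graph_coords n gamma).

Let n1 : enorm n = 1. Proof. by have [] := ch. Qed.

Lemma closure_zero_off_box (a : R * R -> R) : {within closure Omega, continuous a} ->
  (forall x, Omega x -> ~ B x -> a x = 0) ->
  forall x, closure Omega x -> ~ B x -> a x = 0.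
Proof.
move=> /subspace_continuousP ca a0 x clx nBx; apply: contrapT => /eqP ax.
have e0 : 0 < `|a x| by rewrite normr_gt0.
have H : nbhs x (fun t => closure Omega t -> `|a x - a t| < `|a x|).
  by have /cvgrPdist_lt/(_ _ e0) := ca x clx.
have nB : nbhs x (~` B).
  by apply: open_nbhs_nbhs; split => //; apply: closed_openC; exact: closed_box.
have [y [Oy [+ nBy]]] := clx _ (filterI H nB).
move=> /(_ (subset_closure Oy)).
by rewrite (a0 y Oy nBy) subr0 ltxx.
Qed.

Lemma within_continuous_box (a : R * R -> R) : {within closure Omega, continuous a} ->
  (forall x, Omega x -> ~ B x -> a x = 0) ->
  {within closure Omega, continuous (fun x => a x * \1_B x)}.
Proof.
move=> ca a0; apply: within_continuous_eq (ca) => x /[!inE] clx; rewrite indicE.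
have [Bx|nBx] := pselect (B x); first by rewrite mem_set ?mulr1.
by rewrite memNset ?mulr0 //; exact: closure_zero_off_box a0 _ clx nBx.
Qed.

(** Where the chart ends the field already vanishes, since its support B lies in U;
    this makes the pullback continuous on the whole half-plane. *)
Lemma pullback_continuous (a : R * R -> R) : {within closure Omega, continuous a} ->
  (forall x, ~ B x -> a x = 0) ->
  {within closure half_plane, continuous (fun p => a (gc p))}.
Proof.
move=> /subspace_continuousP ca a0; apply/subspace_continuousP => p Hp P Pp.
change (nbhs p (fun q => closure half_plane q -> P (a (gc q)))).
have cg := continuous_graph_coords ch (x := p).
have [oU _ _ _] := ch.
have [Up|nUp] := pselect (U (gc p)).
  have nU : nbhs p (gc @^-1` U) by apply: cg; exact: open_nbhs_nbhs.
  have H : nbhs (gc p) (fun y => closure Omega y -> P (a y)) := ca _ (chart_closure ch Up Hp) _ Pp.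
  have : nbhs p (fun q => closure Omega (gc q) -> P (a (gc q))) := cg _ H.
  apply: filterS2 nU => q Uq h Hq; apply: h.
  exact: chart_closure ch Uq Hq.
have nBp : ~ B (gc p) by move/BU.
have nB : nbhs (gc p) (~` B).
  by apply: open_nbhs_nbhs; split => //; apply: closed_openC; exact: closed_box.
have : nbhs p (gc @^-1` (~` B)) := cg _ nB.
apply: filterS => q nBq _; rewrite a0 //.
by have := nbhs_singleton Pp; rewrite /from_subspace /= a0.
Qed.

Lemma differentiable_chart_point (f a1 a2 : R * R -> R) p :
  C1_closure Omega f a1 a2 -> (forall x, ~ B x -> f x = 0) -> half_plane p ->
  [/\ differentiable f (gc p), 'D_e1 f (gc p) = a1 (gc p) * \1_B (gc p) &
      'D_e2 f (gc p) = a2 (gc p) * \1_B (gc p)].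
Proof.
move=> Cf f0 Hp; have [_ _ _ df] := Cf.
have f120 := C1_closure_support (@closed_box _ c r) Cf f0.
have [Op|nOp] := pselect (Omega (gc p)).
  have [dfp E1 E2] := df _ Op; split=> //; rewrite ?E1 ?E2 indicE.
    have [Bx|nBx] := pselect (B (gc p)); first by rewrite mem_set ?mulr1.
    by rewrite memNset ?mulr0 //; have [] := f120 _ Op nBx.
  have [Bx|nBx] := pselect (B (gc p)); first by rewrite mem_set ?mulr1.
  by rewrite memNset ?mulr0 //; have [] := f120 _ Op nBx.
have nBp : ~ B (gc p) by move=> /BU /(chart_half_plane ch)[_ /(_ Hp)].
have nf0 : \forall y \near gc p, f y = cst 0 y.
  have : nbhs (gc p) (~` B).
    by apply: open_nbhs_nbhs; split => //; apply: closed_openC; exact: closed_box.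
  by apply: filterS => y; exact: f0.
rewrite !(near_eq_derive _ nf0) !derive_cst indicE memNset // !mulr0; split => //.
apply: littleo_differentiable => eps eps0.
have /nbhs_ballP[e /= e0 be] := nf0.
apply/nbhs_ballP; exists e => //= h; rewrite -ball_normE /= sub0r normrN => he.
rewrite be ?(f0 _ nBp) /cst ?subrr ?normr0 ?mulr_ge0 // ?ltW //.
by rewrite -ball_normE /= opprD addrCA subrr addr0 normrN.
Qed.

(** The chain rule in the coordinates of the chart, which straighten the
    boundary. *)
Lemma pullback_C1 (f a1 a2 : R * R -> R) :
  C1_closure Omega f a1 a2 -> (forall x, ~ B x -> f x = 0) ->
  C1_closure half_plane (fun p => f (gc p))
    (fun p => a1 (gc p) * \1_B (gc p) * (n.2 + derive1 gamma p.1 * n.1) +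
              a2 (gc p) * \1_B (gc p) * (- n.1 + derive1 gamma p.1 * n.2))
    (fun p => a1 (gc p) * \1_B (gc p) * n.1 + a2 (gc p) * \1_B (gc p) * n.2).
Proof.
move=> Cf f0; have [cf ca1 ca2 _] := Cf.
have f120 := C1_closure_support (@closed_box _ c r) Cf f0.
have off (a : R * R -> R) x : ~ B x -> a x * \1_B x = 0.
  by move=> nB; rewrite indicE memNset // mulr0.
have cA1 : {within closure half_plane, continuous (fun p => a1 (gc p) * \1_B (gc p))}.
  apply: (pullback_continuous (a := fun x => a1 x * \1_B x)); last exact: off.
  by apply: within_continuous_box => // x Ox nB; have [] := f120 x Ox nB.
have cA2 : {within closure half_plane, continuous (fun p => a2 (gc p) * \1_B (gc p))}.
  apply: (pullback_continuous (a := fun x => a2 x * \1_B x)); last exact: off.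
  by apply: within_continuous_box => // x Ox nB; have [] := f120 x Ox nB.
have [[_ g11 g12 dg1] [_ g21 g22 dg2]] := C1_graph_coords half_plane ch.
split.
- exact: pullback_continuous.
- by apply: within_continuousD; apply: within_continuousM.
- by apply: within_continuousD; apply: within_continuousM.
- move=> p Hp.
  have [df E1 E2] := differentiable_chart_point Cf f0 Hp.
  have [d1 d11 d12] := dg1 p Hp; have [d2 d21 d22] := dg2 p Hp.
  have gcE : gc = fun q => ((gc q).1, (gc q).2) by apply/funext => q; rewrite -surjective_pairing.
  have dgc : differentiable gc p by rewrite gcE; exact: differentiable_pair d1 d2.
  have dfg : differentiable (f \o gc) p by exact: differentiable_comp.
  have D (e : R * R) : 'D_e (f \o gc) p =
      'D_e (fun q => (gc q).1) p * 'D_e1 f (gc p) + 'D_e (fun q => (gc q).2) p * 'D_e2 f (gc p).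
    rewrite (deriveE _ dfg) diff_comp //= (deriveE _ d1) (deriveE _ d2) !(deriveE _ df).
    have -> : 'd gc p e = ('d (fun q => (gc q).1) p e) *: e1 + ('d (fun q => (gc q).2) p e) *: e2.
      by rewrite {1}gcE diff_pair //; exact: pair_e12.
    exact: diff_e12.
  split; first exact: dfg.
    by rewrite [LHS](D e1) d11 d21 E1 E2; ring.
  by rewrite [LHS](D e2) d12 d22 E1 E2; ring.
Qed.

Lemma pullback_bounded : exists2 M : R, 0 < M & forall p, B (gc p) -> box 0 M p.
Proof.
pose inv x : R * R := (dot (Defs.rot n) x, dot n x - gamma (dot (Defs.rot n) x)).
have cinv : continuous inv.
  move=> x; apply: continuous_pair; first exact: continuous_dot.
  apply: cvgB; first exact: continuous_dot.
  apply: (@cvg_comp _ _ _ (dot (Defs.rot n)) gamma); first exact: continuous_dot.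
  exact: chart_continuous ch _.
have [M [_ BM]] := compact_bounded (continuous_compact (continuous_subspaceT cinv) (@compact_box _ c r)).
exists (`|M| + 1); first by rewrite ltr_wpDl.
move=> p Bp; rewrite /box /= subr0.
apply: (BM (`|M| + 1)); first by rewrite ltr_pwDr // ler_norm.
exists (gc p) => //; rewrite /inv dot_rot_graph_coords // dot_graph_coords //.
by rewrite [gamma _ + _]addrC addrK -surjective_pairing.
Qed.

Variables (F a1 a2 G b1 b2 : R * R -> R).
Hypotheses (CF : C1_closure Omega F a1 a2) (CG : C1_closure Omega G b1 b2)
  (F0 : forall x, ~ B x -> F x = 0) (G0 : forall x, ~ B x -> G x = 0).

(** Tg and Nm are the components of the field along rot n and n.  In the coordinates
    of the chart the field becomes (Tg, W), with W the component transversal to the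
    lines parallel to the graph: its divergence in these coordinates is the original
    one, and - W is the normal component times the arc element. *)
Let Tg p : R := n.2 * F (gc p) - n.1 * G (gc p).
Let Nm p : R := n.1 * F (gc p) + n.2 * G (gc p).
Let W p : R := Nm p - derive1 gamma p.1 * Tg p.

Let W_T : exists W1 W2 T1 T2 : R * R -> R,
  [/\ C1_closure half_plane W W1 W2, C1_closure half_plane Tg T1 T2 &
   forall p, W2 p + T1 p = (a1 (gc p) + b2 (gc p)) * \1_B (gc p)].
Proof.
have PF := pullback_C1 CF F0; have PG := pullback_C1 CG G0.
have CT := C1_closureB (C1_closureZ n.2 PF) (C1_closureZ n.1 PG).
have CN := C1_closureD (C1_closureZ n.1 PF) (C1_closureZ n.2 PG).
have Cg := C1_closure_comp1 half_plane (chart_derivative2 ch) (chart_continuous2 ch).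
have CW := C1_closureB CN (C1_closureM Cg CT).
do 4 eexists; split; [exact: CW|exact: CT|].
move=> p /=; have nn := unit_sqr n1.
rewrite -[RHS]mulr1 -nn; ring.
Qed.

Let zero_off p : ~ B (gc p) -> W p = 0 /\ Tg p = 0.
Proof. by move=> nB; rewrite /W /Nm /Tg F0 // G0 // !mulr0 subr0 addr0 mulr0 subr0. Qed.

Let d x : R := a1 x + b2 x.

Let d0 x : Omega x -> ~ B x -> d x = 0.
Proof.
move=> Ox nB; have [a10 _] := C1_closure_support (@closed_box _ c r) CF F0 Ox nB.
have [_ b20] := C1_closure_support (@closed_box _ c r) CG G0 Ox nB.
by rewrite /d a10 b20 addr0.
Qed.

Lemma integrable_chart_divergence :
  (leb2 : {measure set (mplane R) -> \bar R}).-integrable Omega (EFin \o d).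
Proof.
have [_ ca1 _ _] := CF; have [_ _ cb2 _] := CG.
exact: (integrable_closure oO (within_continuousD ca1 cb2) (c := c) (r := r)).
Qed.

Lemma chart_divergence_integral :
  (\int[leb2]_(x in Omega) (d x)%:E = \int[leb1]_s (- W (s, 0))%:E)%E.
Proof.
have mO : measurable (Omega : set (mplane R)) by exact: open_measurable2.
have [M M0 BM] := pullback_bounded.
have [W1 [W2 [T1 [T2 [CW CT WT]]]]] := W_T.
have offM p : ~ box 0 M p -> W p = 0 /\ Tg p = 0.
  by move=> np; apply: zero_off => /BM.
have := integrable_chart_divergence => /(integrable_mkcond _ mO) id.
rewrite integral_mkcond.
have mgm : measurable_fun setT (gamma : measurableTypeR R -> measurableTypeR R).
  exact: continuous_measurable_fun (chart_continuous ch).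
rewrite -(integral_graph_coords n1 mgm (measurable_int _ id)).
transitivity (\int[leb2]_(p in half_plane) (W2 p + T1 p)%:E)%E.
  rewrite [RHS]integral_mkcond; apply: eq_integral => p _; rewrite !patchE.
  have [Hp|nHp] := pselect (half_plane p).
    rewrite (mem_set Hp) WT /=.
    have [Op|nOp] := pselect (Omega (gc p)).
      rewrite mem_set // /d /=; congr EFin; rewrite indicE.
      have [Bx|nBx] := pselect (B (gc p)); first by rewrite mem_set ?mulr1.
      by rewrite memNset ?mulr0 //; exact: d0.
    rewrite memNset // indicE memNset ?mulr0 //.
    by move=> /BU /(chart_half_plane ch)[_ /(_ Hp)].
  rewrite (memNset nHp).
  have [Op|nOp] := pselect (Omega (gc p)); last by rewrite memNset.
  rewrite mem_set //= d0 //.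
  by move=> /BU /(chart_half_plane ch)[/(_ Op)].
have [_ _ cW2 _] := CW; have [_ cT1 _ _] := CT.
have iW2 : (leb2 : {measure set (mplane R) -> \bar R}).-integrable half_plane (EFin \o W2).
  apply: (integrable_closure open_half_plane cW2 (c := 0) (r := M)) => x Hx nx.
  by have [] := C1_closure_support (@closed_box _ 0 M) CW (fun x nx => (offM x nx).1) Hx nx.
have iT1 : (leb2 : {measure set (mplane R) -> \bar R}).-integrable half_plane (EFin \o T1).
  apply: (integrable_closure open_half_plane cT1 (c := 0) (r := M)) => x Hx nx.
  by have [] := C1_closure_support (@closed_box _ 0 M) CT (fun x nx => (offM x nx).2) Hx nx.
have mH : measurable (half_plane : set (mplane R)).
  by apply: open_measurable2; exact: open_half_plane.
under eq_integral do rewrite EFinD.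
rewrite integralD //.
rewrite (half_plane_integral2 M0 CW (fun x nx => (offM x nx).1)).
by rewrite (half_plane_integral1 M0 CT (fun x nx => (offM x nx).2)) adde0.
Qed.

Local Notation kappa := (fun x => F x * (nu x).1 + G x * (nu x).2).
Local Notation BB := (B `&` boundary Omega).

Let nuE x : B x -> boundary Omega x -> nu x = chart_normal n gamma (dot (Defs.rot n) x).
Proof.
move=> Bx bx; have [U' [n' [gamma' [ch' Ux' ->]]]] := nuP bx.
exact: (chart_normal_unique oO bx ch' Ux' ch (BU Bx)).
Qed.

Let mBB : measurable (BB : set (mplane R)).
Proof. by apply: measurableI; [exact: measurable_box|exact: measurable_boundary]. Qed.

Let continuous_arc : continuous (arc_element gamma).
Proof.
move=> s; apply: (@cvg_comp _ _ _ (fun s => 1 + derive1 gamma s ^+ 2) Num.sqrt); last exact: sqrt_continuous.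
apply: cvgD; first exact: cvg_cst.
by rewrite expr2; apply: cvgM; exact: (chart_continuous1 ch).
Qed.

Let measurable_kappa : measurable_fun (BB : set (mplane R)) kappa.
Proof.
have [cF _ _ _] := CF; have [cG _ _ _] := CG.
have sub : BB `<=` closure Omega by move=> x [_ []].
apply: within_continuous_measurable2 => //.
pose nu' x := chart_normal n gamma (dot (Defs.rot n) x).
apply: (@within_continuous_eq _ _ _ (fun x => F x * (nu' x).1 + G x * (nu' x).2)).
  by move=> x /[!inE] -[Bx bx]; rewrite nuE.
have cd : continuous (dot (Defs.rot n)) by exact: continuous_dot.
have cnu (k : R) (l : R) : {within BB, continuous (fun x : R * R =>
    (arc_element gamma (dot (Defs.rot n) x))^-1 * (derive1 gamma (dot (Defs.rot n) x) * k - l))}.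
  apply: continuous_subspaceT => x; apply: cvgM.
    apply: cvgV; first by rewrite gt_eqF // arc_element_gt0.
    by apply: (@cvg_comp _ _ _ (dot (Defs.rot n)) (arc_element gamma)); [exact: cd|exact: continuous_arc].
  apply: cvgB; last exact: cvg_cst.
  apply: cvgM; last exact: cvg_cst.
  by apply: (@cvg_comp _ _ _ (dot (Defs.rot n)) (derive1 gamma)); [exact: cd|exact: (chart_continuous1 ch)].
apply: within_continuousD; apply: within_continuousM.
- exact: continuous_subspaceW sub cF.
- exact: cnu.
- exact: continuous_subspaceW sub cG.
- exact: cnu.
Qed.

Let kappa_graph s : BB (graph_point n gamma s) ->
  kappa (graph_point n gamma s) * arc_element gamma s = - W (s, 0).
Proof.
move=> [Bs bs]; rewrite nuE // graph_point_coords dot_rot_graph_coords //=.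
rewrite /W /Nm /Tg /chart_normal /= /GRing.scale /=; field.
by rewrite gt_eqF // arc_element_gt0.
Qed.

Lemma chart_boundary_integral :
  sigma.-integrable (boundary Omega) (EFin \o kappa) /\
  (\int[sigma]_(x in boundary Omega) (kappa x)%:E = \int[leb1]_s (- W (s, 0))%:E)%E.
Proof.
have [M M0 BM] := pullback_bounded.
have [W1 [W2 [T1 [T2 [CW CT WT]]]]] := W_T.
have [cW _ _ _] := CW.
have cW0 : continuous (fun s => - W (s, 0)).
  have sH (s : R) : setT s -> closure half_plane (s, 0 : R) by rewrite closure_half_plane /=.
  have := @restriction_continuous_comp R _ R setT (closure half_plane) (fun s : R => (s, 0 : R)) W
    (continuous_subspaceT (@continuous_pairl _ R (0 : R))) cW sH.
  rewrite (continuous_open_subspace _ openT) => H s.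
  by apply: cvgN; exact: H s (mem_set I).
have W00 s : ~ B (gc (s, 0)) -> - W (s, 0) = 0.
  by move=> /zero_off[-> _]; rewrite oppr0.
have lM : (@lebesgue_measure R `[(- M)%R, M]%classic < +oo)%E.
  by rewrite lebesgue_measure_itv /=; case: ifP => _; rewrite ?ltry // -EFinB ltry.
have iW : (@lebesgue_measure R).-integrable setT (fun s => (- W (s, 0))%:E).
  have [K K0 KW] := within_continuous_bounded (continuous_subspaceT cW0) (@segment_compact R (- M) M).
  apply: (@integrable_bounded_support _ (measurableTypeR R) R (@lebesgue_measure R) setT `[- M, M]%classic _ K) => //.
  - exact: continuous_measurable_fun cW0.
  - by move=> s _ sM; exact: KW.
  - move=> s _ sM; apply: W00 => /BM; rewrite boxP /= subr0 => -[sM' _].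
    by apply: sM; rewrite /= in_itv /= -ler_norml.
have mgp : measurable_fun setT (graph_point n gamma : measurableTypeR R -> mplane R).
  rewrite (_ : graph_point n gamma = fun s => gc (s, 0)); last first.
    by apply/funext => s; rewrite graph_point_coords.
  apply: (@measurableT_comp _ _ _ _ _ _ gc); last exact: measurable_pairr.
  apply: measurable_graph_coords.
  exact: continuous_measurable_fun (chart_continuous ch).
have mgB : measurable (graph_point n gamma @^-1` BB : set (measurableTypeR R)).
  by rewrite -[X in measurable X]setTI; exact: mgp.
have marc : measurable_fun setT (arc_element gamma : measurableTypeR R -> R).
  exact: continuous_measurable_fun continuous_arc.
have sE A : measurable (A : set (mplane R)) -> A `<=` BB ->
   (sigma A = \int[@lebesgue_measure R]_(s in graph_point n gamma @^-1` A) (arc_element gamma s)%:E)%E.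
  by move=> mA AB; apply: (sigmaP.2 _ _ _ ch) => // x /AB[/BU].
have ik : (@lebesgue_measure R).-integrable (graph_point n gamma @^-1` BB)
    (fun s => (kappa (graph_point n gamma s) * arc_element gamma s)%:E).
  apply: (eq_integrable mgB (fun s => (- W (s, 0))%:E)).
    by move=> s /[!inE] Bs; rewrite kappa_graph.
  by apply: integrableS iW.
have [ikB EB] := integral_image_density mgp marc (fun s => ltW (arc_element_gt0 gamma s)) mBB sE measurable_kappa ik.
have patch0 : (EFin \o kappa) \_ (boundary Omega) = (EFin \o kappa) \_ BB.
  apply/funext => x; rewrite !patchE.
  have [bx|nbx] := pselect (boundary Omega x); last first.
    by rewrite !memNset // => -[].
  rewrite mem_set //; have [Bx|nBx] := pselect (B x); first by rewrite mem_set.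
  by rewrite memNset; [rewrite /= F0 // G0 // !mul0r addr0|move=> []].
split.
  by apply/(integrable_mkcond _ measurable_boundary); rewrite patch0; apply/(integrable_mkcond _ mBB).
rewrite integral_mkcond patch0 -integral_mkcond EB.
rewrite [RHS](_ : _ = (\int[@lebesgue_measure R]_(s in graph_point n gamma @^-1` BB) (- W (s, 0))%:E)%E).
  by apply: eq_integral => s /[!inE] Bs; rewrite kappa_graph.
rewrite [RHS]integral_mkcond; apply: eq_integral => s _; rewrite patchE.
case: ifPn => //; rewrite notin_setE => nBB; rewrite W00 // => Bs.
apply: nBB; rewrite /= graph_point_coords; split=> //.
apply/(chart_boundary oO ch (BU Bs)).
by rewrite dot_rot_graph_coords // dot_graph_coords //= addr0.
Qed.

(** Both sides equal the integral of - W over the line that straightens the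
    boundary. *)
Lemma green_chart : green_formula F G d.
Proof.
have [ik Ek] := chart_boundary_integral.
by split => //; [exact: integrable_chart_divergence|rewrite chart_divergence_integral Ek].
Qed.

End in_chart.

Lemma green_formula_eq F G d F' G' d' :
  (forall x, boundary Omega x -> F x = F' x) -> (forall x, boundary Omega x -> G x = G' x) ->
  (forall x, Omega x -> d x = d' x) ->
  green_formula F G d -> green_formula F' G' d'.
Proof.
have mO : measurable (Omega : set (mplane R)) by exact: open_measurable2.
move=> FF GG dd [id iF E]; split.
- apply: (eq_integrable mO (EFin \o d)) => // x /[!inE] Ox.
  by rewrite /= dd.
- apply: (eq_integrable measurable_boundary (fun x => (F x * (nu x).1 + G x * (nu x).2)%:E)) => // x /[!inE] bx.
  by rewrite /= FF ?GG.
- rewrite (_ : (\int[leb2]_(x in Omega) (d' x)%:E = \int[leb2]_(x in Omega) (d x)%:E)%E).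
    by rewrite E; apply: eq_integral => x /[!inE] bx; rewrite FF ?GG.
  by apply: eq_integral => x /[!inE] Ox; rewrite dd.
Qed.

Lemma green_formulaD F G d F' G' d' : green_formula F G d -> green_formula F' G' d' ->
  green_formula (fun x => F x + F' x) (fun x => G x + G' x) (fun x => d x + d' x).
Proof.
have mO : measurable (Omega : set (mplane R)) by exact: open_measurable2.
move=> [id iF E] [id' iF' E'].
have kE : (fun x => ((F x + F' x) * (nu x).1 + (G x + G' x) * (nu x).2)%:E) =
   (fun x => (F x * (nu x).1 + G x * (nu x).2)%:E) \+ (fun x => (F' x * (nu x).1 + G' x * (nu x).2)%:E).
  by apply/funext => x; rewrite /= -EFinD; congr EFin; ring.
split.
- rewrite (_ : EFin \o _ = (EFin \o d) \+ (EFin \o d')); first exact: integrableD.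
  by apply/funext => x; rewrite /= EFinD.
- by rewrite kE; apply: integrableD => //; exact: measurable_boundary.
- rewrite [X in integral _ _ X](_ : _ = (EFin \o d) \+ (EFin \o d')); last first.
    by apply/funext => x; rewrite /= EFinD.
  rewrite [RHS](_ : _ = (\int[sigma]_(x in boundary Omega) ((fun x => (F x * (nu x).1 + G x * (nu x).2)%:E) \+ (fun x => (F' x * (nu x).1 + G' x * (nu x).2)%:E)) x)%E).
    rewrite integralD // integralD //; last exact: measurable_boundary.
    by rewrite E E'.
  by apply: eq_integral => x _; rewrite -EFinD; congr EFin; ring.
Qed.

Lemma green_formula0 : green_formula (fun=> 0) (fun=> 0) (fun=> 0).
Proof.
have mO : measurable (Omega : set (mplane R)) by exact: open_measurable2.
split.
- exact: integrable0.
- apply: (eq_integrable measurable_boundary (cst 0%E)); last exact: integrable0.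
  by move=> x _; rewrite !mul0r addr0.
- rewrite integral0_eq // integral0_eq // => x _.
  by rewrite !mul0r addr0.
Qed.

Hypothesis smoothO : smooth_boundary Omega.

(** Points off the boundary have charts too: small pieces of the domain, or of its
    exterior, that lie above, or below, a horizontal line.  Thus the pieces of a
    covering can all be treated alike. *)
Lemma chart_at x : exists U n gamma, graph_chart Omega U n gamma /\ U x.
Proof.
have e2n : enorm (e2 : R * R) = 1 by rewrite /enorm /dot /= mul0r add0r mulr1 sqrtr1.
have dcst (a : R) k s : derivable (derive1n k (cst a : R -> R)) s 1.
  suff [b ->] : exists b, derive1n k (cst a : R -> R) = cst b by exact: derivable_cst.
  elim: k => [|k [b IH]]; first by exists a.
  by exists 0; rewrite derive1nS IH; apply/funext => y; rewrite derive1_cst.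
have dote2 (y : R * R) : dot e2 y = y.2 by rewrite /dot /= mul0r add0r mul1r.
have [bx|nbx] := pselect (boundary Omega x); first exact: smoothO.
pose N (a : R) := [set y : R * R | a < y.2].
have oN a : open (N a).
  by apply: (@open_comp _ _ snd [set t | a < t]); [move=> y _; exact: cvg_snd|exact: open_gt].
have oN' (a : R) : open [set y : R * R | y.2 < a].
  by apply: (@open_comp _ _ snd [set t | t < a]); [move=> y _; exact: cvg_snd|exact: open_lt].
have [Ox|nOx] := pselect (Omega x).
  exists (Omega `&` N (x.2 - 1)), e2, (cst (x.2 - 1)); split.
    split => //; first exact: openI.
    by move=> y [Oy Ny]; rewrite dote2.
  by split => //; rewrite /N /=; lra.
have nclx : ~ closure Omega x.
  by move=> clx; apply: nbx; split => //; rewrite (interior_id _).1.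
exists (~` closure Omega `&` [set y | y.2 < x.2 + 1]), e2, (cst (x.2 + 1)); split.
  split => //.
    by apply: openI => //; apply: closed_openC; exact: closed_closure.
  move=> y [nc /= yx]; rewrite dote2 /cst; split => [/subset_closure//|].
  by rewrite ltNge ltW.
by split => //=; lra.
Qed.

(** Peel off a field supported in one chart at a time: the factors 1 - cutoff
    accumulated on the way vanish on the support of the field.  Thus no partition
    of unity has to be normalised. *)
Lemma green_formula_cover (l : seq ((R * R) * R)) :
  (forall q, q \in l -> 0 < q.2 /\ exists U n gamma, graph_chart Omega U n gamma /\ box q.1 (2 * q.2) `<=` U) ->
  forall F a1 a2 G b1 b2, C1_closure Omega F a1 a2 -> C1_closure Omega G b1 b2 ->
  (forall x, (forall q, q \in l -> ~ box q.1 q.2 x) -> F x = 0 /\ G x = 0) ->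
  green_formula F G (fun x => a1 x + b2 x).
Proof.
elim: l => [|[c r] l IH] Hl F a1 a2 G b1 b2 CF CG FG0.
  have F0 x : F x = 0 by have [] := FG0 x.
  have G0 x : G x = 0 by have [] := FG0 x.
  apply: (green_formula_eq _ _ _ green_formula0) => x Ox; rewrite ?F0 ?G0 //.
  have [] := C1_closure_support (@closed0 (R * R)%type) CF (fun x _ => F0 x) Ox id => -> _.
  by have [] := C1_closure_support (@closed0 (R * R)%type) CG (fun x _ => G0 x) Ox id => _ ->; rewrite addr0.
have [r0 [U [n [gamma [ch BU]]]]] : 0 < r /\ exists U n gamma, graph_chart Omega U n gamma /\ box c (2 * r) `<=` U.
  by apply: (Hl (c, r)); rewrite in_cons eqxx.
have Cc := C1_closure_cutoff Omega c r.
have Cc' := C1_closureB (C1_closure_cst Omega 1) Cc.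
have off f x : ~ box c (2 * r) x -> f x * cutoff c r x = 0 :> R.
  by move=> nb; rewrite cutoff_eq0 ?mulr0.
have g1 := green_chart ch BU (C1_closureM CF Cc) (C1_closureM CG Cc) (off F) (off G).
have g2 : green_formula _ _ _ := IH _ _ _ _ _ _ _ (C1_closureM CF Cc') (C1_closureM CG Cc') _.
apply: (green_formula_eq _ _ _ (green_formulaD g1 (g2 _ _))).
- by move=> x _; ring.
- by move=> x _; ring.
- by move=> x _; ring.
- by move=> q ql; apply: Hl; rewrite in_cons ql orbT.
- move=> x nx; have [bx|nbx] := pselect (box c r x).
    by rewrite cutoff_eq1 // subrr !mulr0.
  have [|-> ->] := FG0 x; last by rewrite !mul0r.
  by move=> q; rewrite in_cons => /orP[/eqP ->|/nx].
Qed.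

Theorem green_formula_compact F a1 a2 G b1 b2 c (r : R) :
  C1_closure Omega F a1 a2 -> C1_closure Omega G b1 b2 ->
  (forall x, ~ box c r x -> F x = 0 /\ G x = 0) ->
  green_formula F G (fun x => a1 x + b2 x).
Proof.
move=> CF CG FG0.
pose good (q : (R * R) * R) := 0 < q.2 /\
  exists U n gamma, graph_chart Omega U n gamma /\ box q.1 (2 * q.2) `<=` U.
have cK : cover_compact (box c r).
  pose T : ptopologicalType := HB.pack (R * R)%type
    (Pointed.class (R * R : pointedType)%type) (Topological.class (R * R : topologicalType)%type).
  have E := @compact_cover T.
  by rewrite -[cover_compact _]/(@cover_compact T _) -E; exact: compact_box.
have [] := cK ((R * R) * R)%type good (fun q => ball q.1 q.2).
- by move=> q _; exact: ball_open.
- move=> x _; have [U [n [gamma [ch Ux]]]] := chart_at x.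
  have [oU _ _ _] := ch.
  have /nbhs_ballP[e /= e0 eU] : nbhs x U by exact: open_nbhs_nbhs.
  exists (x, e / 3); last by apply: ballxx; rewrite /=; lra.
  split; first by rewrite /=; lra.
  exists U, n, gamma; split => // y; rewrite /box /= => xy; apply: eU.
  by rewrite -ball_normE /= distrC; apply: le_lt_trans xy _; lra.
move=> D Dgood Dcov.
apply: (@green_formula_cover (finmap.enum_fset D)) CF CG _.
  by move=> q qD; have := Dgood q qD; rewrite inE.
move=> x nx; apply: FG0 => bx.
have [q /= qD xq] := Dcov x bx.
by apply: (nx q qD); move: xq; rewrite -ball_normE /box /= distrC => /ltW.
Qed.

End green.

(** * Smooth functions up to the boundary and the vorticity equation *)

Section smooth_ext.
Context {R : realType} {V : normedModType R}.
Implicit Types (D E : set V) (e : V) (s : seq V).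

Lemma derivable_component (f : V -> R * R) z e : derivable f z e ->
  [/\ derivable (fun z => (f z).1) z e, derivable (fun z => (f z).2) z e &
      'D_e f z = ('D_e (fun z => (f z).1) z, 'D_e (fun z => (f z).2) z)].
Proof.
rewrite /derivable => df.
have c1 : (fun h : R => h^-1 *: ((f (h *: e + z)).1 - (f z).1)) @ 0^' --> ('D_e f z).1.
  by apply: (@cvg_comp _ _ _ (fun h : R => h^-1 *: (f (h *: e + z) - f z)) fst); [exact: df|exact: cvg_fst].
have c2 : (fun h : R => h^-1 *: ((f (h *: e + z)).2 - (f z).2)) @ 0^' --> ('D_e f z).2.
  by apply: (@cvg_comp _ _ _ (fun h : R => h^-1 *: (f (h *: e + z) - f z)) snd); [exact: df|exact: cvg_snd].
split; [exact: cvgP c1|exact: cvgP c2|].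
by rewrite [LHS]surjective_pairing -(cvg_lim _ c1) // -(cvg_lim _ c2).
Qed.

Lemma differentiable_near_eq (f g : V -> R) z : (\forall y \near z, f y = g y) ->
  differentiable f z -> differentiable g z.
Proof.
move=> fg df; rewrite (_ : g = f + (g - f)); last by apply/funext => y; rewrite !fctE addrC subrK.
apply: differentiableD => //; apply: littleo_differentiable => eps eps0.
have /nbhs_ballP[e /= e0 be] := fg.
apply/nbhs_ballP; exists e => //= h; rewrite -ball_normE /= sub0r normrN => he.
rewrite !fctE /= be; last by rewrite -ball_normE /= opprD addrCA subrr addr0 normrN.
have -> : f z = g z by apply: be; exact: ballxx.
by rewrite !subrr normr0 mulr_ge0 // ltW.
Qed.

(** The scalar form of smooth_up_to.  As s ranges over all the iterated
    derivatives, the class is stable under differentiation. *)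
Definition smooth_ext D E (f : V -> R) : Prop := forall s,
  (forall z e, D z -> derivable (iter_derive s f) z e) /\
  exists2 g : V -> R, {within E, continuous g} & forall z, D z -> g z = iter_derive s f z.

Variables (D E : set V).
Hypothesis oD : open D.

Lemma near_open (P : V -> Prop) z : D z -> (forall y, D y -> P y) -> \forall y \near z, P y.
Proof. by move=> Dz DP; apply: filterS DP _; exact: open_nbhs_nbhs. Qed.

Lemma derive_eq_on (W : normedModType R) (f g : V -> W) e z : (forall y, D y -> f y = g y) -> D z ->
  'D_e f z = 'D_e g z.
Proof. by move=> fg Dz; apply: near_eq_derive; exact: near_open. Qed.

Lemma derivable_eq_on (W : normedModType R) (f g : V -> W) e z : (forall y, D y -> f y = g y) -> D z ->
  derivable f z e -> derivable g z e.
Proof. by move=> fg Dz; apply: near_eq_derivable; exact: near_open. Qed.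

Lemma iter_derive_eq_on (W : normedModType R) (f g : V -> W) : (forall y, D y -> f y = g y) ->
  forall s z, D z -> iter_derive s f z = iter_derive s g z.
Proof. move=> fg; elim=> [|e s IH] z Dz /=; first exact: fg.
exact: derive_eq_on IH Dz. Qed.

Lemma smooth_ext_derive f e : smooth_ext D E f -> smooth_ext D E ('D_e f).
Proof. by move=> sf s; have := sf (rcons s e); rewrite /iter_derive foldr_rcons. Qed.

Lemma smooth_ext_derivable f z e : smooth_ext D E f -> D z -> derivable f z e.
Proof. by move=> sf; have [+ _] := sf [::]; apply. Qed.

Lemma smooth_extB f g : smooth_ext D E f -> smooth_ext D E g ->
  smooth_ext D E (fun z => f z - g z).
Proof.
move=> sf sg s.
have I : forall z, D z -> iter_derive s f z - iter_derive s g z = iter_derive s (fun z => f z - g z) z.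
  elim: s => [|e s IH] z Dz //=.
  have [df _] := sf s; have [dg _] := sg s.
  by rewrite -(derive_eq_on _ IH Dz) deriveB; [|exact: df|exact: dg].
have [df [h ch hE]] := sf s; have [dg [k ck kE]] := sg s; split.
  by move=> z e Dz; exact: derivable_eq_on I Dz (derivableB (df z e Dz) (dg z e Dz)).
exists (fun z => h z - k z); first exact: within_continuousB.
by move=> z Dz; rewrite hE // kE // I.
Qed.

Lemma smooth_up_to_components (f : V -> R * R) : smooth_up_to D E f ->
  smooth_ext D E (fun z => (f z).1) /\ smooth_ext D E (fun z => (f z).2).
Proof.
move=> [_ sf].
have I s : forall z, D z ->
    (iter_derive s f z).1 = iter_derive s (fun z => (f z).1) z /\
    (iter_derive s f z).2 = iter_derive s (fun z => (f z).2) z.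
  elim: s => [|e s IH] z Dz //=.
  have [df _] := sf s; have [_ _ ->] := derivable_component (df z e Dz).
  by split; apply: derive_eq_on Dz => y Dy; have [] := IH y Dy.
split=> s; have [df [g cg gE]] := sf s.
- split=> [z e Dz|].
    have [dc _ _] := derivable_component (df z e Dz).
    by apply: (derivable_eq_on _ Dz dc) => y Dy; have [] := I s y Dy.
  exists (fun z => (g z).1); last by move=> z Dz; rewrite gE //; have [] := I s z Dz.
  by move=> x; apply: (cvg_comp _ _ (cg x)); exact: cvg_fst.
- split=> [z e Dz|].
    have [_ dc _] := derivable_component (df z e Dz).
    by apply: (derivable_eq_on _ Dz dc) => y Dy; have [] := I s y Dy.
  exists (fun z => (g z).2); last by move=> z Dz; rewrite gE //; have [] := I s z Dz.
  by move=> x; apply: (cvg_comp _ _ (cg x)); exact: cvg_snd.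
Qed.

Hypothesis DE : D `<=` E.

Lemma smooth_ext_continuous f z : smooth_ext D E f -> D z -> {for z, continuous f}.
Proof.
move=> sf Dz; have [_ [g cg gE]] := sf [::].
have cD : {within D, continuous g} := continuous_subspaceW DE cg.
rewrite (continuous_open_subspace _ oD) in cD.
have cz := cD z (mem_set Dz).
change (f y @[y --> z] --> f z); rewrite -[f z]/(iter_derive [::] f z) -gE //.
by apply: cvg_trans cz; apply: near_eq_cvg; exact: near_open.
Qed.

End smooth_ext.

(** The computation in curl_momentum, as an identity between the values of the
    derivatives at one point: A and B stand for derivatives of order two and three
    of the two components of the velocity, p, q, r, s for those of order one. *)
Lemma curl_identity (R : realType)
    (A1 A2 A3 A4 A5 B1 B2 B3 B4 B5 p q r s u w m ot o1 o2 o11 o22 : R) :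
  p + s = 0 ->
  m = B1 + B2 - B3 - (u * B4 + r * p + (w * B5 + s * r)) ->
  m = A1 + A2 - A3 - (u * A4 + p * q + (w * A5 + q * s)) ->
  ot = B3 - A3 -> o1 = B4 - A4 -> o2 = B5 - A5 -> o11 = B1 - A1 -> o22 = B2 - A2 ->
  ot = o11 + o22 - (u * o1 + w * o2).
Proof. by move=> ps -> + -> -> -> -> ->; have -> : s = - p by [lra]; lra. Qed.

Section space_time_smooth.
Context {R : realType}.
Variables (D E : set (R * R * R)).
Hypotheses (oD : open D) (DE : D `<=` E).

Lemma smooth_ext_differentiable f z : smooth_ext D E f -> D z -> differentiable f z.
Proof.
move=> sf Dz; apply: partials_differentiable3.
- apply: (near_open oD Dz) => y Dy.
  by split; exact: (smooth_ext_derivable (E := E)).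
- exact: (smooth_ext_continuous oD DE (smooth_ext_derive _ sf)).
- exact: (smooth_ext_continuous oD DE (smooth_ext_derive _ sf)).
- exact: (smooth_ext_continuous oD DE (smooth_ext_derive _ sf)).
Qed.

Lemma smooth_ext_commute f a b z : smooth_ext D E f -> D z ->
  'D_a ('D_b f) z = 'D_b ('D_a f) z.
Proof.
move=> sf Dz; apply: mixed_derivatives.
- apply: (near_open oD Dz) => y Dy.
  by split; exact: (smooth_ext_derivable (E := E)).
- by apply: smooth_ext_differentiable Dz; exact: smooth_ext_derive.
- by apply: smooth_ext_differentiable Dz; exact: smooth_ext_derive.
Qed.

Section curl_of_momentum.
Variables v1 v2 : R * R * R -> R.
Hypotheses (sv1 : smooth_ext D E v1) (sv2 : smooth_ext D E v2).

(** The pressure gradient according to the momentum equation, for f = v1 and f = v2. *)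
Definition momentum (f : R * R * R -> R) z : R :=
  'D_dx1 ('D_dx1 f) z + 'D_dx2 ('D_dx2 f) z - 'D_dt f z
    - (v1 z * 'D_dx1 f z + v2 z * 'D_dx2 f z).

Lemma differentiable_momentum f z : smooth_ext D E f -> D z -> differentiable (momentum f) z.
Proof.
move=> sf Dz.
have d1 := smooth_ext_derive dx1 sf; have d2 := smooth_ext_derive dx2 sf.
have h11 := smooth_ext_differentiable (smooth_ext_derive dx1 d1) Dz.
have h22 := smooth_ext_differentiable (smooth_ext_derive dx2 d2) Dz.
have ht := smooth_ext_differentiable (smooth_ext_derive dt sf) Dz.
have h1 := smooth_ext_differentiable d1 Dz; have h2 := smooth_ext_differentiable d2 Dz.
have hv1 := smooth_ext_differentiable sv1 Dz; have hv2 := smooth_ext_differentiable sv2 Dz.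
exact: differentiableB (differentiableB (differentiableD h11 h22) ht)
  (differentiableD (differentiableM hv1 h1) (differentiableM hv2 h2)).
Qed.

Lemma derive_momentum f z e : smooth_ext D E f -> D z ->
  'D_e (momentum f) z =
  'D_e ('D_dx1 ('D_dx1 f)) z + 'D_e ('D_dx2 ('D_dx2 f)) z - 'D_e ('D_dt f) z
  - (v1 z * 'D_e ('D_dx1 f) z + 'D_dx1 f z * 'D_e v1 z +
     (v2 z * 'D_e ('D_dx2 f) z + 'D_dx2 f z * 'D_e v2 z)).
Proof.
move=> sf Dz.
have I g : smooth_ext D E g -> is_derive z e g ('D_e g z).
  by move=> sg; apply/derivableP; exact: (smooth_ext_derivable (E := E)).
have J (g h : R * R * R -> R) : smooth_ext D E g -> smooth_ext D E h ->
    is_derive z e (fun y => g y * h y) (g z * 'D_e h z + h z * 'D_e g z).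
  by move=> sg sh; exact: is_deriveM (I g sg) (I h sh).
have s1 := smooth_ext_derive dx1 sf; have s2 := smooth_ext_derive dx2 sf.
have st := smooth_ext_derive dt sf.
have [_ H] := is_deriveB (is_deriveB (is_deriveD (I _ (smooth_ext_derive dx1 s1))
  (I _ (smooth_ext_derive dx2 s2))) (I _ st)) (is_deriveD (J _ _ sv1 s1) (J _ _ sv2 s2)).
exact: H.
Qed.

Definition curl3 (f g : R * R * R -> R) z : R := 'D_dx1 g z - 'D_dx2 f z.

Lemma derive_curl3 f g e z : smooth_ext D E f -> smooth_ext D E g -> D z ->
  'D_e (curl3 f g) z = curl3 ('D_e f) ('D_e g) z.
Proof.
move=> sf sg Dz; rewrite /curl3.
rewrite -(smooth_ext_commute e dx1 sg Dz) -(smooth_ext_commute e dx2 sf Dz).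
apply: deriveB; apply: (smooth_ext_derivable (E := E) _ Dz); exact: smooth_ext_derive.
Qed.

Lemma derive2_curl3 f g e z : smooth_ext D E f -> smooth_ext D E g -> D z ->
  'D_e ('D_e (curl3 f g)) z = curl3 ('D_e ('D_e f)) ('D_e ('D_e g)) z.
Proof.
move=> sf sg Dz; rewrite -derive_curl3 //; [|exact: smooth_ext_derive..].
by apply: (derive_eq_on oD) => // y Dy; exact: derive_curl3.
Qed.

(** Taking the curl of the momentum equation removes the gradient of the
    pressure, and in the plane the stretching term is a multiple of the
    divergence. *)
Lemma curl_momentum z : D z -> 'D_dx1 v1 z + 'D_dx2 v2 z = 0 ->
  'D_dx2 (momentum v1) z = 'D_dx1 (momentum v2) z ->
  'D_dt (curl3 v1 v2) z = 'D_dx1 ('D_dx1 (curl3 v1 v2)) z + 'D_dx2 ('D_dx2 (curl3 v1 v2)) z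
    - (v1 z * 'D_dx1 (curl3 v1 v2) z + v2 z * 'D_dx2 (curl3 v1 v2) z).
Proof.
move=> Dz div mc.
exact: (curl_identity div (derive_momentum dx1 sv2 Dz)
  (etrans (esym mc) (derive_momentum dx2 sv1 Dz))
  (derive_curl3 dt sv1 sv2 Dz) (derive_curl3 dx1 sv1 sv2 Dz) (derive_curl3 dx2 sv1 sv2 Dz)
  (derive2_curl3 dx1 sv1 sv2 Dz) (derive2_curl3 dx2 sv1 sv2 Dz)).
Qed.

End curl_of_momentum.

End space_time_smooth.

Section slices.
Context {R : realType}.

Lemma quotient_at_time (W : normedModType R) (f : R * R * R -> W) (s : R) x (e : R * R) :
  (fun h : R => h^-1 *: (f (h *: e + x, s) - f (x, s))) =
  (fun h : R => h^-1 *: (f (h *: (e, 0) + (x, s)) - f (x, s))).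
Proof.
apply/funext => h; rewrite (_ : h *: (e, 0 : R) + (x, s) = (h *: e + x, s)) //.
by congr (_, _); rewrite /= scaler0 add0r.
Qed.

Lemma quotient_in_time (W : normedModType R) (f : R * R * R -> W) (s : R) (x : R * R) :
  (fun h : R => h^-1 *: (f (x, h *: (1 : R) + s) - f (x, s))) =
  (fun h : R => h^-1 *: (f (h *: dt + (x, s)) - f (x, s))).
Proof.
apply/funext => h; rewrite (_ : h *: dt + (x, s) = (x, h *: (1 : R) + s)) //.
by congr (_, _); rewrite /= scaler0 add0r.
Qed.

Lemma derive_at_time (W : normedModType R) (f : R * R * R -> W) (s : R) x (e : R * R) :
  'D_e (at_time f s) x = 'D_(e, 0) f (x, s).
Proof. by rewrite /derive /= -quotient_at_time. Qed.

Lemma derive_in_time (W : normedModType R) (f : R * R * R -> W) (s : R) (x : R * R) :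
  'D_1 (fun s : R => f (x, s)) s = 'D_dt f (x, s).
Proof. by rewrite /derive /= -quotient_in_time. Qed.

Lemma derivable_in_time (W : normedModType R) (f : R * R * R -> W) (s : R) (x : R * R) :
  derivable (fun s : R => f (x, s)) s 1 <-> derivable f (x, s) dt.
Proof. by rewrite /derivable /= -quotient_in_time. Qed.

Lemma differentiable_at_time (m : R * R * R -> R) (s : R) x :
  differentiable m (x, s) -> differentiable (at_time m s) x.
Proof.
move=> dm; apply: (@differentiable_comp _ _ _ _ (fun y : R * R => (y, s)) m x) dm.
apply: (@differentiable_pair _ _ _ _ (fun y : R * R => y) (fun=> s)); last exact: differentiable_cst.
exact: ex_diff.
Qed.

Lemma momentum_components (A B1 B2 C1 C2 u : R * R) (q1 q2 : R)
    (a1 a2 a3 a4 a5 a6 a7 a8 a9 a10 a11 a12 : R) :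
  A = (a9, a10) -> B1 = (a1, a2) -> B2 = (a3, a4) -> C1 = (a5, a6) -> C2 = (a7, a8) ->
  q1 = a11 -> q2 = a12 ->
  A - (B1 + B2) + (u.1 *: C1 + u.2 *: C2) + (q1, q2) = 0 ->
  a11 = a1 + a3 - a9 - (u.1 * a5 + u.2 * a7) /\ a12 = a2 + a4 - a10 - (u.1 * a6 + u.2 * a8).
Proof.
move=> -> -> -> -> -> -> -> [m1 m2].
have {}m1 : a9 - (a1 + a3) + (u.1 * a5 + u.2 * a7) + a11 = 0 := m1.
have {}m2 : a10 - (a2 + a4) + (u.1 * a6 + u.2 * a8) + a12 = 0 := m2.
by split; lra.
Qed.

Lemma vorticityE (v : R * R * R -> R * R) :
  vorticity v = fun z => 'D_dx1 (fun y => (v y).2) z - 'D_dx2 (fun y => (v y).1) z.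
Proof.
apply/funext => z; rewrite /vorticity /curl.
rewrite (derive_at_time (fun z => (v z).2)) (derive_at_time (fun z => (v z).1)).
by rewrite -surjective_pairing.
Qed.

End slices.

Section vorticity_equation.
Context {R : realType}.
Variables (Omega : set (R * R)) (T : R) (v0 : R * R -> R * R)
  (v : R * R * R -> R * R) (p : R * R * R -> R).
Local Notation D := (Omega `*` `]0, T[).
Local Notation E := (closure Omega `*` `[0, T[).
Hypotheses (oO : open Omega) (sv : smooth_up_to D E v) (NS : navier_stokes Omega T v0 v p).

Let v1 z := (v z).1.
Let v2 z := (v z).2.
Let omega := vorticity v.

Lemma open_cylinder : open D.
Proof. rewrite (_ : D = fst @^-1` Omega `&` snd @^-1` [set` `]0, T[]) //.
by apply: openI; [apply: (@open_comp _ _ fst) => // z _; exact: cvg_fst|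
  apply: (@open_comp _ _ snd) => // z _; exact: cvg_snd]. Qed.

Lemma subcylinder_sub s : s <= T -> Omega `*` `]0, s[ `<=` E.
Proof.
move=> sT z [Oz]; rewrite /= !in_itv /= => /andP[z0 zs]; split; first exact: subset_closure.
by rewrite /= ltW // (lt_le_trans zs).
Qed.

Lemma cylinder_sub : D `<=` E.
Proof. exact: subcylinder_sub. Qed.

Let sv1 : smooth_ext D E v1.
Proof. by have [] := smooth_up_to_components open_cylinder sv. Qed.
Let sv2 : smooth_ext D E v2.
Proof. by have [] := smooth_up_to_components open_cylinder sv. Qed.

Lemma smooth_vorticity : smooth_ext D E omega.
Proof.
rewrite /omega vorticityE; apply: (smooth_extB open_cylinder); exact: smooth_ext_derive.
Qed.

Lemma divergence_free z : D z -> 'D_dx1 v1 z + 'D_dx2 v2 z = 0.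
Proof.
case: z => x s [/= Ox]; rewrite in_itv /= => sT.
have [_ dv _ _] := NS; have := dv x s Ox sT.
by rewrite /divergence (derive_at_time v1) (derive_at_time v2).
Qed.

Let derive_eqD (f g : R * R * R -> R) e z :
  (forall y, D y -> f y = g y) -> D z -> 'D_e f z = 'D_e g z.
Proof. by move=> fg Dz; exact: (@derive_eq_on R _ D open_cylinder R f g e z fg Dz). Qed.

Lemma pressure_gradient z : D z -> 'D_dx1 p z = momentum v1 v2 v1 z /\ 'D_dx2 p z = momentum v1 v2 v2 z.
Proof.
case: z => x s [/= Ox]; rewrite in_itv /= => sT.
have [mom _ _ _] := NS; have [_] := mom x s Ox sT.
have Dz y : Omega y -> D (y, s) by move=> Oy; split => //=; rewrite in_itv.
have dv y e : Omega y -> derivable v (y, s) e.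
  by move=> Oy; have [_ H] := sv; have [h _] := H [::]; apply: h; exact: Dz.
have dvE y e : Omega y -> 'D_e v (y, s) = ('D_e v1 (y, s), 'D_e v2 (y, s)).
  by move=> Oy; have [_ _ ->] := derivable_component (dv y e Oy).
have ddv y e f : Omega y -> derivable ('D_f v) (y, s) e.
  by move=> Oy; have [_ H] := sv; have [h _] := H [:: f]; apply: h; exact: Dz.
have ddvE e f : 'D_e ('D_f v) (x, s) = ('D_e ('D_f v1) (x, s), 'D_e ('D_f v2) (x, s)).
  have [_ _ ->] := derivable_component (ddv x e f Ox).
  have fE y : D y -> 'D_f v y = ('D_f v1 y, 'D_f v2 y).
    move=> Dy; have [_ H] := sv; have [h _] := H [::].
    by have [_ _ ->] := derivable_component (h _ f Dy).
  rewrite (@derive_eqD (fun z => ('D_f v z).1) ('D_f v1) e _ _ (Dz x Ox)); last by move=> y /fE ->.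
  by rewrite (@derive_eqD (fun z => ('D_f v z).2) ('D_f v2) e _ _ (Dz x Ox)) // => y /fE ->.
have L1 : 'D_e1 (fun y => 'D_e1 (at_time v s) y) x =
    ('D_dx1 ('D_dx1 v1) (x, s), 'D_dx1 ('D_dx1 v2) (x, s)).
  have -> : (fun y => 'D_e1 (at_time v s) y) = at_time ('D_dx1 v) s.
    by apply/funext => y; exact: (derive_at_time v s y e1).
  by rewrite -(ddvE dx1 dx1); exact: (derive_at_time ('D_dx1 v) s x e1).
have L2 : 'D_e2 (fun y => 'D_e2 (at_time v s) y) x =
    ('D_dx2 ('D_dx2 v1) (x, s), 'D_dx2 ('D_dx2 v2) (x, s)).
  have -> : (fun y => 'D_e2 (at_time v s) y) = at_time ('D_dx2 v) s.
    by apply/funext => y; exact: (derive_at_time v s y e2).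
  by rewrite -(ddvE dx2 dx2); exact: (derive_at_time ('D_dx2 v) s x e2).
have G1 : 'D_e1 (at_time v s) x = ('D_dx1 v1 (x, s), 'D_dx1 v2 (x, s)).
  by rewrite -(dvE x dx1 Ox); exact: derive_at_time.
have G2 : 'D_e2 (at_time v s) x = ('D_dx2 v1 (x, s), 'D_dx2 v2 (x, s)).
  by rewrite -(dvE x dx2 Ox); exact: derive_at_time.
have Gt : 'D_1 (fun s => v (x, s)) s = ('D_dt v1 (x, s), 'D_dt v2 (x, s)).
  by rewrite -(dvE x dt Ox); exact: derive_in_time.
have p1 : 'D_e1 (at_time p s) x = 'D_dx1 p (x, s) by exact: derive_at_time.
have p2 : 'D_e2 (at_time p s) x = 'D_dx2 p (x, s) by exact: derive_at_time.
move=> m; exact: (momentum_components Gt L1 L2 G1 G2 p1 p2 m).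
Qed.

(** Here the components of the pressure gradient are replaced by the smooth
    functions with which they agree in Omega, and Young's theorem applies. *)
Lemma momentum_curl z : D z -> 'D_dx2 (momentum v1 v2 v1) z = 'D_dx1 (momentum v1 v2 v2) z.
Proof.
case: z => x s Dz; have [Ox sT] := Dz; rewrite /= in_itv /= in sT.
have Dy y : Omega y -> D (y, s) by move=> Oy; split => //=; rewrite in_itv.
have [mom _ _ _] := NS.
have P1 y : Omega y -> 'D_e1 (at_time p s) y = at_time (momentum v1 v2 v1) s y.
  by move=> Oy; rewrite derive_at_time; have [] := pressure_gradient (Dy y Oy).
have P2 y : Omega y -> 'D_e2 (at_time p s) y = at_time (momentum v1 v2 v2) s y.
  by move=> Oy; rewrite derive_at_time; have [] := pressure_gradient (Dy y Oy).
have dm (m : R * R * R -> R) := @differentiable_at_time R m s x.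
have dmom f (sf : smooth_ext D E f) :=
  @differentiable_momentum _ _ _ open_cylinder cylinder_sub v1 v2 sv1 sv2 f (x, s) sf Dz.
have H := @mixed_derivatives R _ (at_time p s) x e1 e2.
have oE (f g : R * R -> R) e : (forall y, Omega y -> f y = g y) -> 'D_e f x = 'D_e g x.
  by move=> fg; exact: (@derive_eq_on R _ Omega oO R f g e x fg Ox).
have := oE _ _ e2 P1; have := oE _ _ e1 P2; rewrite !derive_at_time => <- <-.
apply: H.
- apply: (near_open oO Ox) => y Oy; have [dp _] := mom y s Oy sT.
  by split; exact: diff_derivable.
- apply: (@differentiable_near_eq _ _ (at_time (momentum v1 v2 v1) s)).
    by apply: (near_open oO Ox) => y /P1 ->.
  exact: dm (dmom _ sv1).
- apply: (@differentiable_near_eq _ _ (at_time (momentum v1 v2 v2) s)).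
    by apply: (near_open oO Ox) => y /P2 ->.
  exact: dm (dmom _ sv2).
Qed.

Lemma vorticity_equation z : D z ->
  'D_dt omega z = 'D_dx1 ('D_dx1 omega) z + 'D_dx2 ('D_dx2 omega) z
    - (v1 z * 'D_dx1 omega z + v2 z * 'D_dx2 omega z).
Proof.
move=> Dz; have oE : omega = curl3 v1 v2 by rewrite /omega vorticityE.
rewrite oE; exact: (@curl_momentum _ _ _ open_cylinder cylinder_sub v1 v2 sv1 sv2 z Dz
  (divergence_free Dz) (momentum_curl Dz)).
Qed.

End vorticity_equation.

(** * Traces and time slices of the continuous extensions *)

Section traces.
Context {R : realType}.
Implicit Types (Omega : set (R * R)).

Lemma traceE Omega (f g : R * R -> R) x : {within closure Omega, continuous g} ->
  (forall y, Omega y -> f y = g y) -> closure Omega x -> trace Omega f x = g x.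
Proof.
move=> /subspace_continuousP cg fg clx; rewrite /trace.
have pF : ProperFilter (within Omega (nbhs x)).
  by apply: within_nbhs_proper.
apply: cvg_lim; first exact: norm_hausdorff.
have : g y @[y --> within Omega (nbhs x)] --> g x.
  apply: cvg_trans (cg x clx); apply: cvg_app.
  move=> P nP; have {}nP : nbhs x (fun y => closure Omega y -> P y) := nP.
  change (nbhs x (fun y => Omega y -> P y)).
  by apply: filterS nP => y h Oy; apply: h; exact: subset_closure.
apply: cvg_trans; apply: near_eq_cvg.
change (nbhs x (fun y => Omega y -> g y = f y)).
by apply: filterE => y Oy; rewrite fg.
Qed.

End traces.

Section cylinder.
Context {R : realType}.
Variables (Omega : set (R * R)) (T : R).
Local Notation D := (Omega `*` `]0, T[).
Local Notation E := (closure Omega `*` `[0, T[).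
Hypothesis oO : open Omega.

Lemma slice_continuous (g : R * R * R -> R) s : {within E, continuous g} -> 0 <= s < T ->
  {within closure Omega, continuous (fun x => g (x, s))}.
Proof.
move=> cg sT; apply: (@restriction_continuous_comp _ _ _ (closure Omega) E (fun x : R * R => (x, s)) g).
- exact: continuous_subspaceT (@continuous_pairl _ _ s).
- exact: cg.
- by move=> x clx; split => //=; rewrite in_itv.
Qed.

Lemma time_slice_continuous (g : R * R * R -> R) x s : {within E, continuous g} ->
  closure Omega x -> s < T -> {within `[0, s], continuous (fun s => g (x, s))}.
Proof.
move=> cg clx sT; apply: (@restriction_continuous_comp _ _ _ `[0, s]%classic E (fun s : R => (x, s)) g).
- exact: continuous_subspaceT (@continuous_pairr _ _ x).
- exact: cg.
- move=> r /=; rewrite !in_itv /= => /andP[r0 rs]; split => //=.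
  by rewrite r0 (le_lt_trans rs).
Qed.

Lemma slice_C1_closure (f g g1 g2 : R * R * R -> R) s :
  smooth_ext D E f -> {within E, continuous g} -> {within E, continuous g1} ->
  {within E, continuous g2} -> (forall z, D z -> g z = f z) ->
  (forall z, D z -> g1 z = 'D_dx1 f z) -> (forall z, D z -> g2 z = 'D_dx2 f z) ->
  0 < s < T ->
  C1_closure Omega (fun x => g (x, s)) (fun x => g1 (x, s)) (fun x => g2 (x, s)).
Proof.
move=> sf cg cg1 cg2 gE g1E g2E sT.
have sT' : 0 <= s < T by case/andP: sT => /ltW -> ->.
split; try exact: slice_continuous.
move=> x Ox.
have Dy y : Omega y -> D (y, s) by move=> Oy; split => //=; rewrite in_itv.
have fg y : Omega y -> at_time f s y = g (y, s) by move=> Oy; rewrite gE //; exact: Dy.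
have df : differentiable (at_time f s) x.
  apply: differentiable_at_time.
  exact: (@smooth_ext_differentiable R D E (@open_cylinder R Omega T oO) (@cylinder_sub R Omega T) f (x, s) sf (Dy x Ox)).
split.
- by apply: (@differentiable_near_eq _ _ (at_time f s)) df; exact: (near_open oO Ox).
- rewrite g1E; last exact: Dy.
  rewrite -(derive_at_time f s x e1).
  by apply: (derive_eq_on oO) => // y Oy; rewrite fg.
- rewrite g2E; last exact: Dy.
  rewrite -(derive_at_time f s x e2).
  by apply: (derive_eq_on oO) => // y Oy; rewrite fg.
Qed.

Lemma slice_time_derive (f g gt : R * R * R -> R) x s :
  smooth_ext D E f -> (forall z, D z -> g z = f z) -> (forall z, D z -> gt z = 'D_dt f z) ->
  Omega x -> 0 < s < T -> is_derive s (1 : R) (fun s => g (x, s)) (gt (x, s)).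
Proof.
move=> sf gE gtE Ox sT.
have Ds : D (x, s) by split => //=; rewrite in_itv.
have ns : \forall r \near s, f (x, r) = g (x, r).
  have oT : open (`]0, T[%classic : set R) by exact: itv_open.
  apply: (@near_open _ R _ oT _ s); first by rewrite /= in_itv.
  by move=> r rT; rewrite gE //; split.
apply: DeriveDef.
- apply: near_eq_derivable ns _.
  by apply/derivable_in_time; exact: (@smooth_ext_derivable R _ D E f _ _ sf Ds).
- by rewrite gtE // -derive_in_time; apply/esym; exact: near_eq_derive.
Qed.

(** The derivative at time 0 is the limit of the derivatives at positive times:
    pass to the limit in the mean value inequality. *)
Lemma derive_initial (f g : R * R * R -> R) x e :
  0 < T -> smooth_ext D E f -> {within E, continuous f} -> {within E, continuous g} ->
  (forall z, D z -> g z = 'D_(e, 0) f z) -> Omega x ->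
  'D_(e, 0) f (x, 0) = g (x, 0).
Proof.
move=> T0 sf cf cg gE Ox.
have E0 y : Omega y -> E (y, 0).
  by move=> Oy; split; [exact: subset_closure|rewrite /= in_itv /= lexx].
rewrite -(derive_at_time f 0 x e) /derive.
apply: cvg_lim; first exact: norm_hausdorff.
apply/cvgrPdist_le => eps eps0; set c := g (x, 0).
have right_lim y : Omega y -> f (y, r) @[r --> 0^'+] --> f (y, 0).
  move=> Oy; have T2 : 0 < T / 2 by lra.
  have := time_slice_continuous cf (subset_closure Oy) (_ : T / 2 < T).
  by move=> /(_ ltac:(lra)) /(continuous_within_itvP _ T2)[].
have ng : nbhs (x, 0 : R) (fun z => E z -> `|c - g z| < eps).
  move/subspace_continuousP : cg => /(_ (x, 0 : R) (E0 x Ox)) /cvgrPdist_lt/(_ _ eps0).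
  exact.
have /nbhs_ballP[d1 /= d10 b1] := ng.
have /nbhs_ballP[d2 /= d20 b2] : nbhs x Omega by exact: open_nbhs_nbhs.
pose d := Num.min (Num.min d1 d2) T; have d0 : 0 < d by rewrite !lt_min d10 d20.
have inO y : `|y - x| < d -> Omega y.
  by rewrite !lt_min => /andP[/andP[_ yd] _]; apply: b2; rewrite -ball_normE /= distrC.
have bound h : `|h| * `|e| < d -> `|f (x + h *: e, 0) - f (x, 0) - h * c| <= eps * `|h|.
  move=> hd.
  have Oh k : `|k| <= `|h| -> `|x + k *: e - x| < d.
    by move=> kh; rewrite addrAC subrr add0r normrZ; apply: le_lt_trans hd; rewrite ler_wpM2r.
  pose u r := `|f (x + h *: e, r) - f (x, r) - h * c|.
  have cu : u r @[r --> 0^'+] --> u 0.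
    apply: cvg_norm; apply: cvgB; last exact: cvg_cst.
    by apply: cvgB; apply: right_lim => //; exact/inO/Oh.
  apply: (@closed_cvg _ _ _ _ u [set y | y <= eps * `|h|] (@closed_le _ _) _ _ cu).
  near=> r.
  have r0 : 0 < r by near: r; exact: nbhs_right_gt.
  have rd : r < d by near: r; exact: nbhs_right_lt.
  have zE k : (x, r) + k *: (e, 0 : R) = (x + k *: e, r).
    by congr (_, _); rewrite /= scaler0 addr0.
  rewrite /= /u -zE; apply: increment_le => k kh; rewrite zE.
  have Dk : D (x + k *: e, r).
    split => /=; first exact/inO/Oh.
    by rewrite in_itv /= r0 (lt_le_trans rd) // ge_min lexx orbT.
  split; first exact: (@smooth_ext_derivable R _ D E f _ _ sf Dk).
  rewrite -gE // distrC; apply/ltW/b1; last exact: (@cylinder_sub R Omega T).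
  rewrite -ball_normE /= prod_normE /= gt_max; apply/andP; split.
    by rewrite distrC; apply: lt_le_trans (Oh k kh) _; rewrite !ge_min lexx.
  by rewrite sub0r normrN gtr0_norm // (lt_le_trans rd) // !ge_min lexx.
near=> h.
have h0 : h != 0 by near: h; exact: nbhs_dnbhs_neq.
have hd : `|h| * `|e| < d.
  have : `|h| < d / (`|e| + 1).
    near: h; apply: dnbhs0_lt; rewrite divr_gt0 // ltr_wpDl //.
  rewrite ltr_pdivlMr ?ltr_wpDl //; apply: le_lt_trans.
  by rewrite ler_wpM2l // lerDl.
have := bound h hd; rewrite [x + _]addrC => B.
have -> : `|c - h^-1 *: (at_time f 0 (h *: e + x) - at_time f 0 x)| =
    `|h|^-1 * `|f (h *: e + x, 0) - f (x, 0) - h * c|.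
  by rewrite distrC -normfV -normrM mulrBr mulrA mulVf // mul1r.
by rewrite ler_pdivrMl ?normr_gt0 // [leRHS]mulrC.
Unshelve. all: by end_near. Qed.

End cylinder.

(** * Iterated integrals over products of sets *)

Section rectangles.
Local Open Scope ereal_scope.
Context d1 d2 (T1 : measurableType d1) (T2 : measurableType d2) (R : realType).
Variables (m1 : {sigma_finite_measure set T1 -> \bar R})
  (m2 : {sigma_finite_measure set T2 -> \bar R}).
Variables (A : set T1) (B : set T2) (mA : measurable A) (mB : measurable B).
Implicit Types f : T1 * T2 -> \bar R.

Lemma patch_rectangle1 f x : \int[m2]_y (f \_ (A `*` B)) (x, y) =
  ((fun x => \int[m2]_(y in B) f (x, y)) \_ A) x.
Proof.
rewrite [RHS]patchE; case: ifPn => [/[!inE] Ax|].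
  rewrite [RHS]integral_mkcond; apply: eq_integral => y _; rewrite !patchE.
  by congr (if _ then _ else _); apply/idP/idP; rewrite !inE => // -[].
rewrite notin_setE => nAx; apply: integral0_eq => y _.
by rewrite patchE memNset // => -[].
Qed.

Lemma patch_rectangle2 f y : \int[m1]_x (f \_ (A `*` B)) (x, y) =
  ((fun y => \int[m1]_(x in A) f (x, y)) \_ B) y.
Proof.
rewrite [RHS]patchE; case: ifPn => [/[!inE] By|].
  rewrite [RHS]integral_mkcond; apply: eq_integral => x _; rewrite !patchE.
  by congr (if _ then _ else _); apply/idP/idP; rewrite !inE => // -[].
rewrite notin_setE => nBy; apply: integral0_eq => x _.
by rewrite patchE memNset // => -[].
Qed.

Let mAB : measurable (A `*` B). Proof. exact: measurableX. Qed.

Lemma fubini_rectangle1 f : (m1 \x m2).-integrable (A `*` B) f ->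
  \int[m1]_(x in A) \int[m2]_(y in B) f (x, y) = \int[m1 \x m2]_(z in A `*` B) f z.
Proof.
move=> /(integrable_mkcond _ mAB) fi; rewrite integral_mkcond [RHS]integral_mkcond.
rewrite -(integral12_prod_meas1 fi); apply: eq_integral => x _.
by rewrite /fubini_F patch_rectangle1.
Qed.

Lemma fubini_rectangle2 f : (m1 \x m2).-integrable (A `*` B) f ->
  m2.-integrable B (fun y => \int[m1]_(x in A) f (x, y)) /\
  \int[m2]_(y in B) \int[m1]_(x in A) f (x, y) = \int[m1 \x m2]_(z in A `*` B) f z.
Proof.
move=> /(integrable_mkcond _ mAB) fi; split.
  apply/(integrable_mkcond _ mB).
  have <- : fubini_G m1 (f \_ (A `*` B)) = (fun y => \int[m1]_(x in A) f (x, y)) \_ B.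
    by apply/funext => y; rewrite /fubini_G patch_rectangle2.
  have mf := measurable_int _ fi.
  apply/integrableP; split; first exact: measurable_fubini_G fi.
  apply: le_lt_trans ((integrable21ltyP m1 m2 mf).1 fi).
  apply: ge0_le_integral => //.
  - by apply: measurableT_comp => //; exact: measurable_fubini_G fi.
  - have := @measurable_fun_fubini_tonelli_G _ _ _ _ _ m1 (abse \o f \_ (A `*` B)).
    by apply=> [|z]; [exact: measurableT_comp|exact: abse_ge0].
  - move=> y _; apply: le_abse_integral => //.
    by apply: measurableT_comp mf _; exact: measurable_pair2.
rewrite integral_mkcond [RHS]integral_mkcond.
rewrite -(integral21_prod_meas1 fi); apply: eq_integral => y _.
by rewrite /fubini_G patch_rectangle2.
Qed.

Lemma tonelli_rectangle2 f : measurable_fun (A `*` B) f -> (forall z, 0 <= f z) ->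
  measurable_fun B (fun y => \int[m1]_(x in A) f (x, y)) /\
  \int[m2]_(y in B) \int[m1]_(x in A) f (x, y) = \int[m1 \x m2]_(z in A `*` B) f z.
Proof.
move=> /(measurable_restrictT _ mAB) mf f0.
have f0' z : 0 <= (f \_ (A `*` B)) z by exact: erestrict_ge0.
split.
  apply/(measurable_restrictT _ mB).
  have <- : fubini_G m1 (f \_ (A `*` B)) = (fun y => \int[m1]_(x in A) f (x, y)) \_ B.
    by apply/funext => y; rewrite /fubini_G patch_rectangle2.
  exact: measurable_fun_fubini_tonelli_G.
rewrite integral_mkcond [RHS]integral_mkcond.
rewrite (fubini_tonelli2 (f \_ (A `*` B)) mf f0'); apply: eq_integral => y _.
by rewrite /fubini_G patch_rectangle2.
Qed.

End rectangles.

Lemma integrable_real_value d (T : measurableType d) (R : realType)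
    (mu : {measure set T -> \bar R}) (D : set T) (f : T -> \bar R) :
  measurable D -> mu.-integrable D f -> exists a : R, (\int[mu]_(x in D) f x = a%:E)%E.
Proof.
move=> mD fi; have := integrable_fin_num mD fi.
by move=> /fineK E; exists (fine (\int[mu]_(x in D) f x)%E); rewrite E.
Qed.

Section exhaustion.
Local Open Scope ereal_scope.
Context d1 d2 (T1 : measurableType d1) (T2 : measurableType d2) (R : realType).
Variables (m1 : {measure set T1 -> \bar R}) (m2 : {measure set T2 -> \bar R}).

(** The two sequences of integrals increase, so that a common bound of their sums
    passes to the limit, even if the finiteness of either limit is not known before. *)
Lemma exhaustion_le (A : nat -> set T1) (B : nat -> set T2) (f : T1 -> \bar R)
    (g : T2 -> \bar R) (c : \bar R) :
  nondecreasing_seq A -> nondecreasing_seq B ->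
  (forall n, measurable (A n)) -> (forall n, measurable (B n)) ->
  measurable_fun (\bigcup_n A n) f -> measurable_fun (\bigcup_n B n) g ->
  (forall x, 0 <= f x) -> (forall x, 0 <= g x) ->
  (forall n, \int[m1]_(x in A n) f x + \int[m2]_(x in B n) g x <= c) ->
  \int[m1]_(x in \bigcup_n A n) f x + \int[m2]_(x in \bigcup_n B n) g x <= c.
Proof.
move=> ndA ndB mA mB mf mg f0 g0 H.
have cA := @ge0_nondecreasing_set_cvg_integral _ _ _ A f m1 ndA mA
  (fun n => measurable_funS (bigcup_measurable (fun n _ => mA n)) (@bigcup_sup _ _ n _ A I) mf)
  (fun n x _ => f0 x).
have cB := @ge0_nondecreasing_set_cvg_integral _ _ _ B g m2 ndB mB
  (fun n => measurable_funS (bigcup_measurable (fun n _ => mB n)) (@bigcup_sup _ _ n _ B I) mg)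
  (fun n x _ => g0 x).
apply: (@closed_cvg _ _ _ _ (fun n => \int[m1]_(x in A n) f x + \int[m2]_(x in B n) g x)
  [set y | y <= c]) (cvgeD _ cA cB).
- exact: closed_ereal_ge_ereal.
- exact: nearW.
- by rewrite ge0_adde_def // inE integral_ge0.
Qed.

End exhaustion.

Section plane_measure.
Context {R : realType}.

Let leb2_sigma_finite : sigma_finite setT (leb2 : set (mplane R) -> \bar R).
Proof.
exists (fun n : nat => box 0 n%:R).
  apply/seteqP; split => // x _; exists (Num.truncn `|x|).+1 => //.
  by rewrite /box /= subr0 ltW // truncnS_gt.
by move=> n; split; [exact: measurable_box|exact: leb2_box_fin].
Qed.

(** The area under a name of its own, which can carry the structure of a
    sigma-finite measure: Fubini's theorem in space-time asks for it. *)
Definition plane_measure (A : set (mplane R)) : \bar R := leb2 A.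

HB.instance Definition _ := Measure.copy plane_measure
  (product_measure1 (@lebesgue_measure R) (@lebesgue_measure R)).
HB.instance Definition _ := Measure_isSigmaFinite.Build _ (mplane R) R plane_measure leb2_sigma_finite.

Variables (A : set (mplane R)) (B : set (measurableTypeR R)) (f : mplane R * measurableTypeR R -> R).
Hypotheses (mA : measurable A) (mB : measurable B).
Local Notation mu3 := (leb3 : {measure set (mplane R * measurableTypeR R) -> \bar R}).

Lemma fubini_space_time : mu3.-integrable (A `*` B) (EFin \o f) ->
  [/\ (@lebesgue_measure R).-integrable B (fun y => (\int[leb2]_(x in A) (f (x, y))%:E)%E),
    (\int[leb1]_(y in B) \int[leb2]_(x in A) (f (x, y))%:E = \int[leb3]_(z in A `*` B) (f z)%:E)%E &
    (\int[leb2]_(x in A) \int[leb1]_(y in B) (f (x, y))%:E = \int[leb3]_(z in A `*` B) (f z)%:E)%E].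
Proof.
move=> fi.
have [H1 H2] := @fubini_rectangle2 _ _ (mplane R) (measurableTypeR R) R plane_measure
  (@lebesgue_measure R) A B mA mB (EFin \o f) fi.
have H3 := @fubini_rectangle1 _ _ (mplane R) (measurableTypeR R) R plane_measure
  (@lebesgue_measure R) A B mA mB (EFin \o f) fi.
by split.
Qed.

Lemma tonelli_space_time : measurable_fun (A `*` B) f -> (forall z, 0 <= f z) ->
  measurable_fun B (fun y => (\int[leb2]_(x in A) (f (x, y))%:E)%E) /\
  (\int[leb1]_(y in B) \int[leb2]_(x in A) (f (x, y))%:E = \int[leb3]_(z in A `*` B) (f z)%:E)%E.
Proof.
move=> mf f0.
apply: (@tonelli_rectangle2 _ _ (mplane R) (measurableTypeR R) R plane_measure
  (@lebesgue_measure R) A B mA mB (EFin \o f)); first exact/measurable_EFinP.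
by move=> z; rewrite /= lee_fin.
Qed.

End plane_measure.

(** * The local energy inequality *)

Section energy.
Context {R : realType}.
Variables (Omega : set (R * R)) (nu : R * R -> R * R)
  (sigma : {sigma_finite_measure set (mplane R) -> \bar R}) (T : R).
Hypotheses (oO : open Omega)
  (nuP : forall x, boundary Omega x -> outward_normal Omega x (nu x))
  (sigmaP : surface_measure Omega sigma) (smoothO : smooth_boundary Omega).
Local Notation E := (closure Omega `*` `[0, T[).
Local Notation mu3 := (leb3 : {measure set (mplane R * measurableTypeR R) -> \bar R}).
Variables (W W1 W2 W11 W12 W21 W22 Wt u1 u2 u11 u12 u21 u22 : R * R * R -> R).
Hypotheses (cW : {within E, continuous W}) (cW1 : {within E, continuous W1})
  (cW2 : {within E, continuous W2}) (cWt : {within E, continuous Wt}).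
Local Notation C1_slices f f1 f2 := (forall s : R, 0 < s < T ->
  C1_closure Omega (fun x => f (x, s)) (fun x => f1 (x, s)) (fun x => f2 (x, s))).
Hypotheses (CW : C1_slices W W1 W2) (CW1 : C1_slices W1 W11 W12) (CW2 : C1_slices W2 W21 W22)
  (Cu1 : C1_slices u1 u11 u12) (Cu2 : C1_slices u2 u21 u22).
Hypotheses
  (dW : forall x (s : R), Omega x -> 0 < s < T ->
    is_derive s (1 : R) (fun s => W (x, s)) (Wt (x, s)))
  (eqW : forall x (s : R), Omega x -> 0 < s < T ->
    Wt (x, s) = W11 (x, s) + W22 (x, s) - (u1 (x, s) * W1 (x, s) + u2 (x, s) * W2 (x, s)))
  (divu : forall x (s : R), Omega x -> 0 < s < T -> u11 (x, s) + u22 (x, s) = 0)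
  (u0 : forall x (s : R), boundary Omega x -> 0 < s < T -> u1 (x, s) = 0 /\ u2 (x, s) = 0).

(** The boundary values of omega times its normal derivative, once W, W1 and W2 are
    the continuous extensions of omega and of its gradient. *)
Definition flux (z : R * R * R) : R := W z * (W1 z * (nu z.1).1 + W2 z * (nu z.1).2).

Section cutoff.
Variables (n : R).
Hypothesis n0 : 0 < n.
Local Notation eta := (cutoff 0 n).
Local Notation eta1 := (cutoff1 0 n).
Local Notation eta2 := (cutoff2 0 n).

Let eta_off x : ~ box 0 (2 * n) x -> eta x = 0.
Proof. exact: cutoff_eq0. Qed.

(** Green's formula for the field zeta^2 (W grad W - W^2 u / 2): its divergence contains
    W (Lap W - u . grad W) = W Wt, and on the boundary u = 0 leaves the flux. *)
Lemma slice_energy s : 0 < s < T ->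
  green_formula Omega nu sigma (fun x => eta x ^+ 2 * (W (x, s) * W1 (x, s)))
    (fun x => eta x ^+ 2 * (W (x, s) * W2 (x, s)))
    (fun x => eta x ^+ 2 * (W (x, s) * Wt (x, s)) +
       eta x ^+ 2 * (W1 (x, s) ^+ 2 + W2 (x, s) ^+ 2) +
       2 * eta x * W (x, s) * (eta1 x * W1 (x, s) + eta2 x * W2 (x, s)) -
       eta x * W (x, s) ^+ 2 * (eta1 x * u1 (x, s) + eta2 x * u2 (x, s))).
Proof.
move=> sT; have Ce := C1_closure_cutoff Omega 0 n.
have Cz := C1_closureM Ce Ce.
have CF := C1_closureB (C1_closureM Cz (C1_closureM (CW sT) (CW1 sT)))
  (C1_closureZ (1 / 2) (C1_closureM Cz (C1_closureM (C1_closureM (CW sT) (CW sT)) (Cu1 sT)))).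
have CG := C1_closureB (C1_closureM Cz (C1_closureM (CW sT) (CW2 sT)))
  (C1_closureZ (1 / 2) (C1_closureM Cz (C1_closureM (C1_closureM (CW sT) (CW sT)) (Cu2 sT)))).
have := @green_formula_compact R Omega nu sigma oO nuP sigmaP smoothO _ _ _ _ _ _ 0 (2 * n) CF CG.
move=> /(_ _)/(green_formula_eq oO); apply.
- by move=> x bx; have [-> _] := u0 bx sT; ring.
- by move=> x bx; have [_ ->] := u0 bx sT; ring.
- move=> x Ox; rewrite eqW //.
  have -> : u22 (x, s) = - u11 (x, s) by have := divu Ox sT; lra.
  by field.
- by move=> x nb; rewrite (eta_off nb) !mul0r mulr0 subrr.
Qed.

Let h1 z := eta z.1 ^+ 2 * (W z * Wt z).
Let h2 z := eta z.1 ^+ 2 * (W1 z ^+ 2 + W2 z ^+ 2).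

Let continuous_eta : {within E, continuous (fun z : R * R * R => eta z.1)}.
Proof.
have [c _ _ _] := C1_closure_cutoff setT (0 : R * R) n.
apply: (@restriction_continuous_comp _ _ _ E (closure setT) fst _ _ c).
  by apply: continuous_subspaceT => z; exact: cvg_fst.
by move=> z _; rewrite closureT.
Qed.

Let ch1 : {within E, continuous h1}.
Proof.
apply: within_continuousM; last exact: within_continuousM.
by apply: within_continuousM; exact: continuous_eta.
Qed.

Let ch2 : {within E, continuous h2}.
Proof.
apply: within_continuousM; first by apply: within_continuousM; exact: continuous_eta.
by apply: within_continuousD; apply: within_continuousM.
Qed.

Let h_off z : ~ box 0 (2 * n) z.1 -> h1 z = 0 /\ h2 z = 0.
Proof. by move=> nb; rewrite /h1 /h2 (eta_off nb) expr0n !mul0r. Qed.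

Lemma integrable_slice (f : R * R * R -> R) (s r : R) : {within E, continuous f} -> 0 <= s < T ->
  (forall z, ~ box 0 r z.1 -> f z = 0) ->
  (leb2 : {measure set (mplane R) -> \bar R}).-integrable Omega (fun x => (f (x, s))%:E).
Proof.
move=> cf sT f0.
apply: (integrable_closure oO (slice_continuous cf sT) (c := 0) (r := r)).
by move=> x _ nb; exact: (f0 (x, s)).
Qed.

Lemma integrable_cylinder (f : R * R * R -> R) (s r : R) : {within E, continuous f} -> 0 < s < T ->
  (forall z, ~ box 0 r z.1 -> f z = 0) -> mu3.-integrable (Omega `*` `]0, s[) (EFin \o f).
Proof.
move=> cf /andP[s0 sT] f0.
pose K : set (R * R * R) := (closure Omega `&` box 0 r) `*` `[0, s].
have KE : K `<=` E.
  move=> z [[clz _]]; rewrite /= !in_itv /= => /andP[z0 zs]; split => //=.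
  by rewrite z0 (le_lt_trans zs).
have cK : compact K.
  apply: compact_setX; last exact: segment_compact.
  by apply: closed_compactI; [exact: closed_closure|exact: compact_box].
have [M M0 fM] := within_continuous_bounded (continuous_subspaceW KE cf) cK.
have sub : Omega `*` `]0, s[ `<=` E by exact: subcylinder_sub (ltW sT).
have mD : measurable (Omega `*` `]0, s[ : set (mplane R * measurableTypeR R)).
  by apply: measurableX; [exact: open_measurable2|exact: measurable_itv].
apply: (@integrable_bounded_support _ (mplane R * measurableTypeR R)%type R mu3
  (Omega `*` `]0, s[) (box 0 r `*` `[0, s]) f M) => //.
- by apply: measurableX; [exact: measurable_box|exact: measurable_itv].
- change (leb3 (box (0%R : R * R) r `*` `[0%R, s] : set (mplane R * measurableTypeR R)) < +oo)%E.
  rewrite product_measure1E //=; [|exact: measurable_box].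
  apply: lte_mul_pinfty => //; last by rewrite lebesgue_measure_itv /=; case: ifP; rewrite ltry.
  by rewrite ge0_fin_numE //; exact: leb2_box_fin.
- by apply: within_continuous_measurable3 => //; exact: continuous_subspaceW sub cf.
- move=> z [Oz _] [bz zs]; apply: fM; split => //.
  by split => //; exact: subset_closure.
- move=> z [_ zs] nK; apply: f0 => bz; apply: nK; split => //.
  by move: zs; rewrite /= !in_itv /= => /andP[/ltW -> /ltW ->].
Qed.

Lemma time_derivative_integral_at x s : Omega x -> 0 < s < T ->
  (\int[leb1]_(r in `]0%R, s[) (h1 (x, r))%:E =
   (eta x ^+ 2 * W (x, s) ^+ 2 / 2 - eta x ^+ 2 * W (x, 0) ^+ 2 / 2)%:E)%E.
Proof.
move=> Ox sT; have [s0 sT'] := andP sT.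
have cWx := time_slice_continuous cW (subset_closure Ox) sT'.
apply: (@integral_derivative_support R `]0, s[%classic
  (fun r => eta x ^+ 2 * W (x, r) ^+ 2 / 2) (fun r => h1 (x, r)) 0 s).
- exact: s0.
- apply: within_continuousM; last exact: within_continuous_cst.
  by apply: within_continuousM; [exact: within_continuous_cst|exact: within_continuousM].
- exact: time_slice_continuous ch1 (subset_closure Ox) sT'.
- move=> r /andP[r0 rs]; have rT : 0 < r < T by rewrite r0 (lt_trans rs).
  have D := dW Ox rT.
  have := is_deriveM (is_deriveM (is_derive_cst (eta x ^+ 2 / 2) r (1 : R)) D) D.
  rewrite (_ : _ * _ = fun r => eta x ^+ 2 * W (x, r) ^+ 2 / 2); last first.
    by apply/funext => r'; rewrite !fctE /cst; ring.
  by case=> dd ->; split => //; rewrite /h1 /GRing.scale /cst !fctE /=; field.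
- by [].
- by move=> r /=; rewrite in_itv /= => rs.
Qed.

(** By Fubini's theorem it is enough to apply the fundamental theorem of calculus
    on each line x = const, where W is continuous up to the initial time. *)
Lemma time_derivative_integral s : 0 < s < T ->
  (\int[leb1]_(r in `]0%R, s[) \int[leb2]_(x in Omega) (h1 (x, r))%:E =
   \int[leb2]_(x in Omega) (eta x ^+ 2 * W (x, s) ^+ 2 / 2 - eta x ^+ 2 * W (x, 0) ^+ 2 / 2)%:E)%E.
Proof.
move=> sT.
have i1 := integrable_cylinder ch1 sT (fun z nz => (h_off nz).1).
have mO : measurable (Omega : set (mplane R)) by exact: open_measurable2.
have [_ -> <-] := fubini_space_time mO (measurable_itv `]0, s[) i1.
by apply: eq_integral => x /[!inE] Ox; exact: time_derivative_integral_at.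
Qed.

Section remainder.
Variables (t L K dl : R).
Hypotheses (tT : t < T) (dl0 : 0 < dl) (L0 : 0 <= L)
  (uL : forall x s, Omega x -> 0 < s < t -> `|u1 (x, s)| <= L /\ `|u2 (x, s)| <= L)
  (WK : forall x s, Omega x -> n <= enorm x -> 0 < s < t -> Num.sqrt (enorm x) * `|W (x, s)| <= K).

(* a bound for the error terms at the points between box 0 n and box 0 (2 * n) *)
Let err : R := K ^+ 2 / n * (8 / (dl * n ^+ 2) + 4 * L / n).

(** The bound err times the area 4 (2 n)^2 of box 0 (2 * n).  It stays bounded as n
    grows because the decay W^2 <= K^2 / |x| is integrated against |grad zeta| = O(1/n)
    over an area O(n^2). *)
Definition remainder : R := K ^+ 2 * (128 / (dl * n) + 64 * L).

Lemma remainderE : remainder = err * (4 * (2 * n) ^+ 2).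
Proof.
by rewrite /remainder /err; field; rewrite ?gt_eqF.
Qed.

Lemma completed_square (a b : R) : - (b ^+ 2 / dl) <= dl * a ^+ 2 + 2 * a * b.
Proof.
rewrite -subr_ge0 (_ : _ - _ = dl * (a + b / dl) ^+ 2).
  by rewrite mulr_ge0 ?sqr_ge0 // ltW.
by field; rewrite gt_eqF.
Qed.

Lemma le_enorm x : `|x| <= enorm x :> R.
Proof.
rewrite prod_normE /= ge_max /enorm /dot -[`|x.1|]sqrtr_sqr -[`|x.2|]sqrtr_sqr.
by rewrite !ler_wsqrtr // -!expr2 ?lerDl ?lerDr ?sqr_ge0.
Qed.

Let err_ge0 : 0 <= err.
Proof.
have n0' := ltW n0; have dl0' := ltW dl0.
apply: mulr_ge0; first by apply: divr_ge0 => //; exact: sqr_ge0.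
by apply: addr_ge0; apply: divr_ge0 => //; apply: mulr_ge0 => //; exact: sqr_ge0.
Qed.

(** The square is completed with delta times the dissipation; the two error terms are
    zero on box 0 n, where the gradient of the cutoff vanishes, and off box 0 (2 * n). *)
Lemma energy_pointwise x s : Omega x -> 0 < s < t ->
  h1 (x, s) + (1 - dl) * h2 (x, s) <=
  (eta x ^+ 2 * (W (x, s) * Wt (x, s)) +
       eta x ^+ 2 * (W1 (x, s) ^+ 2 + W2 (x, s) ^+ 2) +
       2 * eta x * W (x, s) * (eta1 x * W1 (x, s) + eta2 x * W2 (x, s)) -
       eta x * W (x, s) ^+ 2 * (eta1 x * u1 (x, s) + eta2 x * u2 (x, s)))
  + err * \1_(box 0 (2 * n)) x.
Proof.
move=> Ox st; rewrite /h1 /h2 /= indicE.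
have [uL1 uL2] := uL Ox st.
have [bx|nbx] := pselect (box 0 (2 * n) x); last first.
  have [-> ->] := cutoff_gradient_eq0_far n0 nbx.
  by rewrite (eta_off nbx) memNset // expr0n /= !(mul0r, mulr0, addr0, subr0).
rewrite mem_set // mulr1.
have q : 0 <= eta x ^+ 2 * (W1 (x, s) ^+ 2 + W2 (x, s) ^+ 2).
  by rewrite mulr_ge0 ?addr_ge0 ?sqr_ge0.
have [bn|nbn] := pselect (box 0 n x).
  have [-> ->] := cutoff_gradient_eq0 n0 bn; have := err_ge0.
  have := mulr_ge0 (ltW dl0) q; lra.
have xn : n <= enorm x.
  by apply: le_trans (le_enorm x); move/negP: nbn; rewrite /box /= subr0 -ltNge => /ltW.
have W2n : W (x, s) ^+ 2 <= K ^+ 2 / n.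
  have WKx := WK Ox xn st.
  rewrite ler_pdivlMr //.
  have e0 : 0 <= enorm x by rewrite (le_trans (ltW n0)).
  apply: le_trans (_ : (Num.sqrt (enorm x) * `|W (x, s)|) ^+ 2 <= _).
    by rewrite exprMn sqr_sqrtr // real_normK ?num_real // mulrC ler_wpM2r // sqr_ge0.
  by rewrite lerXn2r // nnegrE ?mulr_ge0 ?sqrtr_ge0 // (le_trans _ WKx) // mulr_ge0 ?sqrtr_ge0.
have [g1 g2] := cutoff_gradient_bound 0 x n0.
have /andP[e0 e1] := cutoff_bounds 0 n x.
have sq (a b : R) : `|a| <= b -> a ^+ 2 <= b ^+ 2.
  by move=> ab; rewrite -real_normK ?num_real // lerXn2r // nnegrE // (le_trans _ ab).
have S1 := completed_square (eta x * W1 (x, s)) (W (x, s) * eta1 x).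
have S2 := completed_square (eta x * W2 (x, s)) (W (x, s) * eta2 x).
have P1 : (W (x, s) * eta1 x) ^+ 2 / dl + (W (x, s) * eta2 x) ^+ 2 / dl <= K ^+ 2 / n * (8 / (dl * n ^+ 2)).
  rewrite [(W (x, s) * eta1 x) ^+ 2]exprMn [(W (x, s) * eta2 x) ^+ 2]exprMn -mulrDl -mulrDr -mulrA ler_pM ?sqr_ge0 //.
    by apply: mulr_ge0; [rewrite addr_ge0 ?sqr_ge0|rewrite invr_ge0 ltW].
  rewrite (_ : 8 / (dl * n ^+ 2) = ((2 / n) ^+ 2 + (2 / n) ^+ 2) / dl); last first.
    by field; rewrite !gt_eqF.
  by rewrite ler_pM2r ?invr_gt0 // lerD // sq.
have P2 : eta x * W (x, s) ^+ 2 * (eta1 x * u1 (x, s) + eta2 x * u2 (x, s)) <= K ^+ 2 / n * (4 * L / n).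
  apply: le_trans (ler_norm _) _; rewrite normrM ler_pM //.
    rewrite normrM (ger0_norm e0) (ger0_norm (sqr_ge0 _)) -[leRHS]mul1r ler_pM // sqr_ge0 //.
  apply: le_trans (ler_normD _ _) _; rewrite (normrM (eta1 x)) (normrM (eta2 x)).
  have -> : 4 * L / n = 2 / n * L + 2 / n * L by ring.
  by rewrite lerD // ler_pM.
move: S1 S2 P1 P2; rewrite /err mulrDr.
lra.
Qed.

Hypothesis flux_int : (sigma \x leb1)%E.-integrable (boundary Omega `*` `]0, t[) (EFin \o flux).

Let mO : measurable (Omega : set (mplane R)). Proof. exact: open_measurable2. Qed.

Let mb : measurable (boundary Omega : set (mplane R)). Proof. exact: measurable_boundary. Qed.

Lemma slice_inequality s : 0 < s < t ->
  (\int[leb2]_(x in Omega) (h1 (x, s) + (1 - dl) * h2 (x, s))%:E <=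
   \int[sigma]_(x in boundary Omega) (eta x ^+ 2 * flux (x, s))%:E + remainder%:E)%E.
Proof.
move=> st; have [s0 s_t] := andP st.
have sT : 0 < s < T by rewrite s0 (lt_trans s_t).
have sT' : 0 <= s < T by rewrite ltW // (lt_trans s_t).
have [id iF EF] := slice_energy sT.
have ih : (leb2 : {measure set (mplane R) -> \bar R}).-integrable Omega
    (fun x => (h1 (x, s) + (1 - dl) * h2 (x, s))%:E).
  apply: (@integrable_slice (fun z => h1 z + (1 - dl) * h2 z) s (2 * n)) sT' _.
    apply: within_continuousD; first exact: ch1.
    by apply: within_continuousM; [exact: within_continuous_cst|exact: ch2].
  by move=> z nb; have [-> ->] := h_off nb; rewrite mulr0 addr0.
have mB := @measurable_box R 0 (2 * n).
have ib : (leb2 : {measure set (mplane R) -> \bar R}).-integrable Omega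
    (fun x => (err * \1_(box 0 (2 * n)) x)%:E).
  apply: (@integrable_bounded_support _ (mplane R) R leb2 Omega (box 0 (2 * n)) _ `|err|) => //.
  - exact: leb2_box_fin.
  - by apply: measurable_funM; [exact: measurable_cst|exact: measurable_indic].
  - by move=> x _ bx; rewrite indicE mem_set // mulr1.
  - by move=> x _ nb; rewrite indicE memNset // mulr0.
apply: (@le_trans _ _ (\int[leb2]_(x in Omega) ((eta x ^+ 2 * (W (x, s) * Wt (x, s)) +
       eta x ^+ 2 * (W1 (x, s) ^+ 2 + W2 (x, s) ^+ 2) +
       2 * eta x * W (x, s) * (eta1 x * W1 (x, s) + eta2 x * W2 (x, s)) -
       eta x * W (x, s) ^+ 2 * (eta1 x * u1 (x, s) + eta2 x * u2 (x, s)))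
       + err * \1_(box 0 (2 * n)) x)%:E)%E).
  apply: le_integral => //.
  - by have := integrableD mO id ib; apply: eq_integrable => // x _; rewrite /= EFinD.
  - by move=> x /[!inE] Ox; rewrite lee_fin; exact: energy_pointwise.
under eq_integral do rewrite EFinD.
rewrite (integralD mO id ib) EF; apply: leeD.
  rewrite le_eqVlt; apply/orP; left; apply/eqP; apply: eq_integral => x _.
  by congr EFin; rewrite /flux /=; ring.
under eq_integral do rewrite EFinM.
rewrite ge0_integralZl_EFin //=; do ?[by apply/measurable_EFinP; exact: measurable_indic].
rewrite integral_indic //.
have Lb : (leb2 (box (0%R : R * R) (2 * n) : set (mplane R)) = (4 * (2 * n) ^+ 2)%:E)%E.
  by apply: leb2_box; rewrite mulr_ge0 // ltW.
apply: (@le_trans _ _ (err%:E * leb2 (box (0%R : R * R) (2 * n) : set (mplane R)))%E).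
  apply: lee_wpmul2l; first by rewrite lee_fin.
  by apply: le_measure; rewrite ?inE //; exact: measurableI.
by rewrite Lb -EFinM remainderE.
Qed.

Lemma integrable_cutoff_flux : (sigma \x leb1)%E.-integrable (boundary Omega `*` `]0, t[)
  (fun z => (eta z.1 ^+ 2 * flux z)%:E).
Proof.
have mD : measurable (boundary Omega `*` `]0, t[ : set (mplane R * measurableTypeR R)).
  by apply: measurableX => //; exact: measurable_itv.
apply: le_integrable flux_int => //.
- apply/measurable_EFinP; apply: measurable_funM.
    apply: measurable_funTS; apply: measurable_funX.
    exact: (measurableT_comp (measurable_cutoff 0 n) (@measurable_fst _ _ (mplane R) (measurableTypeR R))).
  by apply/measurable_EFinP; exact: measurable_int flux_int.
- move=> z _; rewrite /= lee_fin normrM -[leRHS]mul1r ler_wpM2r // ger0_norm ?sqr_ge0 //.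
  by have /andP[e0 e1] := cutoff_bounds 0 n z.1; rewrite expr_le1.
Qed.

(** Integration of slice_inequality over ]0, s[: all the terms are finite here, since
    the cutoff has compact support, and can be moved from one side to the other. *)
Lemma local_energy_inequality s : 0 < s <= t ->
  (\int[leb2]_(x in Omega) (eta x ^+ 2 * W (x, s) ^+ 2 / 2)%:E
     + (1 - dl)%:E * \int[leb1]_(r in `]0%R, s[) \int[leb2]_(x in Omega)
         (eta x ^+ 2 * (W1 (x, r) ^+ 2 + W2 (x, r) ^+ 2))%:E <=
   \int[leb2]_(x in Omega) (eta x ^+ 2 * W (x, 0) ^+ 2 / 2)%:E
     + \int[leb1]_(r in `]0%R, s[) \int[sigma]_(x in boundary Omega) (eta x ^+ 2 * flux (x, r))%:E
     + (s * remainder)%:E)%E.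
Proof.
move=> /andP[s0 s_t].
have sT : 0 < s < T by rewrite s0 (le_lt_trans s_t).
have T0 : 0 < T by case/andP: sT => /lt_trans; apply.
have ms : measurable (`]0, s[%classic : set (measurableTypeR R)) by exact: measurable_itv.
have ce (r : R) : 0 <= r < T -> (leb2 : {measure set (mplane R) -> \bar R}).-integrable Omega
    (fun x => (eta x ^+ 2 * W (x, r) ^+ 2 / 2)%:E).
  move=> rT; apply: (@integrable_slice (fun z => eta z.1 ^+ 2 * W z ^+ 2 / 2) r (2 * n)) rT _.
    apply: within_continuousM; last exact: within_continuous_cst.
    by apply: within_continuousM; apply: within_continuousM => //; exact: continuous_eta.
  by move=> z nb; rewrite (eta_off nb) expr0n !mul0r.
have is_ : (leb2 : {measure set (mplane R) -> \bar R}).-integrable Omega _ := ce s _.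
have i0 := ce 0 _; rewrite lexx T0 in i0; have {}i0 := i0 isT.
have {}is_ := is_ ltac:(by case/andP: sT => /ltW -> ->).
have i1 := integrable_cylinder ch1 sT (fun z nz => (h_off nz).1).
have i2 := integrable_cylinder ch2 sT (fun z nz => (h_off nz).2).
have [j1 E1 _] := fubini_space_time mO ms i1.
have [j2 E2 _] := fubini_space_time mO ms i2.
have [as_ Eas] := integrable_real_value mO is_.
have [a0 Ea0] := integrable_real_value mO i0.
have [b Eb] := integrable_real_value ms j2.
have mbt : measurable (`]0, t[%classic : set (measurableTypeR R)) by exact: measurable_itv.
have [jf _] := @fubini_rectangle2 _ _ (mplane R) (measurableTypeR R) R sigma (@lebesgue_measure R)
  (boundary Omega) `]0, t[%classic mb mbt _ integrable_cutoff_flux.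
have {}jf : (@lebesgue_measure R).-integrable `]0, s[
   (fun r => (\int[sigma]_(x in boundary Omega) (eta x ^+ 2 * flux (x, r))%:E)%E).
  apply: integrableS jf => // r; rewrite /= !in_itv /= => /andP[-> rs].
  exact: lt_le_trans s_t.
have [c Ec] := integrable_real_value ms jf.
rewrite Eas Ea0 [X in (_%:E * X)%E]Eb Ec.
have H1 := time_derivative_integral sT.
have H1' : (\int[leb2]_(x in Omega) (eta x ^+ 2 * W (x, s) ^+ 2 / 2 - eta x ^+ 2 * W (x, 0) ^+ 2 / 2)%:E = (as_ - a0)%:E)%E.
  by rewrite EFinB -Eas -Ea0 -integralB //; apply: eq_integral => x _; rewrite EFinB.
have lebs : (@lebesgue_measure R `]0%R, s[%classic = s%:E)%E.
  by rewrite lebesgue_measure_itv /= lte_fin s0 oppr0 adde0.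
have ir : (@lebesgue_measure R).-integrable `]0, s[ (cst remainder%:E).
  apply: (@integrable_bounded_support _ (measurableTypeR R) R (@lebesgue_measure R)
    `]0, s[%classic `]0, s[%classic (fun=> remainder) `|remainder|) => //.
  exact: (eq_ind_r (fun y => (y < +oo)%E) (ltry s) lebs).
have M : (\int[leb1]_(r in `]0%R, s[) (\int[leb2]_(x in Omega) (h1 (x, r))%:E + (1 - dl)%:E * \int[leb2]_(x in Omega) (h2 (x, r))%:E) <=
   \int[leb1]_(r in `]0%R, s[) (\int[sigma]_(x in boundary Omega) (eta x ^+ 2 * flux (x, r))%:E + remainder%:E))%E.
  apply: le_integral => //.
  - by apply: integrableD => //; exact: integrableZl.
  - by apply: integrableD.
  - move=> r /[!inE]; rewrite /= in_itv /= => /andP[r0 rs].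
    have rt : 0 < r < t by rewrite r0 (lt_le_trans rs).
    apply: le_trans (slice_inequality rt).
    have rT : 0 <= r < T by rewrite ltW // (lt_le_trans rs) // ltW //; case/andP: sT.
    have k1 := integrable_slice ch1 rT (fun z nz => (h_off nz).1).
    have k2 := integrable_slice ch2 rT (fun z nz => (h_off nz).2).
    under [leRHS]eq_integral do rewrite EFinD EFinM.
    by rewrite (integralD mO k1 (integrableZl mO _ k2)) (integralZl mO k2).
move: M; rewrite (integralD ms j1 (integrableZl ms _ j2)) (integralZl ms j2) (integralD ms jf ir).
have Er : (\int[leb1]_(x in `]0%R, s[) cst remainder%:E x = (s * remainder)%:E)%E.
  rewrite mulrC (EFinM remainder); apply: etrans (integral_cst _ ms _) _.
  exact: (congr1 (fun y => remainder%:E * y)%E lebs).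
rewrite H1 H1' Eb Ec Er -!EFinM -!EFinD !lee_fin; lra.
Qed.

End remainder.
End cutoff.

Section limit.
Variables (t L : R).
Hypotheses (t0 : 0 < t) (tT : t < T) (L0 : 0 <= L)
  (uL : forall x s, Omega x -> 0 < s < t -> `|u1 (x, s)| <= L /\ `|u2 (x, s)| <= L).
Hypothesis flux_int : (sigma \x leb1)%E.-integrable (boundary Omega `*` `]0, t[) (EFin \o flux).

Let mO : measurable (Omega : set (mplane R)). Proof. exact: open_measurable2. Qed.

Let mb : measurable (boundary Omega : set (mplane R)). Proof. exact: measurable_boundary. Qed.

Let mt (s : R) : measurable (`]0, s[%classic : set (measurableTypeR R)).
Proof. exact: measurable_itv. Qed.

Definition cutoff_flux (n s : R) : \bar R :=
  (\int[leb1]_(r in `]0%R, s[) \int[sigma]_(x in boundary Omega) (cutoff 0 n x ^+ 2 * flux (x, r))%:E)%E.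

Lemma cutoff_fluxE n s : 0 < n -> 0 < s <= t -> cutoff_flux n s =
  (\int[sigma \x leb1]_(z in boundary Omega `*` `]0%R, s[) (cutoff 0 n z.1 ^+ 2 * flux z)%:E)%E /\
  (sigma \x leb1)%E.-integrable (boundary Omega `*` `]0, s[) (fun z => (cutoff 0 n z.1 ^+ 2 * flux z)%:E).
Proof.
move=> n0 /andP[s0 st].
have i : (sigma \x leb1)%E.-integrable (boundary Omega `*` `]0, s[)
    (fun z => (cutoff 0 n z.1 ^+ 2 * flux z)%:E).
  apply: integrableS (integrable_cutoff_flux n flux_int); [exact: measurableX..|].
  move=> z [bz zs]; split => //; move: zs; rewrite /= !in_itv /= => /andP[-> zs].
  exact: lt_le_trans st.
split => //.
by have [_] := @fubini_rectangle2 _ _ (mplane R) (measurableTypeR R) R sigma (@lebesgue_measure R)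
  (boundary Omega) `]0, s[%classic mb (mt s) _ i.
Qed.

(** A bound uniform in n and s, for the energy at times s < t: the sign of the flux is
    given at the time t only. *)
Lemma cutoff_flux_le n s : 0 < n -> 0 < s <= t -> (cutoff_flux n s <=
  \int[sigma \x leb1]_(z in boundary Omega `*` `]0%R, t[) `|(flux z)%:E|)%E.
Proof.
move=> n0 st; have [-> i] := cutoff_fluxE n0 st; have [s0 s_t] := andP st.
have mbs r : measurable (boundary Omega `*` `]0, r[ : set (mplane R * measurableTypeR R)).
  exact: measurableX.
have sub : boundary Omega `*` `]0, s[ `<=` boundary Omega `*` `]0, t[.
  move=> z [bz zs]; split => //; move: zs; rewrite /= !in_itv /= => /andP[-> zs].
  exact: lt_le_trans s_t.
apply: (@le_trans _ _ (\int[sigma \x leb1]_(z in boundary Omega `*` `]0%R, s[) `|(flux z)%:E|)%E).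
  apply: le_integral => //.
    by apply: integrable_abse; exact: integrableS flux_int.
  move=> z _; rewrite /= lee_fin; apply: le_trans (ler_norm _) _.
  rewrite normrM -[leRHS]mul1r ler_wpM2r // ger0_norm ?sqr_ge0 //.
  by have /andP[e0 e1] := cutoff_bounds 0 n z.1; rewrite expr_le1.
apply: ge0_subset_integral => //.
by apply: measurableT_comp => //; exact: measurable_int flux_int.
Qed.

Lemma cutoff_flux_cvg : cutoff_flux k.+1%:R t @[k --> \oo] -->
  (\int[leb1]_(s in `]0%R, t[) \int[sigma]_(x in boundary Omega) (flux (x, s))%:E)%E.
Proof.
have tt : 0 < t <= t by rewrite t0 lexx.
have mbt : measurable (boundary Omega `*` `]0, t[ : set (mplane R * measurableTypeR R)).
  exact: measurableX.
have [_ ->] := @fubini_rectangle2 _ _ (mplane R) (measurableTypeR R) R sigma (@lebesgue_measure R)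
  (boundary Omega) `]0, t[%classic mb (mt t) _ flux_int.
have kpos (k : nat) : 0 < k.+1%:R :> R by [].
rewrite (_ : (fun k => cutoff_flux k.+1%:R t) = (fun k : nat => \int[sigma \x leb1]_(z in boundary Omega `*` `]0%R, t[)
   (cutoff 0 k.+1%:R z.1 ^+ 2 * flux z)%:E)%E); last first.
  by apply/funext => k; have [] := cutoff_fluxE (kpos k) tt.
have ii k := (cutoff_fluxE (kpos k) tt).2.
have [|||||_ _] := @dominated_convergence _ _ R (sigma \x leb1)%E _ mbt
  (fun k z => (cutoff 0 k.+1%:R z.1 ^+ 2 * flux z)%:E) (EFin \o flux) (abse \o (EFin \o flux)).
- by move=> k; exact: measurable_int (ii k).
- exact: measurable_int flux_int.
- apply: aeW => z _; apply: cvg_near_cst; near=> k.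
  rewrite cutoff_eq1 ?expr1n ?mul1r // /box /= subr0.
  apply: le_trans (ltW (truncnS_gt _)) _; rewrite ler_nat ltnS.
  by near: k; exact: nbhs_infty_ge.
- exact: integrable_abse.
- apply: aeW => z k _; rewrite /= lee_fin normrM -[leRHS]mul1r ler_wpM2r // ger0_norm ?sqr_ge0 //.
  by have /andP[e0 e1] := cutoff_bounds 0 k.+1%:R z.1; rewrite expr_le1.
by [].
Unshelve. all: by end_near. Qed.

(** On box 0 m the cutoff of any larger scale n is 1; thus the left-hand side does not
    depend on n and survives the limit. *)
Lemma exhausted_energy (K dl m n s : R) :
  (forall x s, Omega x -> n <= enorm x -> 0 < s < t -> Num.sqrt (enorm x) * `|W (x, s)| <= K) ->
  0 < dl -> dl <= 1 -> 0 < n -> m <= n -> 0 < s <= t ->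
  (\int[leb2]_(x in Omega `&` box 0%R m) (W (x, s) ^+ 2 / 2)%:E
     + \int[leb3]_(z in (Omega `&` box 0%R m) `*` `]0%R, s[)
         ((1 - dl) * (W1 z ^+ 2 + W2 z ^+ 2))%:E <=
   \int[leb2]_(x in Omega) (W (x, 0) ^+ 2 / 2)%:E + cutoff_flux n s
     + (s * remainder n L K dl)%:E)%E.
Proof.
move=> WK dl0 dl1 n0 mn st; have [s0 s_t] := andP st.
set F0 := (\int[leb2]_(x in Omega) (W (x, 0) ^+ 2 / 2)%:E)%E.
pose Q := Omega `*` `]0, s[ : set (mplane R * measurableTypeR R).
have sT : s < T by exact: le_lt_trans s_t tT.
have subE : Q `<=` E by exact: subcylinder_sub (ltW sT).
have mD3 : measurable Q by exact: measurableX.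
have mW1 : measurable_fun Q W1.
  by apply: within_continuous_measurable3 => //; exact: continuous_subspaceW subE cW1.
have mW2 : measurable_fun Q W2.
  by apply: within_continuous_measurable3 => //; exact: continuous_subspaceW subE cW2.
have mWs (r : R) : 0 <= r < T -> measurable_fun (Omega : set (mplane R)) (fun x => W (x, r)).
  move=> rT; apply: within_continuous_measurable2 => //.
  exact: continuous_subspaceW (@subset_closure _ _) (slice_continuous cW rT).
have me := @measurable_cutoff R 0 n.
have me3 : measurable_fun setT (fun z : mplane R * measurableTypeR R => cutoff (0 : R * R) n z.1).
  exact: (measurableT_comp me (@measurable_fst _ _ (mplane R) (measurableTypeR R))).
have mh2 : measurable_fun Q (fun z => cutoff 0 n z.1 ^+ 2 * (W1 z ^+ 2 + W2 z ^+ 2)).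
  apply: measurable_funM; first by apply: measurable_funX; exact: measurable_funTS.
  by apply: measurable_funD; exact: measurable_funX.
have mB := @measurable_box R 0 m.
have h2_ge0 z : 0 <= cutoff 0 n z.1 ^+ 2 * (W1 z ^+ 2 + W2 z ^+ 2).
  by rewrite mulr_ge0 ?addr_ge0 ?sqr_ge0.
have cut1 x : box 0 m x -> cutoff 0 n x = 1.
  by move=> bx; apply: cutoff_eq1 => //; rewrite /box /= (le_trans bx).
have H := @local_energy_inequality n n0 t L K dl tT dl0 L0 uL WK flux_int s st.
apply: le_trans (le_trans _ H) _; last first.
  apply: leeD => //; apply: leeD => //; apply: ge0_le_integral => //.
  - by move=> x _; rewrite lee_fin; apply: divr_ge0 => //; apply: mulr_ge0; exact: sqr_ge0.
  - apply/measurable_EFinP; apply: measurable_funM => //; apply: measurable_funM.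
      by apply: measurable_funX; exact: measurable_funTS.
    by apply: measurable_funX; apply: mWs; rewrite lexx (lt_trans s0).
  - apply/measurable_EFinP; apply: measurable_funM => //.
    by apply: measurable_funX; apply: mWs; rewrite lexx (lt_trans s0).
  - move=> x _; rewrite lee_fin ler_pM2r // -[leRHS]mul1r ler_wpM2r ?sqr_ge0 //.
    by have /andP[e0 e1] := cutoff_bounds 0 n x; rewrite expr_le1.
apply: leeD.
  apply: (@le_trans _ _ (\int[leb2]_(x in Omega `&` box 0%R m)
      (cutoff 0 n x ^+ 2 * W (x, s) ^+ 2 / 2)%:E)%E).
    rewrite le_eqVlt; apply/orP; left; apply/eqP; apply: eq_integral => x /[!inE] -[_ bx].
    by rewrite cut1 // expr1n mul1r.
  apply: ge0_subset_integral => //; first exact: measurableI.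
    apply/measurable_EFinP; apply: measurable_funM => //; apply: measurable_funM.
      by apply: measurable_funX; exact: measurable_funTS.
    by apply: measurable_funX; apply: mWs; rewrite ltW.
  by move=> x _; rewrite lee_fin; apply: divr_ge0 => //; apply: mulr_ge0; exact: sqr_ge0.
have [_ ->] := tonelli_space_time mO (mt s) mh2 h2_ge0.
have mA3 : measurable ((Omega `&` box 0 m) `*` `]0, s[ : set (mplane R * measurableTypeR R)).
  by apply: measurableX => //; exact: measurableI.
apply: (@le_trans _ _ ((1 - dl)%:E * \int[leb3]_(z in (Omega `&` box 0%R m) `*` `]0%R, s[)
  (cutoff 0 n z.1 ^+ 2 * (W1 z ^+ 2 + W2 z ^+ 2))%:E)%E).
  rewrite -ge0_integralZl_EFin //.
  - rewrite le_eqVlt; apply/orP; left; apply/eqP; apply: eq_integral => z /[!inE] -[[_ bz] _].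
    by rewrite cut1 // expr1n mul1r.
  - by move=> z _; rewrite lee_fin.
  - apply/measurable_EFinP; apply: measurable_funS mh2 => //.
    by move=> z [[Oz _] zs].
  - by rewrite subr_ge0.
apply: lee_wpmul2l; first by rewrite lee_fin subr_ge0.
apply: ge0_subset_integral => //.
- by apply/measurable_EFinP; exact: mh2.
- by move=> z _; rewrite lee_fin.
- by move=> z [[Oz _] zs].
Qed.

Lemma cylinder_exhaustion (s : R) :
  [/\ nondecreasing_seq (fun m : nat => Omega `&` box 0 m%:R),
      nondecreasing_seq (fun m : nat => (Omega `&` box 0 m%:R) `*` (`]0, s[ : set R)),
      \bigcup_m (Omega `&` box 0 m%:R) = Omega &
      \bigcup_m ((Omega `&` box 0 m%:R) `*` (`]0, s[ : set R)) = Omega `*` `]0, s[].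
Proof.
have nd (k m : nat) : (k <= m)%N -> Omega `&` box 0 k%:R `<=` Omega `&` box 0 m%:R.
  by move=> km x [Ox bx]; split => //; apply: le_trans bx _; rewrite ler_nat.
have cov x : box 0 (Num.truncn `|x|).+1%:R x.
  by rewrite /box /= subr0 ltW // truncnS_gt.
split.
- by move=> k m km; apply/subsetPset; exact: nd.
- by move=> k m km; apply/subsetPset => z [/(nd _ _ km) ? ?]; split.
- apply/seteqP; split => [x [m _ []]//|x Ox].
  by exists (Num.truncn `|x|).+1.
- apply/seteqP; split => [z [m _ [[? _] ?]]//|z [Oz zs]].
  by exists (Num.truncn `|z.1|).+1.
Qed.

(** Both integrands are nonnegative and the squares exhaust the plane: monotone
    convergence. *)
Lemma exhaustion_energy (dl s : R) (c : \bar R) : dl <= 1 -> 0 < s < T ->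
  (forall m : nat,
    \int[leb2]_(x in Omega `&` box 0%R m%:R) (W (x, s) ^+ 2 / 2)%:E
      + \int[leb3]_(z in (Omega `&` box 0%R m%:R) `*` `]0%R, s[)
          ((1 - dl) * (W1 z ^+ 2 + W2 z ^+ 2))%:E <= c)%E ->
  (\int[leb2]_(x in Omega) (W (x, s) ^+ 2 / 2)%:E
      + (1 - dl)%:E * \int[leb3]_(z in Omega `*` `]0%R, s[) (W1 z ^+ 2 + W2 z ^+ 2)%:E <= c)%E.
Proof.
move=> dl1 /andP[s0 sT] H.
have subE : Omega `*` `]0, s[ `<=` E by exact: subcylinder_sub (ltW sT).
have mD3 : measurable (Omega `*` `]0, s[ : set (mplane R * measurableTypeR R)) by exact: measurableX.
have mG : measurable_fun (Omega `*` `]0, s[ : set (mplane R * measurableTypeR R))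
    (fun z => W1 z ^+ 2 + W2 z ^+ 2).
  apply: measurable_funD; apply: measurable_funX; apply: within_continuous_measurable3 => //.
    exact: continuous_subspaceW subE cW1.
  exact: continuous_subspaceW subE cW2.
have [nA nB UA UB] := cylinder_exhaustion s.
rewrite -ge0_integralZl_EFin //; last 3 first.
- by move=> z _; rewrite lee_fin addr_ge0 ?sqr_ge0.
- exact/measurable_EFinP.
- by rewrite subr_ge0.
have := @exhaustion_le _ _ (mplane R) (mplane R * measurableTypeR R)%type R leb2 leb3
  (fun m : nat => Omega `&` box 0%R m%:R) (fun m : nat => (Omega `&` box 0%R m%:R) `*` `]0%R, s[)
  (fun x => (W (x, s) ^+ 2 / 2)%:E) (fun z => ((1 - dl)%:E * (W1 z ^+ 2 + W2 z ^+ 2)%:E)%E) c nA nB.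
have mb0 m : measurable (box 0%R m%:R : set (mplane R)) := @measurable_box R 0 m%:R.
rewrite UA UB; apply=> //.
- by move=> m; exact: measurableI.
- by move=> m; apply: measurableX => //; exact: measurableI.
- apply/measurable_EFinP; apply: measurable_funM => //; apply: measurable_funX.
  apply: within_continuous_measurable2 => //.
  by apply: continuous_subspaceW (@subset_closure _ _) (slice_continuous cW _); rewrite ltW.
- by apply/measurable_EFinP; apply: measurable_funM.
- by move=> x; rewrite lee_fin divr_ge0 ?sqr_ge0.
- by move=> z; rewrite -EFinM lee_fin; apply: mulr_ge0; [rewrite subr_ge0|rewrite addr_ge0 ?sqr_ge0].
Qed.

Definition decay_bound (K : R) : Prop := exists r : R, forall x s, Omega x -> r <= enorm x ->
  0 < s < t -> Num.sqrt (enorm x) * `|W (x, s)| <= K.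

Let A0 := (\int[leb2]_(x in Omega) (W (x, 0) ^+ 2 / 2)%:E)%E.
Let G := (\int[leb3]_(z in Omega `*` `]0%R, t[) (W1 z ^+ 2 + W2 z ^+ 2)%:E)%E.

Hypothesis A0_fin : (A0 < +oo)%E.

Let A0E : A0 \is a fin_num.
Proof. by rewrite ge0_fin_numE // integral_ge0 // => x _; rewrite lee_fin divr_ge0 ?sqr_ge0. Qed.

(** Take delta = 1, which discards the dissipation. *)
Lemma slice_energy_bound (K : R) : decay_bound K ->
  exists C : R, forall s, 0 < s < t -> (\int[leb2]_(x in Omega) (W (x, s) ^+ 2 / 2)%:E <= C%:E)%E.
Proof.
move=> [r WK].
have mbt : measurable (boundary Omega `*` `]0, t[ : set (mplane R * measurableTypeR R)).
  exact: measurableX.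
pose B := (\int[sigma \x leb1]_(z in boundary Omega `*` `]0%R, t[) `|(flux z)%:E|)%E.
have [b bE] := integrable_real_value mbt (integrable_abse flux_int).
have BE : B = b%:E by exact: bE.
exists (fine A0 + b + t * (K ^+ 2 * (128 + 64 * L))) => s st; have [s0 s_t] := andP st.
have st' : 0 < s <= t by rewrite s0 ltW.
have := @exhaustion_energy 1 s (fine A0 + b + t * (K ^+ 2 * (128 + 64 * L)))%:E (lexx _).
rewrite subrr mul0e adde0; apply; first by rewrite s0 (lt_trans s_t).
move=> m; pose n := Num.max (Num.max r m%:R) 1.
have n1 : 1 <= n by rewrite le_max lexx orbT.
have n0 : 0 < n by exact: lt_le_trans ltr01 n1.
have rn : r <= n by rewrite !le_max lexx.
have mn : m%:R <= n by rewrite !le_max lexx orbT.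
have := @exhausted_energy K 1 m%:R n s (fun x s Ox nx => WK x s Ox (le_trans rn nx))
  ltr01 (lexx _) n0 mn st'.
rewrite subrr => /le_trans; apply.
rewrite 2!EFinD fineK //; apply: leeD; last first.
  rewrite lee_fin; apply: ler_pM; [exact: ltW| |exact: ltW|].
    rewrite /remainder; apply: mulr_ge0; first exact: sqr_ge0.
    by apply: addr_ge0; [apply: divr_ge0; rewrite ?mul1r ?(ltW n0)|apply: mulr_ge0].
  rewrite /remainder ler_wpM2l ?sqr_ge0 // lerD2r mul1r ler_pdivrMr //; lra.
by apply: leeD => //; rewrite -BE; exact: cutoff_flux_le.
Qed.

Hypothesis flux_le0 :
  (\int[leb1]_(s in `]0%R, t[) \int[sigma]_(x in boundary Omega) (flux (x, s))%:E <= 0)%E.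

Lemma remainder_cvg (K dl : R) : 0 < dl ->
  remainder k.+1%:R L K dl @[k --> \oo] --> K ^+ 2 * (64 * L).
Proof.
move=> dl0.
have H : K ^+ 2 * (128 / dl * @harmonic R k + 64 * L) @[k --> \oo] --> K ^+ 2 * (128 / dl * 0 + 64 * L).
  by apply: cvgMr; apply: cvgD; [apply: cvgMr; exact: cvg_harmonic|exact: cvg_cst].
rewrite mulr0 add0r in H; apply: cvg_trans H; apply: near_eq_cvg; near=> k.
rewrite /remainder /harmonic /=.
have k0 : (k.+1%:R : R) != 0 by rewrite pnatr_eq0.
by move: (k.+1%:R : R) k0 => y y0; field; rewrite y0 gt_eqF.
Unshelve. all: by end_near. Qed.

(** The limit n -> oo at fixed delta: the cutoff flux converges to the full flux, which
    is nonpositive. *)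
Lemma global_energy_slack (K dl : R) : decay_bound K -> 0 < dl -> dl <= 1 ->
  (\int[leb2]_(x in Omega) (W (x, t) ^+ 2 / 2)%:E + (1 - dl)%:E * G <=
   A0 + (t * (K ^+ 2 * (64 * L)))%:E)%E.
Proof.
move=> [r WK] dl0 dl1; apply: exhaustion_energy => //; first by rewrite t0.
move=> m.
have tt : 0 < t <= t by rewrite t0 lexx.
set X := (X in (X <= _)%E).
set Fl := (\int[leb1]_(s in `]0%R, t[) \int[sigma]_(x in boundary Omega) (flux (x, s))%:E)%E.
have FlE : Fl \is a fin_num.
  have mbt : measurable (boundary Omega `*` `]0, t[ : set (mplane R * measurableTypeR R)).
    exact: measurableX.
  have [_] := @fubini_rectangle2 _ _ (mplane R) (measurableTypeR R) R sigma (@lebesgue_measure R)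
    (boundary Omega) `]0, t[%classic mb (mt t) _ flux_int.
  by rewrite /Fl => ->; exact: integrable_fin_num.
have c1 : (A0 + cutoff_flux k.+1%:R t + (t * remainder k.+1%:R L K dl)%:E)%E @[k --> \oo] -->
    (A0 + Fl + (t * (K ^+ 2 * (64 * L)))%:E)%E.
  apply: cvgeD; first by rewrite fin_num_adde_defl.
    apply: cvgeD; first by rewrite fin_num_adde_defl.
      exact: cvg_cst.
    exact: cutoff_flux_cvg.
  by apply: cvg_EFin; [exact: nearW|apply: cvgMr; exact: remainder_cvg].
apply: (@le_trans _ _ (A0 + Fl + (t * (K ^+ 2 * (64 * L)))%:E)%E); last first.
  by apply: leeD => //; rewrite -[leRHS]adde0; apply: leeD.
have cX : closed [set y | (X <= y)%E] by exact: closed_ereal_le_ereal.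
apply: (closed_cvg _ cX _ _ c1).
near=> k; apply: exhausted_energy => //.
- move=> x s Ox kx; apply: WK => //; apply: le_trans kx.
  apply: le_trans (ler_norm _) _; apply: le_trans (ltW (truncnS_gt _)) _; rewrite ler_nat ltnS.
  by near: k; exact: nbhs_infty_ge.
- by rewrite ler_nat; apply: leqW; near: k; exact: nbhs_infty_ge.
Unshelve. all: by end_near. Qed.

(** The limit delta -> 0.  Before it can be taken, the dissipation has to be known to
    be finite: this follows from the case delta = 1 / 2. *)
Theorem global_energy (eps : R) : 0 <= eps -> (forall d, 0 < d -> decay_bound (eps + d)) ->
  (\int[leb2]_(x in Omega) (W (x, t) ^+ 2 / 2)%:E + G <=
   A0 + (t * (64 * L) * eps ^+ 2)%:E)%E /\ (G < +oo)%E.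
Proof.
move=> eps0 dec.
have X0 : (0 <= \int[leb2]_(x in Omega) (W (x, t) ^+ 2 / 2)%:E)%E.
  by apply: integral_ge0 => x _; rewrite lee_fin divr_ge0 ?sqr_ge0.
have G0 : (0 <= G)%E by apply: integral_ge0 => z _; rewrite lee_fin addr_ge0 ?sqr_ge0.
pose a := fine A0; have aE : A0 = a%:E by rewrite fineK.
have Hd d : 0 < d -> d <= 1 -> (\int[leb2]_(x in Omega) (W (x, t) ^+ 2 / 2)%:E + (1 - d)%:E * G <=
   (a + t * ((eps + d) ^+ 2 * (64 * L)))%:E)%E.
  by move=> d0 d1; rewrite (EFinD a) -aE; apply: global_energy_slack => //; exact: dec.
have [x xE] : exists x : R, (\int[leb2]_(x in Omega) (W (x, t) ^+ 2 / 2)%:E = x%:E)%E.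
  exists (fine (\int[leb2]_(x in Omega) (W (x, t) ^+ 2 / 2)%:E)%E); rewrite fineK //.
  rewrite ge0_fin_numE //; apply: le_lt_trans (ltry _).
  have := Hd 1 ltr01 (lexx _); rewrite subrr mul0e adde0; exact.
have [g gE] : exists g : R, G = g%:E.
  exists (fine G); rewrite fineK // ge0_fin_numE //.
  have h0 : 0 < (1 / 2 : R) by lra.
  have := Hd (1 / 2) h0 ltac:(lra).
  case: (G) G0 => [g _ _||//]; first by rewrite ltry.
  move=> _; rewrite xE gt0_muley ?lte_fin; last lra.
  by rewrite addey.
rewrite xE gE aE; split; last by rewrite ltry.
rewrite -!EFinD lee_fin.
move: G0; rewrite gE lee_fin => g0.
apply/ler_addgt0Pr => e e0.
pose q := g + t * (64 * L) * (2 * eps + 1) + 1.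
have q0 : 0 < q.
  rewrite ltr_wpDl // addr_ge0 // !mulr_ge0 // ?addr_ge0 ?mulr_ge0 // ltW //.
have q1 : 0 < Num.min 1 (e / q) by rewrite lt_min ltr01 divr_gt0.
have := Hd _ q1; rewrite ge_min lexx => /(_ isT).
set d := Num.min _ _ in q1 *; rewrite xE gE -EFinM -EFinD lee_fin.
have dq : d * q <= e by rewrite -ler_pdivlMr // /d ge_min lexx orbT.
have d1 : d <= 1 by rewrite /d ge_min lexx.
have tL : 0 <= t * (64 * L) by rewrite !mulr_ge0 // ltW.
have d2 : t * (64 * L) * d ^+ 2 <= t * (64 * L) * d.
  by rewrite ler_wpM2l // expr2 ler_piMl // ltW.
by rewrite /q in dq; nra.
Qed.

End limit.
End energy.

(** * Norms *)

Section norms.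
Context {R : realType}.
Implicit Types (Omega : set (R * R)).
Local Notation mu3 := (leb3 : {measure set (mplane R * measurableTypeR R) -> \bar R}).

Lemma poweR2 (x : \bar R) : (0 <= x -> x `^ 2 = x ^+ 2)%E.
Proof.
case: x => [r||]; last by rewrite leNgt ltNy0.
  by rewrite lee_fin => r0; rewrite poweR_EFin powR_mulrn // EFin_expe.
by move=> _; rewrite poweRyr ?pnatr_eq0 // expe2 mulyy.
Qed.

Lemma L2_square d (T : measurableType d) (mu : {measure set T -> \bar R}) (D : set T) (f : T -> \bar R) :
  measurable D ->
  ('N[mu]_(2%:E)[f \_ D] ^+ 2 = \int[mu]_(x in D) `|f x| ^+ 2)%E.
Proof.
move=> mD; rewrite -poweR2 ?Lnorm_ge0 // poweR_Lnorm ?pnatr_eq0 //.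
rewrite [RHS]integral_mkcond; apply: eq_integral => x _.
rewrite !patchE; case: ifPn => _; first exact: poweR2.
by rewrite (_ : point = 0%E) // abse0 poweR0r // pnatr_eq0.
Qed.

Lemma L2norm_square Omega (f : R * R -> R) : open Omega ->
  (L2norm Omega f ^+ 2 = \int[leb2]_(x in Omega) (f x ^+ 2)%:E)%E.
Proof.
move=> oO; rewrite /L2norm L2_square; last exact: open_measurable2.
by apply: eq_integral => x _; change (`|f x|%:E ^+ 2 = (f x ^+ 2)%:E)%E;
  rewrite -EFin_expe real_normK ?num_real.
Qed.

Lemma L2norm_ge0 Omega (f : R * R -> R) : (0 <= L2norm Omega f)%E.
Proof. exact: Lnorm_ge0. Qed.

Lemma lty_square (x : \bar R) : (x ^+ 2 < +oo -> 0 <= x -> x < +oo)%E.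
Proof. by case: x => // r _ _; exact: ltry. Qed.

Lemma le_square_bound (x : \bar R) (c : R) : (x ^+ 2 <= c%:E -> 0 <= x -> x <= (1 + c)%:E)%E.
Proof.
move=> h x0; have xf : x \is a fin_num.
  by rewrite ge0_fin_numE // lty_square // (le_lt_trans h (ltry c)).
by move: h x0; rewrite -(fineK xf) -EFin_expe !lee_fin => r2 r0; nra.
Qed.

Lemma leb3_ball_gt0 (z : R * R * R) (e : R) : 0 < e ->
  (0 < leb3 (ball z e : set (mplane R * measurableTypeR R)))%E.
Proof.
move=> e0.
have h0 : 0 < e / 2 by lra.
pose Q : set (R * R * R) := box z.1 (e / 2) `*` `[z.2 - e / 2, z.2 + e / 2].
have mQ : measurable (Q : set (mplane R * measurableTypeR R)).
  by apply: measurableX; [exact: measurable_box|exact: measurable_itv].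
apply: (@lt_le_trans _ _ (leb3 (Q : set (mplane R * measurableTypeR R)))).
  rewrite product_measure1E //=; [|exact: measurable_box].
  rewrite leb2_box ?ltW // lebesgue_measure_itv /= lte_fin ltrD2l gtrN //.
  by rewrite -EFinB -EFinM lte_fin; apply: mulr_gt0; [rewrite mulr_gt0 // exprn_gt0|lra].
apply: le_measure; rewrite ?inE //; first by apply: open_measurable3; exact: ball_open.
move=> y [by1]; rewrite /= in_itv /= => /andP[y1 y2].
rewrite -ball_normE /= prod_normE /= gt_max; apply/andP; split.
  by rewrite distrC; apply: le_lt_trans by1 _; lra.
by apply: (@le_lt_trans _ _ (e / 2)); [rewrite ler_norml; apply/andP; split; lra|lra].
Qed.

(** Nonempty open sets have positive measure, so that an almost everywhere
    bound on a continuous function holds everywhere. *)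
Lemma ae_continuous_le (D : set (R * R * R)) (f g : R * R * R -> R) (L : R) : open D ->
  (\forall z \ae mu3, D z -> g z <= L) -> (forall z, D z -> f z <= g z) ->
  (forall z, D z -> {for z, continuous f}) -> forall z, D z -> f z <= L.
Proof.
move=> oD [N [mN N0 sub]] fg cf z Dz; rewrite leNgt; apply/negP => Lf.
have n1 : nbhs z (fun y => L < f y).
  by apply: (cf z Dz (fun y => L < y)); apply: open_nbhs_nbhs; split => //; exact: open_gt.
have n2 : nbhs z D by exact: open_nbhs_nbhs.
have nn : nbhs z ((fun y => L < f y) `&` D) by apply: filterI.
move/nbhs_ballP: nn => [e /= e0 be].
have := leb3_ball_gt0 z e0; rewrite ltNge => /negP; apply.
rewrite -N0; apply: le_measure; rewrite ?inE //; first by apply: open_measurable3; exact: ball_open.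
move=> y /be[Ly Dy]; apply: sub => /= /(_ Dy); rewrite leNgt (lt_le_trans Ly) //; exact: fg.
Qed.

Lemma abs_le_enorm (x : R * R) : `|x.1| <= enorm x /\ `|x.2| <= enorm x.
Proof.
by have := le_enorm x; rewrite prod_normE /= ge_max => /andP[].
Qed.

(** The essential supremum controls every value of v in the open cylinder, by
    continuity. *)
Lemma Linfty_norm_bound Omega (T t : R) (v : R * R * R -> R * R) : open Omega -> t <= T ->
  (exists M : R, forall x s, Omega x -> 0 < s < T -> enorm (v (x, s)) <= M) ->
  (forall z, (Omega `*` `]0, T[) z -> {for z, continuous (fun z => (v z).1)}) ->
  (forall z, (Omega `*` `]0, T[) z -> {for z, continuous (fun z => (v z).2)}) ->
  exists L : R, [/\ 0 <= L, Linfty_norm Omega t v = L%:E &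
    forall x s, Omega x -> 0 < s < t -> `|(v (x, s)).1| <= L /\ `|(v (x, s)).2| <= L].
Proof.
move=> oO tT [M vM] c1 c2.
have N0 : (0 <= Linfty_norm Omega t v)%E by exact: Lnorm_ge0.
have pos : (0 < mu3 setT)%E.
  apply: lt_le_trans (leb3_ball_gt0 0 ltr01) _.
  by apply: le_measure; rewrite ?inE //; apply: open_measurable3; exact: ball_open.
have E : Linfty_norm Omega t v = ess_sup mu3 (abse \o ((fun z => (enorm (v z))%:E) \_ (Omega `*` `]0, t[))).
  by rewrite /Linfty_norm unlock /= pos.
have e0 x : 0 <= enorm x :> R by exact: sqrtr_ge0.
have NM : (Linfty_norm Omega t v <= `|M|%:E)%E.
  rewrite E; apply/ess_supP; apply: aeW => -[x s] /=; rewrite patchE.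
  case: ifPn => [/[!inE] -[Ox]|_]; last by rewrite (_ : point = 0%E) // abse0 lee_fin.
  rewrite /= in_itv /= => /andP[s0 st]; rewrite lee_fin ger0_norm // (le_trans _ (ler_norm _)) //.
  by apply: vM => //; rewrite s0 (lt_le_trans st).
exists (fine (Linfty_norm Omega t v)).
have NE : Linfty_norm Omega t v \is a fin_num.
  by rewrite ge0_fin_numE //; apply: le_lt_trans NM (ltry _).
split; [exact: fine_ge0|by rewrite fineK|].
set L := fine _.
have ae : \forall z \ae mu3, (Omega `*` `]0, t[) z -> enorm (v z) <= L.
  have := ess_sup_ge mu3 (abse \o ((fun z => (enorm (v z))%:E) \_ (Omega `*` `]0, t[))).
  rewrite -E -(fineK NE); apply: filterS => z /= + Dz.
  by rewrite patchE mem_set //= lee_fin ger0_norm.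
have oD := @open_cylinder R Omega t oO.
have sub z : (Omega `*` `]0, t[) z -> (Omega `*` `]0, T[) z.
  move=> [Oz]; rewrite /= !in_itv /= => /andP[z0 zt]; split => //=.
  by rewrite z0 (lt_le_trans zt).
move=> x s Ox st; have Dz : (Omega `*` `]0, t[) (x, s) by split => //=; rewrite in_itv.
split.
- apply: (@ae_continuous_le _ (fun z => `|(v z).1|) _ L oD ae _ _ (x, s) Dz).
    by move=> z _; have [] := abs_le_enorm (v z).
  by move=> z /sub Dz'; apply: cvg_norm; exact: c1.
- apply: (@ae_continuous_le _ (fun z => `|(v z).2|) _ L oD ae _ _ (x, s) Dz).
    by move=> z _; have [] := abs_le_enorm (v z).
  by move=> z /sub Dz'; apply: cvg_norm; exact: c2.
Qed.

(** A nonincreasing function has its infimum as limit at infinity.  The limit is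
    nonnegative because the domain is unbounded; otherwise the supremum over the empty
    set would be -oo. *)
Lemma decay_limit_bound Omega (t : R) (w : R * R * R -> R) : 0 < t ->
  (forall r : R, exists2 x, Omega x & r <= enorm x) ->
  (decay_limit Omega t w < +oo)%E ->
  exists eps : R, [/\ 0 <= eps, decay_limit Omega t w = eps%:E &
    forall d, 0 < d -> exists r : R, forall x s, Omega x -> r <= enorm x ->
      0 < s < t -> Num.sqrt (enorm x) * `|w (x, s)| <= eps + d].
Proof.
move=> t0 unb eps_fin.
pose A (r : R) := [set (Num.sqrt (enorm z.1) * `|w z|)%:E | z in
         [set z : R * R * R | [/\ Omega z.1, r <= enorm z.1 & 0 < z.2 < t]]].
pose S (r : R) := ereal_sup (A r).
have S0 r : (0 <= S r)%E.
  have [x Ox rx] := unb r.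
  apply: (@le_trans _ _ (Num.sqrt (enorm x) * `|w (x, t / 2)|)%:E).
    by rewrite lee_fin mulr_ge0 ?sqrtr_ge0.
  apply: ereal_sup_ubound; exists (x, t / 2) => //; split => //=.
  by apply/andP; split; lra.
have ni : {homo S : a b / (a <= b)%R >-> (b <= a)%E}.
  move=> a b ab; apply: le_ereal_sup => _ [z [Oz bz zt] <-]; exists z => //.
  by split => //; exact: le_trans bz.
have E : decay_limit Omega t w = ereal_inf (range S).
  by apply: cvg_lim; [exact: ereal_hausdorff|exact: nonincreasing_cvge].
have I0 : (0 <= decay_limit Omega t w)%E.
  by rewrite E; apply: le_ereal_inf_tmp => _ [r _ <-]; exact: S0.
have F : decay_limit Omega t w \is a fin_num by rewrite ge0_fin_numE.
exists (fine (decay_limit Omega t w)); split; [exact: fine_ge0|by rewrite fineK|].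
move=> d d0.
have : (ereal_inf (range S) < (fine (decay_limit Omega t w) + d)%:E)%E.
  by rewrite -E EFinD fineK // lteDl // lte_fin.
move=> /ereal_inf_lt[_ [r _ <-] Sr]; exists r => x s Ox rx st.
rewrite -lee_fin; apply: le_trans (ltW Sr); apply: ereal_sup_ubound.
by exists (x, s).
Qed.

End norms.

(** * The domains *)

Section domains.
Context {R : realType}.
Implicit Types (Omega : set (R * R)).

Lemma far_point (r : R) : 0 <= r -> r <= enorm ((0, r) : R * R).
Proof. by move=> r0; have [_] := abs_le_enorm ((0, r) : R * R); rewrite /= ger0_norm. Qed.

Lemma unbounded_domain Omega :
  Omega = setT \/ exterior_domain Omega \/ perturbed_half_space Omega ->
  forall r : R, exists2 x, Omega x & r <= enorm x.
Proof.
move=> H r; pose q := `|r| + 1.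
have q0 : 0 < q by rewrite /q ltr_wpDl.
have rq : r <= q by rewrite /q (le_trans (ler_norm r)) // lerDl.
case: H => [->|[[_ cO]|[_ [r0 Or]]]].
- by exists (0, q) => //; apply: le_trans rq (far_point (ltW q0)).
- have [M [_ BM]] := compact_bounded cO.
  pose a := q + `|M| + 1.
  have a0 : 0 <= a by rewrite /a !addr_ge0 // ltW.
  exists (0, a); last first.
    apply: le_trans (far_point a0); apply: le_trans rq _.
    by rewrite /a -addrA lerDl addr_ge0.
  apply: contrapT => nO; have := BM (`|M| + 1) _ (0, a) nO.
  rewrite ltr_pwDr ?ler_norm // => /(_ isT); apply/negP; rewrite -ltNge.
  rewrite prod_normE /= lt_max (ger0_norm a0) /a; apply/orP; right.
  by rewrite -[ltLHS]add0r -addrA ltrD2r.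
- pose a := q + `|r0|.
  have a0 : 0 < a by rewrite /a ltr_wpDr.
  exists (0, a); last first.
    by apply: le_trans (far_point (ltW a0)); apply: le_trans rq _; rewrite /a lerDl.
  apply/Or => //; apply: le_trans (far_point (ltW a0)).
  by rewrite /a (le_trans (ler_norm r0)) // lerDr ltW.
Qed.

Lemma open_domain Omega :
  Omega = setT \/ exterior_domain Omega \/ perturbed_half_space Omega -> open Omega.
Proof. by case=> [->|[[[]]|[[]]]] //; exact: openT. Qed.

Lemma smooth_boundary_setT : smooth_boundary (setT : set (R * R)).
Proof. by move=> x [_ []]; rewrite interiorT. Qed.

End domains.

(** * The enstrophy estimate *)

Lemma le_integral_sum_squares d (T : measurableType d) (R : realType)
    (mu : {measure set T -> \bar R}) (D : set T) (a b : T -> R) :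
  measurable D -> measurable_fun D a -> measurable_fun D b ->
  (\int[mu]_(z in D) (a z ^+ 2)%:E <= \int[mu]_(z in D) (a z ^+ 2 + b z ^+ 2)%:E /\
   \int[mu]_(z in D) (b z ^+ 2)%:E <= \int[mu]_(z in D) (a z ^+ 2 + b z ^+ 2)%:E)%E.
Proof.
move=> mD ma mb.
have ma2 := measurable_funX 2 ma; have mb2 := measurable_funX 2 mb.
have mab := measurable_funD ma2 mb2.
by split; apply: ge0_le_integral => //; try exact/measurable_EFinP; move=> z _;
  rewrite lee_fin ?sqr_ge0 ?lerDl ?lerDr ?sqr_ge0.
Qed.

Lemma enorm_grad_square (R : realType) (f : R * R -> R) x (a b : R) :
  'D_e1 f x = a -> 'D_e2 f x = b -> enorm (grad f x) ^+ 2 = a ^+ 2 + b ^+ 2.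
Proof.
move=> <- <-; rewrite /enorm /dot -!expr2 sqr_sqrtr //.
by apply: addr_ge0; exact: sqr_ge0.
Qed.

Section enstrophy.
Context {R : realType}.
Variables (Omega : set (R * R)) (T : R) (v0 : R * R -> R * R) (v : R * R * R -> R * R)
  (p : R * R * R -> R) (nu : R * R -> R * R)
  (sigma : {sigma_finite_measure set (mplane R) -> \bar R}) (t : R).
Hypotheses (oO : open Omega) (unbounded : forall r : R, exists2 x, Omega x & r <= enorm x)
  (smoothO : smooth_boundary Omega)
  (nuP : forall x, boundary Omega x -> outward_normal Omega x (nu x))
  (sigmaP : surface_measure Omega sigma) (T0 : 0 < T)
  (v0L2 : in_L2 Omega (curl v0))
  (sv : smooth_up_to (Omega `*` `]0, T[) (closure Omega `*` `[0, T[) v)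
  (vM : exists M : R, forall x s, Omega x -> 0 < s < T -> enorm (v (x, s)) <= M)
  (NS : navier_stokes Omega T v0 v p) (tT : 0 < t < T).
Let omega := vorticity v.
Hypotheses (eps_fin : (decay_limit Omega t omega < +oo)%E)
  (bflux_int : (sigma \x leb1)%E.-integrable (boundary Omega `*` `]0, t[)
    (EFin \o boundary_flux Omega nu omega))
  (bflux_le0 : (\int[leb1]_(s in `]0%R, t[) \int[sigma]_(x in boundary Omega)
     (boundary_flux Omega nu omega (x, s))%:E <= 0)%E).

Local Notation D := (Omega `*` `]0, T[).
Local Notation E := (closure Omega `*` `[0, T[).

Let mO : measurable (Omega : set (mplane R)). Proof. exact: open_measurable2. Qed.

Let mt : measurable (`]0, t[%classic : set (measurableTypeR R)). Proof. exact: measurable_itv. Qed.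

Let mOt : measurable (Omega `*` `]0, t[ : set (mplane R * measurableTypeR R)).
Proof. exact: measurableX. Qed.

Lemma D_mem x s : Omega x -> 0 < s < T -> D (x, s).
Proof. by move=> Ox sT; split => //=; rewrite in_itv. Qed.

Lemma cylinder_t_sub : Omega `*` `]0, t[ `<=` D.
Proof.
move=> z [Oz]; rewrite /= !in_itv /= => /andP[z0 zt]; split => //=.
by case/andP: tT => _; rewrite z0; exact: lt_trans.
Qed.

Lemma measurable_extension (f g : R * R * R -> R) : {within E, continuous g} ->
  (forall z, D z -> g z = f z) ->
  measurable_fun (Omega `*` `]0, t[ : set (mplane R * measurableTypeR R)) f.
Proof.
move=> cg gE; apply: (eq_measurable_fun g).
  by move=> z /[!inE] /cylinder_t_sub; exact: gE.
apply: within_continuous_measurable3 => //.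
exact: continuous_subspaceW (subset_trans cylinder_t_sub (@cylinder_sub R Omega T)) cg.
Qed.

Lemma L2L2_norm (f g : R * R * R -> R) : {within E, continuous g} ->
  (forall z, D z -> g z = f z) ->
  ('N[@lebesgue_measure R]_(2%:E)[(fun s => L2norm Omega (at_time f s)) \_ `]0%R, t[] ^+ 2 =
   \int[leb3]_(z in Omega `*` `]0%R, t[) (g z ^+ 2)%:E)%E.
Proof.
move=> cg gE; rewrite L2_square //.
have mg : measurable_fun (Omega `*` `]0, t[ : set (mplane R * measurableTypeR R)) (fun z => g z ^+ 2).
  by apply: measurable_funX; exact: (measurable_extension cg).
have [_ <-] := tonelli_space_time mO mt mg (fun z => sqr_ge0 _).
apply: eq_integral => s Hs; have st : 0 < s < t by move: Hs; rewrite inE /= in_itv.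
rewrite gee0_abs ?L2norm_ge0 // L2norm_square //; apply: eq_integral => x /[!inE] Ox.
rewrite /at_time -gE //; apply: cylinder_t_sub; split => //=; by rewrite in_itv.
Qed.

Lemma grad_energy (f f1 f2 : R * R * R -> R) :
  {within E, continuous f1} -> {within E, continuous f2} ->
  (forall z, D z -> f1 z = 'D_dx1 f z) -> (forall z, D z -> f2 z = 'D_dx2 f z) ->
  (\int[leb1]_(s in `]0%R, t[) L2norm Omega (fun x => enorm (grad (at_time f s) x)) ^+ 2 =
   \int[leb3]_(z in Omega `*` `]0%R, t[) (f1 z ^+ 2 + f2 z ^+ 2)%:E)%E.
Proof.
move=> cf1 cf2 f1E f2E.
have mG : measurable_fun (Omega `*` `]0, t[ : set (mplane R * measurableTypeR R))
    (fun z => f1 z ^+ 2 + f2 z ^+ 2).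
  apply: measurable_funD; apply: measurable_funX.
    exact: (measurable_extension cf1).
  exact: (measurable_extension cf2).
have [_ <-] := tonelli_space_time mO mt mG (fun z => addr_ge0 (sqr_ge0 _) (sqr_ge0 _)).
apply: eq_integral => s Hs; have st : 0 < s < t by move: Hs; rewrite inE /= in_itv.
rewrite L2norm_square //; apply: eq_integral => x /[!inE] Ox; congr EFin.
have Dz : D (x, s) by apply: cylinder_t_sub; split => //=; rewrite in_itv.
exact: (enorm_grad_square (etrans (derive_at_time f s x e1) (esym (f1E _ Dz)))
  (etrans (derive_at_time f s x e2) (esym (f2E _ Dz)))).
Qed.

Lemma square_half (f : R * R -> R) : measurable_fun (Omega : set (mplane R)) f ->
  (\int[leb2]_(x in Omega) (f x ^+ 2)%:E = 2%:E * \int[leb2]_(x in Omega) (f x ^+ 2 / 2)%:E)%E.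
Proof.
move=> mf; rewrite -ge0_integralZl_EFin //.
- by apply: eq_integral => x _; rewrite -EFinM; congr EFin; field.
- by move=> x _; rewrite lee_fin divr_ge0 ?sqr_ge0.
- by apply/measurable_EFinP; apply: measurable_funM => //; exact: measurable_funX.
Qed.

Lemma lee_double (x g a : \bar R) (b : R) :
  (0 <= x -> 0 <= g -> 0 <= a -> (0 <= b)%R -> x + g <= a + b%:E ->
   2%:E * x + 2%:E * g <= 2%:E * a + 2%:E * b%:E)%E.
Proof. by move=> x0 g0 a0 b0 H; rewrite -!ge0_muleDr ?lee_fin //; apply: lee_wpmul2l. Qed.

Lemma boundary_flux_traces (w W W1 W2 : R * R * R -> R) x s :
  trace Omega (fun y => 'D_e1 (at_time w s) y) x = W1 (x, s) ->
  trace Omega (fun y => 'D_e2 (at_time w s) y) x = W2 (x, s) ->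
  trace Omega (at_time w s) x = W (x, s) ->
  boundary_flux Omega nu w (x, s) = flux nu W W1 W2 (x, s).
Proof. by rewrite /flux => <- <- <-; rewrite mulrC. Qed.

Lemma measurable_slice (W : R * R * R -> R) s : {within E, continuous W} -> 0 <= s < T ->
  measurable_fun (Omega : set (mplane R)) (fun x => W (x, s)).
Proof.
move=> cW sT; apply: within_continuous_measurable2 => //.
exact: continuous_subspaceW (@subset_closure _ _) (slice_continuous cW sT).
Qed.

Lemma L2norm_slice (W : R * R * R -> R) s : {within E, continuous W} -> 0 <= s < T ->
  (forall x, Omega x -> W (x, s) = omega (x, s)) ->
  (L2norm Omega (at_time omega s) ^+ 2 = 2%:E * \int[leb2]_(x in Omega) (W (x, s) ^+ 2 / 2)%:E)%E.
Proof.
move=> cW sT Ws; rewrite L2norm_square // -square_half; last exact: measurable_slice.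
by apply: eq_integral => x /[!inE] Ox; rewrite Ws.
Qed.

Lemma initial_energy_finite (W : R * R * R -> R) : {within E, continuous W} ->
  (forall x, Omega x -> curl v0 x = W (x, 0)) ->
  (\int[leb2]_(x in Omega) (W (x, 0) ^+ 2 / 2)%:E < +oo)%E.
Proof.
move=> cW curl0; have [_ fin] := v0L2.
have mW : measurable_fun (Omega : set (mplane R)) (fun x => W (x, 0)).
  by apply: measurable_slice => //; rewrite lexx.
have : (L2norm Omega (curl v0) ^+ 2 < +oo)%E.
  have := fin; have := L2norm_ge0 Omega (curl v0).
  by case: (L2norm _ _) => // r _ _; rewrite -EFin_expe ltry.
rewrite L2norm_square //; apply: le_lt_trans; apply: ge0_le_integral => //.
- by move=> x _; rewrite lee_fin divr_ge0 ?sqr_ge0.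
- by apply/measurable_EFinP; apply: measurable_funM => //; apply: measurable_funX.
- by apply/measurable_EFinP; apply: measurable_funX; have [] := v0L2.
- by move=> x Ox; rewrite lee_fin curl0 // ler_pdivrMr //; have := sqr_ge0 (W (x, 0)); lra.
Qed.

Lemma bounded_slices (W : R * R * R -> R) (C : R) : {within E, continuous W} ->
  (forall z, D z -> W z = omega z) ->
  (forall s, 0 < s < t -> (\int[leb2]_(x in Omega) (W (x, s) ^+ 2 / 2)%:E <= C%:E)%E) ->
  in_LqL2 +oo Omega t omega.
Proof.
have [t0 tT'] := andP tT.
move=> cW WE sliceC; split; first exact: measurable_extension cW WE.
rewrite unlock /=; case: ifPn => // _.
apply: le_lt_trans (ltry (1 + 2 * `|C|)); apply/ess_supP; apply: aeW => s /=.
rewrite patchE; case: ifPn => [/[!inE]|_]; last first.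
  by rewrite (_ : point = 0%E) // abse0 lee_fin addr_ge0 ?mulr_ge0.
rewrite /= in_itv /= => st; rewrite gee0_abs ?L2norm_ge0 //.
have sT : 0 < s < T by case/andP: st => -> st; rewrite (lt_trans st).
have sT0 : 0 <= s < T by rewrite ltW //; case/andP: sT.
apply: le_square_bound (L2norm_ge0 _ _).
rewrite (L2norm_slice cW sT0 (fun x Ox => WE _ (D_mem Ox sT))).
apply: (@le_trans _ _ (2%:E * (`|C|)%:E)%E); last by rewrite -EFinM.
apply: lee_wpmul2l; first by rewrite lee_fin.
by apply: le_trans (sliceC s st) _; rewrite lee_fin ler_norm.
Qed.

(** The continuous extensions W, W1 and W2 of the vorticity and of its gradient
    satisfy the hypotheses of the global energy inequality; W is built from the
    extensions of the derivatives of v so that it is the curl of v at time 0 as well. *)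
Lemma vorticity_energy : exists W W1 W2 : R * R * R -> R, exists L eps C : R,
  [/\ [/\ {within E, continuous W}, {within E, continuous W1} & {within E, continuous W2}],
      [/\ forall z, D z -> W z = omega z, forall z, D z -> W1 z = 'D_dx1 omega z,
          forall z, D z -> W2 z = 'D_dx2 omega z & forall x, Omega x -> W (x, 0) = omega (x, 0)],
      [/\ 0 <= L, Linfty_norm Omega t v = L%:E & decay_limit Omega t omega = eps%:E],
      (forall s, 0 < s < t -> (\int[leb2]_(x in Omega) (W (x, s) ^+ 2 / 2)%:E <= C%:E)%E) &
      (\int[leb2]_(x in Omega) (W (x, t) ^+ 2 / 2)%:E
         + \int[leb3]_(z in Omega `*` `]0%R, t[) (W1 z ^+ 2 + W2 z ^+ 2)%:E
       <= \int[leb2]_(x in Omega) (W (x, 0) ^+ 2 / 2)%:E + (t * (64 * L) * eps ^+ 2)%:E)%E /\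
      (\int[leb3]_(z in Omega `*` `]0%R, t[) (W1 z ^+ 2 + W2 z ^+ 2)%:E < +oo)%E].
Proof.
have [t0 tT'] := andP tT.
have oD := @open_cylinder R Omega T oO.
have DE := @cylinder_sub R Omega T.
pose v1 z := (v z).1; pose v2 z := (v z).2.
have [sv1 sv2] : smooth_ext D E v1 /\ smooth_ext D E v2 by exact: smooth_up_to_components.
have so : smooth_ext D E omega by exact: smooth_vorticity.
have cv : {within E, continuous v} by have [] := sv.
have cv1 : {within E, continuous v1}.
  by move=> z; apply: (cvg_comp _ _ (cv z)); exact: cvg_fst.
have cv2 : {within E, continuous v2}.
  by move=> z; apply: (cvg_comp _ _ (cv z)); exact: cvg_snd.
have ext f s : smooth_ext D E f -> exists2 g : R * R * R -> R, {within E, continuous g} &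
    forall z, D z -> g z = iter_derive s f z.
  by move=> /(_ s)[].
have [u11 cu11 u11E] := ext _ [:: dx1] sv1; have [u12 cu12 u12E] := ext _ [:: dx2] sv1.
have [u21 cu21 u21E] := ext _ [:: dx1] sv2; have [u22 cu22 u22E] := ext _ [:: dx2] sv2.
have [W1 cW1 W1E] := ext _ [:: dx1] so; have [W2 cW2 W2E] := ext _ [:: dx2] so.
have [W11 cW11 W11E] := ext _ [:: dx1; dx1] so; have [W12 cW12 W12E] := ext _ [:: dx2; dx1] so.
have [W21 cW21 W21E] := ext _ [:: dx1; dx2] so; have [W22 cW22 W22E] := ext _ [:: dx2; dx2] so.
have [Wt cWt WtE] := ext _ [:: dt] so.
pose W z := u21 z - u12 z.
have cW : {within E, continuous W} by exact: within_continuousB.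
have WE z : D z -> W z = omega z.
  by move=> Dz; rewrite /W u21E // u12E // /omega vorticityE.
have W0 x : Omega x -> W (x, 0) = omega (x, 0).
  move=> Ox; rewrite /omega vorticityE /W.
  by rewrite -(derive_initial oO T0 sv2 cv2 cu21 u21E Ox) -(derive_initial oO T0 sv1 cv1 cu12 u12E Ox).
have curl0 x : Omega x -> curl v0 x = W (x, 0).
  move=> Ox; rewrite W0 // /omega /vorticity /curl /=.
  have [_ _ _ v00] := NS.
  by congr (_ - _); apply: (@derive_eq_on R _ Omega oO R _ _ _ x _ Ox) => y Oy; rewrite /at_time v00.
have C1 f g g1 g2 (sf : smooth_ext D E f) cg cg1 cg2 gE g1E g2E s sT :=
  @slice_C1_closure R Omega T oO f g g1 g2 s sf cg cg1 cg2 gE g1E g2E sT.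
have CW := C1 _ _ _ _ so cW cW1 cW2 WE W1E W2E.
have CW1 := C1 _ _ _ _ (smooth_ext_derive dx1 so) cW1 cW11 cW12 W1E W11E W12E.
have CW2 := C1 _ _ _ _ (smooth_ext_derive dx2 so) cW2 cW21 cW22 W2E W21E W22E.
have Cu1 := C1 _ _ _ _ sv1 cv1 cu11 cu12 (fun z _ => erefl) u11E u12E.
have Cu2 := C1 _ _ _ _ sv2 cv2 cu21 cu22 (fun z _ => erefl) u21E u22E.
have dW x s Ox sT := @slice_time_derive R Omega T omega W Wt x s so WE WtE Ox sT.
have eqW x s : Omega x -> 0 < s < T ->
    Wt (x, s) = W11 (x, s) + W22 (x, s) - (v1 (x, s) * W1 (x, s) + v2 (x, s) * W2 (x, s)).
  move=> Ox sT; have Dz := D_mem Ox sT.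
  by rewrite WtE // W11E // W22E // W1E // W2E //; exact: (vorticity_equation oO sv NS Dz).
have divu x s : Omega x -> 0 < s < T -> u11 (x, s) + u22 (x, s) = 0.
  move=> Ox sT; have Dz := D_mem Ox sT.
  by rewrite u11E // u22E //; exact: (divergence_free NS Dz).
have u0 x s : boundary Omega x -> 0 < s < T -> v1 (x, s) = 0 /\ v2 (x, s) = 0.
  by move=> bx sT; have [_ _ vb _] := NS; rewrite /v1 /v2 vb.
have fluxE x s : boundary Omega x -> 0 < s < t ->
    boundary_flux Omega nu omega (x, s) = flux nu W W1 W2 (x, s).
  move=> [clx _] /andP[s0 st]; have sT : 0 < s < T by rewrite s0 (lt_trans st).
  have sT0 : 0 <= s < T by rewrite ltW //; case/andP: sT.
  apply: boundary_flux_traces.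
  - apply: (@traceE R Omega _ (fun y => W1 (y, s)) x (slice_continuous cW1 sT0) _ clx) => y Oy.
    by rewrite (derive_at_time omega s y e1) W1E //; exact: D_mem.
  - apply: (@traceE R Omega _ (fun y => W2 (y, s)) x (slice_continuous cW2 sT0) _ clx) => y Oy.
    by rewrite (derive_at_time omega s y e2) W2E //; exact: D_mem.
  - apply: (@traceE R Omega _ (fun y => W (y, s)) x (slice_continuous cW sT0) _ clx) => y Oy.
    by rewrite WE //; exact: D_mem.
have mb : measurable (boundary Omega : set (mplane R)) by exact: measurable_boundary.
have flux_int : (sigma \x leb1)%E.-integrable (boundary Omega `*` `]0, t[) (EFin \o flux nu W W1 W2).
  apply: eq_integrable bflux_int; first exact: measurableX.
  by move=> [x s] /[!inE] -[bx]; rewrite /= in_itv /= => st; rewrite fluxE.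
have flux_le0 : (\int[leb1]_(s in `]0%R, t[) \int[sigma]_(x in boundary Omega)
    (flux nu W W1 W2 (x, s))%:E <= 0)%E.
  apply: le_trans bflux_le0; rewrite le_eqVlt; apply/orP; left; apply/eqP.
  apply: eq_integral => s /[!inE]; rewrite /= in_itv /= => st.
  by apply: eq_integral => x /[!inE] bx; rewrite fluxE.
have [L [L0 LE uL]] : exists L : R, [/\ 0 <= L, Linfty_norm Omega t v = L%:E &
    forall x s, Omega x -> 0 < s < t -> `|(v (x, s)).1| <= L /\ `|(v (x, s)).2| <= L].
  apply: (Linfty_norm_bound oO (ltW tT') vM) => z Dz.
    exact: (smooth_ext_continuous oD DE sv1 Dz).
  exact: (smooth_ext_continuous oD DE sv2 Dz).
have [eps [eps0 epsE dec]] := decay_limit_bound t0 unbounded eps_fin.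
have Wdec d : 0 < d -> decay_bound Omega W t (eps + d).
  move=> /dec[r Hr]; exists r => x s Ox rx st; rewrite WE; first exact: Hr.
  by apply: D_mem => //; case/andP: st => -> st; rewrite (lt_trans st).
have A0 := initial_energy_finite cW curl0.
have [glob G_fin] := global_energy oO nuP sigmaP smoothO cW cW1 cW2 cWt CW CW1 CW2 Cu1 Cu2
  dW eqW divu u0 t0 tT' L0 uL flux_int A0 flux_le0 eps0 Wdec.
have [C sliceC] := slice_energy_bound oO nuP sigmaP smoothO cW cW1 cW2 cWt CW CW1 CW2 Cu1 Cu2
  dW eqW divu u0 tT' L0 uL flux_int A0 (Wdec 1 ltr01).
exists W, W1, W2, L, eps, C.
exact (And5 (And3 cW cW1 cW2) (And4 WE W1E W2E W0) (And3 L0 LE epsE) sliceC (conj glob G_fin)).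
Qed.

Theorem enstrophy_estimate :
  [/\ in_LqL2 +oo Omega t omega,
      in_LqL2 2%:E Omega t (fun z => 'D_e1 (at_time omega z.2) z.1),
      in_LqL2 2%:E Omega t (fun z => 'D_e2 (at_time omega z.2) z.1) &
      (L2norm Omega (at_time omega t) ^+ 2
         + 2%:E * \int[leb1]_(s in `]0%R, t[)
             L2norm Omega (fun x => enorm (grad (at_time omega s) x)) ^+ 2
       <= L2norm Omega (at_time omega 0) ^+ 2
          + (128 * t)%:E * Linfty_norm Omega t v * decay_limit Omega t omega ^+ 2)%E].
Proof.
have [t0 tT'] := andP tT.
have [W [W1 [W2 [L [eps [C [[cW cW1 cW2] [WE W1E W2E W0] [L0 LE epsE] sliceC [glob G_fin]]]]]]]] :=
  vorticity_energy.
have tT0 : 0 <= t < T by rewrite ltW.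
have zT0 : (0 : R) <= 0 < T by rewrite lexx.
have gradE1 : (fun z => 'D_e1 (at_time omega z.2) z.1) = 'D_dx1 omega.
  by apply/funext => z; rewrite (derive_at_time omega) -surjective_pairing.
have gradE2 : (fun z => 'D_e2 (at_time omega z.2) z.1) = 'D_dx2 omega.
  by apply/funext => z; rewrite (derive_at_time omega) -surjective_pairing.
have [W1_le W2_le] := @le_integral_sum_squares _ _ R leb3 (Omega `*` `]0, t[) W1 W2 mOt
  (measurable_extension cW1 (fun z _ => erefl)) (measurable_extension cW2 (fun z _ => erefl)).
split.
- exact: bounded_slices cW WE sliceC.
- rewrite gradE1; split; first exact: measurable_extension cW1 W1E.
  apply: lty_square (Lnorm_ge0 _ _ _); rewrite (L2L2_norm cW1 W1E).
  exact: le_lt_trans W1_le G_fin.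
- rewrite gradE2; split; first exact: measurable_extension cW2 W2E.
  apply: lty_square (Lnorm_ge0 _ _ _); rewrite (L2L2_norm cW2 W2E).
  exact: le_lt_trans W2_le G_fin.
- rewrite (L2norm_slice cW tT0 (fun x Ox => WE _ (D_mem Ox tT))).
  rewrite (L2norm_slice cW zT0 W0).
  rewrite (grad_energy cW1 cW2 W1E W2E).
  have X0 s : (0 <= \int[leb2]_(x in Omega) (W (x, s) ^+ 2 / 2)%:E)%E.
    by apply: integral_ge0 => x _; rewrite lee_fin divr_ge0 ?sqr_ge0.
  have G0 : (0 <= \int[leb3]_(z in Omega `*` `]0%R, t[) (W1 z ^+ 2 + W2 z ^+ 2)%:E)%E.
    by apply: integral_ge0 => z _; rewrite lee_fin addr_ge0 ?sqr_ge0.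
  have B0 : 0 <= t * (64 * L) * eps ^+ 2.
    by apply: mulr_ge0; [apply: mulr_ge0; [exact: ltW|apply: mulr_ge0]|exact: sqr_ge0].
  have -> : ((128 * t)%:E * Linfty_norm Omega t v * decay_limit Omega t omega ^+ 2 =
      2%:E * (t * (64 * L) * eps ^+ 2)%:E)%E.
    by rewrite LE epsE -EFin_expe -!EFinM; congr EFin; ring.
  exact: lee_double (X0 t) G0 (X0 0) B0 glob.
Qed.

End enstrophy.

Theorem theorem1p6 (R : realType) :
  exists2 C0 : R, 0 < C0 &
  forall (Omega : set (R * R)) (T : R)
    (v0 : R * R -> R * R) (v : R * R * R -> R * R) (p : R * R * R -> R)
    (nu : R * R -> R * R)
    (sigma : {sigma_finite_measure set (mplane R) -> \bar R}) (t : R),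
  Omega = setT \/
    ((exterior_domain Omega \/ perturbed_half_space Omega) /\ smooth_boundary Omega) ->
  (forall x, boundary Omega x -> outward_normal Omega x (nu x)) ->
  surface_measure Omega sigma ->
  0 < T ->
  in_L2 Omega (curl v0) ->
  smooth_up_to (Omega `*` `]0, T[) (closure Omega `*` `[0, T[) v ->
  (exists M : R, forall x s, Omega x -> 0 < s < T -> enorm (v (x, s)) <= M) ->
  navier_stokes Omega T v0 v p ->
  0 < t < T ->
  let omega := vorticity v in
  let epsilon := decay_limit Omega t omega in
  (epsilon < +oo)%E ->
  (sigma \x leb1)%E.-integrable (boundary Omega `*` `]0, t[)
    (EFin \o boundary_flux Omega nu omega) ->
  (\int[leb1]_(s in `]0%R, t[) \int[sigma]_(x in boundary Omega)
     (boundary_flux Omega nu omega (x, s))%:E <= 0)%E ->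
  [/\ in_LqL2 +oo Omega t omega,
      in_LqL2 2%:E Omega t (fun z => 'D_e1 (at_time omega z.2) z.1),
      in_LqL2 2%:E Omega t (fun z => 'D_e2 (at_time omega z.2) z.1) &
      (L2norm Omega (at_time omega t) ^+ 2
         + 2%:E * \int[leb1]_(s in `]0%R, t[)
             L2norm Omega (fun x => enorm (grad (at_time omega s) x)) ^+ 2
       <= L2norm Omega (at_time omega 0) ^+ 2
          + (C0 * t)%:E * Linfty_norm Omega t v * epsilon ^+ 2)%E].
Proof.
(* twice the constant 64 of global_energy, whose energies carry a factor 1 / 2 *)
exists 128 => //.
move=> Omega T v0 v p nu sigma t domO nuP sigmaP T0 v0L2 sv vM NS tT omega epsilon.
move=> eps_fin bflux_int bflux_le0.
have domO' : Omega = setT \/ exterior_domain Omega \/ perturbed_half_space Omega.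
  by case: domO => [->|[]]; [left|right].
have smoothO : smooth_boundary Omega.
  by case: domO => [->|[]//]; exact: smooth_boundary_setT.
exact: (enstrophy_estimate (open_domain domO') (unbounded_domain domO') smoothO nuP sigmaP T0
  v0L2 sv vM NS tT eps_fin bflux_int bflux_le0).
Qed.
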